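(* Let $\Omega$ be a bounded Borel subset of $\mathbb{R}$ with $|\Omega|=1$ and let $p\in\mathbb{N}$, $p\ge 1$. Suppose that $\Omega$ $p$-tiles $\mathbb{R}$ by $\frac1p\mathbb{Z}$. Then: (a) For a.e. $x\in\mathbb{R}$ the set $\Omega_x:=\{k\in\mathbb{Z}: x+\frac kp\in\Omega\}$ has exactly $p$ elements, $\Omega_x=\{k_0(x)<k_1(x)<\dots<k_{p-1}(x)\}$. (b) For a.e. $x\in\Omega$ there exist unique $y\in[0,\frac1p)$ and $i\in\{0,\dots,p-1\}$ such that $y+\frac{k_i(y)}p=x$. (c) $k_i(x+\frac1p)=k_i(x)-1$ for a.e. $x\in\mathbb{R}$ and all $i=0,\dots,p-1$. (d) The operator $W:L^2(\Omega)\to L^2([0,\frac1p),\mathbb{C}^p)$ defined by $$(Wf)(x)=\left(f\left(x+\tfrac{k_0(x)}p\right),\dots,f\left(x+\tfrac{k_{p-1}(x)}p\right)\right)^t,\qquad x\in[0,\tfrac1p),$$ is an isometric isomorphism with inverse given by $$W^{-1}(f_0,\dots,f_{p-1})^t(x)=f_i(y)\quad\text{if } x=y+\tfrac{k_i(y)}p \text{ with } y\in[0,\tfrac1p),\ i\in\{0,\dots,p-1\}.$$ (e) A set $\Lambda$ of the form $\Lambda=\{0=\lambda_0,\lambda_1,\dots,\lambda_{p-1}\}+p\mathbb{Z}$ is a spectrum for $\Omega$ if and only if $\{\lambda_0,\dots,\lambda_{p-1}\}$ is a spectrum for $\frac1p\Omega_x$ for a.e. $x\in[0,\frac1p)$.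 (f) For $\Lambda$ of this form, the exponential functions are mapped by $W$ as follows: for $i=0,\dots,p-1$, $n\in\mathbb{Z}$, $x\in[0,\frac1p)$, $$(We_{\lambda_i+np})(x)=e_{\lambda_i+np}(x)\left(e_{\lambda_i}\left(\tfrac{k_0(x)}p\right),\dots,e_{\lambda_i}\left(\tfrac{k_{p-1}(x)}p\right)\right)^t .$$ (g) Suppose that $\Lambda=\{0=\lambda_0,\lambda_1,\dots,\lambda_{p-1}\}+p\mathbb{Z}$ is a spectrum for $\Omega$ and let $U_\Lambda$ be the group of local translations on $\Omega$ associated to $\Lambda$. For (a.e.) $x\in\mathbb{R}$ let $\mathcal{M}_x$ be the $p\times p$ unitary matrix with column vectors $v_i(x)=\frac1{\sqrt p}\left(e_{\lambda_i}(\frac{k_0(x)}p),\dots,e_{\lambda_i}(\frac{k_{p-1}(x)}p)\right)^t$, $i=0,\dots,p-1$, and consider the one-parameter unitary group $\mathcal{U}_p$ on $L^2([0,\frac1p),\mathbb{C}^p)$ defined by $$(\mathcal{U}_p(t)F)(x)=\mathcal{M}_x\mathcal{M}_{x+t}^*F(x+t),\qquad x,t\in\mathbb{R}.$$ Then $W$ intertwines $U_\Lambda$ and $\mathcal{U}_p$: $WU_\Lambda(t)=\mathcal{U}_p(t)W$ for all $t\in\mathbb{R}$.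
   Context: $|\Omega|$ is Lebesgue measure; $e_\lambda(x)=e^{2\pi \mathrm{i}\lambda x}$ for $\lambda,x\in\mathbb{R}$. $\Omega$ $p$-tiles $\mathbb{R}$ by $\frac1p\mathbb{Z}$ if for almost every $x\in\mathbb{R}$ there exist exactly $p$ integers $j$ such that $x\in\Omega+\frac jp$. A Borel set $\Omega$ of finite positive measure has spectrum $\Lambda\subset\mathbb{R}$ if $\{|\Omega|^{-1/2}e_\lambda:\lambda\in\Lambda\}$ is an orthonormal basis of $L^2(\Omega)$. A finite set $A\subset\mathbb{R}$ has spectrum $\Gamma\subset\mathbb{R}$ if $\{e_\gamma:\gamma\in\Gamma\}$ is an orthogonal basis of $L^2(\mu)$ where $\mu=\frac1{|A|}\sum_{a\in A}\delta_a$ (here $|A|$ is cardinality). $L^2([0,\frac1p),\mathbb{C}^p)$ (Lebesgue measure on $[0,\frac1p)$) is identified with the space of $\frac1p$-periodic $\mathbb{C}^p$-valued functions on $\mathbb{R}$ that are square integrable over a period; in particular $F(x+t)$ makes sense for all $x,t$. If $\Omega$ has spectrum $\Lambda$, the associated group of local translations $U_\Lambda$ is the strongly continuous one-parameter unitary group on $L^2(\Omega)$ determined by $U_\Lambda(t)e_\lambda=e^{2\pi \mathrm{i}\lambda t}e_\lambda$ for $\lambda\in\Lambda$, $t\in\mathbb{R}$. *)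

(* Defs.v *)
Set Warnings "-notation-incompatible-prefix,-notation-overridden,-ambiguous-paths".
From HB Require Import structures.
From mathcomp Require Import all_boot all_order all_algebra.
From mathcomp Require Import sesquilinear spectral finmap complex.
From mathcomp Require Import all_classical all_reals all_analysis.

Set Implicit Arguments.
Unset Strict Implicit.
Unset Printing Implicit Defensive.

Import Order.TTheory GRing.Theory Num.Theory.
Import numFieldNormedType.Exports.

Local Open Scope classical_set_scope.
Local Open Scope card_scope.
Local Open Scope ring_scope.
Local Open Scope complex_scope.
Local Open Scope sesquilinear_scope.

(* A Hilbert space of classes of functions, presented by representatives:
   [hmem] is the set of representatives, [heqv] is equality of classes (almost
   everywhere equality in the instances below) and [hip] is the inner product,
   linear in its first argument. Operators between such spaces are plain
   functions on representatives; the predicates below require them to preserve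
   [hmem] and [heqv], and constrain their values only on [hmem]. *)
Record hspace (C : numClosedFieldType) := HSpace {
  hvec : lmodType C;
  hmem : set hvec;
  heqv : hvec -> hvec -> Prop;
  hip : hvec -> hvec -> C }.

Arguments hmem {C} h _.
Arguments heqv {C} h _ _.
Arguments hip {C} h _ _.

Section HilbertSpaces.
Variable R : realType.
Local Notation C := R[i].
Implicit Types H K : hspace C.

Definition hnorm H (f : hvec H) : R := Num.sqrt (complex.Re (hip H f f)).

Section Families.
Variables (H : hspace C) (I : choiceType) (S : set I) (e : I -> hvec H).

Definition total_family : Prop :=
  forall f, hmem H f -> forall eps : R, 0 < eps ->
    exists (s : seq I) (c : I -> C),
      (forall i, i \in s -> S i) /\ hnorm (f - \sum_(i <- s) c i *: e i) < eps.

Definition orthogonal_basis : Prop :=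
  [/\ (forall i, S i -> hmem H (e i) /\ hip H (e i) (e i) <> 0),
      (forall i j, S i -> S j -> i <> j -> hip H (e i) (e j) = 0) &
      total_family].

Definition orthonormal_basis : Prop :=
  orthogonal_basis /\ forall i, S i -> hip H (e i) (e i) = 1.

End Families.

Definition operator H K (A : hvec H -> hvec K) : Prop :=
  (forall f, hmem H f -> hmem K (A f)) /\
  (forall f g, hmem H f -> hmem H g -> heqv H f g -> heqv K (A f) (A g)).

Definition linear_isometry H K (A : hvec H -> hvec K) : Prop :=
  [/\ operator A,
      (forall (a : C) f g, hmem H f -> hmem H g ->
         heqv K (A (a *: f + g)) (a *: A f + A g)) &
      (forall f, hmem H f -> hnorm (A f) = hnorm f)].

Definition inverse_operators H K (A : hvec H -> hvec K) (B : hvec K -> hvec H)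
    : Prop :=
  [/\ operator A, operator B,
      (forall f, hmem H f -> heqv H (B (A f)) f) &
      (forall g, hmem K g -> heqv K (A (B g)) g)].

Definition isometric_isomorphism H K (A : hvec H -> hvec K) : Prop :=
  linear_isometry A /\ exists B : hvec K -> hvec H, inverse_operators A B.

Definition sc_unitary_group H (U : R -> hvec H -> hvec H) : Prop :=
  [/\ (forall t, isometric_isomorphism (U t)),
      (forall f, hmem H f -> heqv H (U 0 f) f),
      (forall s t f, hmem H f -> heqv H (U (s + t) f) (U s (U t f))) &
      (forall f, hmem H f -> forall t,
         hnorm (U s f - U t f) @[s --> t] --> (0 : R))].

End HilbertSpaces.

Arguments orthogonal_basis {R} H {I} S e.
Arguments orthonormal_basis {R} H {I} S e.
Arguments inverse_operators {R} H K A B.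
Arguments isometric_isomorphism {R} H K A.
Arguments sc_unitary_group {R} H U.

Section L2.
Context {d : measure_display} {T : measurableType d} {R : realType}.
Local Notation C := R[i].
Variables (mu : {measure set T -> \bar R}) (D : set T).

Definition cmeasurable (f : T -> C) : Prop :=
  measurable_fun setT (fun x => complex.Re (f x)) /\
  measurable_fun setT (fun x => complex.Im (f x)).

Definition cintegral (f : T -> C) : C :=
  (\int[mu]_(x in D) complex.Re (f x)) +i* (\int[mu]_(x in D) complex.Im (f x)).

(* Every class of L^2(D) has a representative that is measurable on the whole
   space (extend it by 0), and only values on D matter for [heqv] and [hip]. *)
Definition L2 : hspace C :=
  {| hvec := T -> C^o;
     hmem := [set f : T -> C^o | cmeasurable f /\
       (\int[mu]_(x in D) ((ComplexField.Normc.normc (f x)) ^+ 2)%:E < +oo)%E];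
     heqv := fun f g => f = g %[ae mu in D];
     hip := fun f g => cintegral (fun x => f x * (g x)^*) |}.

Definition L2vec (n : nat) : hspace C :=
  {| hvec := T -> 'cV[C]_n;
     hmem := [set F : T -> 'cV[C]_n |
       forall i, hmem L2 (fun x => F x i ord0)];
     heqv := fun F G => F = G %[ae mu in D];
     hip := fun F G => \sum_(i < n)
       hip L2 (fun x => F x i ord0) (fun x => G x i ord0) |}.

End L2.

Section Spectra.
Variable R : realType.
Local Notation C := R[i].
Local Notation leb := (@lebesgue_measure R).

Definition e_ (lam x : R) : C :=
  cos (2 * pi * (lam * x)) +i* sin (2 * pi * (lam * x)).

Definition spectrum (Omega Lam : set R) : Prop :=
  orthonormal_basis (L2 leb Omega) Lam
    (fun lam x => (Num.sqrt (fine (leb Omega)))^-1%:C * e_ lam x).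

Definition uniform_measure (A : set R) :
    {measure set (measurableTypeR R) -> \bar R} :=
  let s : seq R := fset_set A in
  mscale ((size s)%:R^-1)%:nng
    (msum (fun n => \d_(nth 0 s n : measurableTypeR R)) (size s)).

Definition finite_spectrum (A Gam : set R) : Prop :=
  finite_set A /\
  orthogonal_basis (L2 (uniform_measure A) setT) Gam e_.

(* The strongly continuous unitary group U_Lam is only determined up to the
   choice of representatives, hence a predicate on U. *)
Definition local_translations (Omega Lam : set R)
    (U : R -> (R -> C^o) -> (R -> C^o)) : Prop :=
  sc_unitary_group (L2 leb Omega) U /\
  forall lam t, Lam lam ->
    heqv (L2 leb Omega) (U t (e_ lam)) (e_ lam t *: (e_ lam : R -> C^o)).

End Spectra.

Section Tiling.
Variables (R : realType) (Omega : set R) (p : nat).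
Local Notation C := R[i].
Local Notation leb := (@lebesgue_measure R).

Definition p_tiles : Prop :=
  {ae leb, forall x : R,
    [set j : int | [set w + j%:~R / p%:R | w in Omega] x] #= `I_p}.

Definition fiber (x : R) : set int := [set k | Omega (x + k%:~R / p%:R)].

Definition scaled_fiber (x : R) : set R :=
  [set k%:~R / p%:R | k in fiber x].

(* Junk value 0 when the fiber is infinite or has at most i elements. *)
Definition k_ (i : nat) (x : R) : int :=
  nth 0 (sort <=%R (fset_set (fiber x))) i.

Definition cell : set R := [set` `[0%R, (p%:R)^-1[].

Definition L2Omega : hspace C := L2 leb Omega.

Definition L2cell : hspace C := L2vec leb cell p.

Definition W (f : R -> C^o) (x : R) : 'cV[C]_p :=
  \col_(i < p) f (x + (k_ i x)%:~R / p%:R).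

(* The identification of L^2(cell, C^p) with periodic functions: the
   1/p-periodic function that agrees with F on cell. *)
Definition periodize (F : R -> 'cV[C]_p) (x : R) : 'cV[C]_p :=
  F (x - (Num.floor (x * p%:R))%:~R / p%:R).

Variable lam : 'I_p -> R.

Definition spectrum_form : set R :=
  [set l | exists (i : 'I_p) (n : int), l = lam i + n%:~R * p%:R].

Definition v_ (i : 'I_p) (x : R) : 'cV[C]_p :=
  (Num.sqrt (p%:R : R))^-1%:C *: \col_(j < p) e_ (lam i) ((k_ j x)%:~R / p%:R).

Definition M_ (x : R) : 'M[C]_p := \matrix_(j < p, i < p) v_ i x j ord0.

Definition Up (t : R) (F : R -> 'cV[C]_p) (x : R) : 'cV[C]_p :=
  M_ x *m (M_ (x + t))^t* *m periodize F (x + t).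

End Tiling.

Arguments W {R} Omega p f x.
Arguments M_ {R} Omega {p} lam x.
Arguments Up {R} Omega {p} lam t F x.
Arguments periodize {R p} F x.
Arguments spectrum_form {R p} lam _.

(* Main.v *)
Require Import Defs.
Set Warnings "-notation-incompatible-prefix,-notation-overridden,-ambiguous-paths".
From HB Require Import structures.
From mathcomp Require Import all_boot all_order all_algebra.
From mathcomp Require Import sesquilinear spectral finmap complex.
From mathcomp Require Import all_classical all_reals all_analysis.
From mathcomp Require Import measurable_realfun ring lra zify.

Set Implicit Arguments.
Unset Strict Implicit.
Unset Printing Implicit Defensive.

Import Order.TTheory GRing.Theory Num.Theory.
Import numFieldNormedType.Exports.

Local Open Scope classical_set_scope.
Local Open Scope card_scope.
Local Open Scope ring_scope.

(* W maps e_(lam i + n p) to sqrt p e_(lam i + n p) v_i, and the e_(n p) are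
   complete and orthogonal on [0, 1/p). Hence the Fourier coefficients of
   e_(lam i - lam j) <v_i, v_j> are the inner products of exponentials on Omega,
   so that Lam is a spectrum iff the frame (v_i(x)) is orthonormal, i.e. M_x is
   unitary, for a.e. x; this in turn says that {lam i} is a spectrum of the fiber
   at x. Completeness of the e_(n p) needs no Stone-Weierstrass theorem: the sets
   whose indicator is an L^2-limit of trigonometric polynomials form a
   sigma-algebra, which contains the rays.
   Finally U_p(t) acts on W e_l, for l in Lam, as multiplication by e_l(t), because
   M_(x+t)^* v_i(x+t) is the i-th unit vector; totality of the W e_l then gives
   the strong continuity of U_p and W U(t) = U_p(t) W. *)

(** * Hilbert spaces of representatives *)

(** Functions are kept as representatives, so operators are linear and invertible only up to [heqv];
    the arguments about norms therefore go through the axioms of [prehilbert]. A second obstacle is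
    that [spectrum_form lam] and [range lam] are sets: they do not record whether two indices give
    the same class mod p, or the same number. Orthogonality says nothing about such a pair, so it
    has to be excluded by completeness and a dimension count, on Omega through a trace and on a
    finite fiber through a determinant. The factor sqrt p comes from two normalisations: v_i(x) is a
    unit vector, while the cell has measure 1/p. Unitarity is obtained on the cell; it passes to all
    of R because k_j(x + n/p) = k_j(x) - n multiplies column i of M_x by a phase that depends only
    on i and n. Such phases change neither unitarity nor M_x M_(x+t)^*, which makes U_p meaningful
    on periodic functions. *)

Section PreHilbert.
Variable R : realType.
Local Notation C := R[i].
Local Notation Re := complex.Re.
Local Notation Im := complex.Im.
Local Notation normc := ComplexField.Normc.normc.
Implicit Types H K L : hspace C.

(** Common interface of [L2], [L2vec] and [column_space], so that the operator arguments are made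
    once. [heqv] stands where a quotient would have equality; [ph_hip] covers the first argument of
    the product, and the second follows by [ph_conj]. *)
Record prehilbert H : Prop := PreHilbert {
  ph0 : hmem H 0;
  phP : forall (a : C) f g, hmem H f -> hmem H g -> hmem H (a *: f + g);
  ph_lin : forall (a : C) f g h, hmem H f -> hmem H g -> hmem H h ->
    hip H (a *: f + g) h = a * hip H f h + hip H g h;
  ph_conj : forall f g, hmem H f -> hmem H g -> hip H g f = (hip H f g)^*;
  ph_ge0 : forall f, hmem H f -> 0 <= hip H f f;
  ph_refl : forall f, heqv H f f;
  ph_sym : forall f g, heqv H f g -> heqv H g f;
  ph_trans : forall f g h, heqv H f g -> heqv H g h -> heqv H f h;
  ph_eqvP : forall (a : C) f f' g g', heqv H f f' -> heqv H g g' ->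
    heqv H (a *: f + g) (a *: f' + g');
  ph_hip : forall f f' g, hmem H f -> hmem H f' -> hmem H g ->
    heqv H f f' -> hip H f g = hip H f' g;
  ph_def : forall f, hmem H f -> hip H f f = 0 -> heqv H f 0 }.

(** Squared norms keep the estimates below linear, without square roots. *)
Definition nsq H (f : hvec H) : R := Re (hip H f f).

Lemma ReD (x y : C) : Re (x + y) = Re x + Re y.
Proof. by case: x y => [? ?] []. Qed.

Lemma ImD (x y : C) : Im (x + y) = Im x + Im y.
Proof. by case: x y => [? ?] []. Qed.

Lemma ReN (x : C) : Re (- x) = - Re x.
Proof. by case: x. Qed.

Lemma ImN (x : C) : Im (- x) = - Im x.
Proof. by case: x. Qed.

Lemma ReM (x y : C) : Re (x * y) = Re x * Re y - Im x * Im y.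
Proof. by case: x y => [? ?] []. Qed.

Lemma ImM (x y : C) : Im (x * y) = Re x * Im y + Im x * Re y.
Proof. by case: x y => [a b] [c d]. Qed.

Lemma Re_conj (x : C) : Re x^* = Re x.
Proof. by case: x. Qed.

Lemma Im_conj (x : C) : Im x^* = - Im x.
Proof. by case: x. Qed.

Lemma eq_ReIm (x y : C) : Re x = Re y -> Im x = Im y -> x = y.
Proof. by case: x y => [? ?] [? ?] /= -> ->. Qed.

Lemma normc_sqr (x : C) : normc x ^+ 2 = Re x ^+ 2 + Im x ^+ 2.
Proof. by case: x => a b /=; rewrite sqr_sqrtr// addr_ge0// sqr_ge0. Qed.

Lemma mulc_conj (x : C) : x * x^* = (normc x ^+ 2)%:C%C.
Proof.
rewrite normc_sqr; apply: eq_ReIm; rewrite ?ReM ?ImM Re_conj Im_conj /=; ring.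
Qed.

Lemma normc_ge0 (x : C) : 0 <= normc x.
Proof. by case: x => a b /=; rewrite sqrtr_ge0. Qed.

Section Basics.
Variables (H : hspace C) (pH : prehilbert H).
Implicit Types f g h : hvec H.

Lemma memZ (a : C) f : hmem H f -> hmem H (a *: f).
Proof. by move=> mf; rewrite -[a *: f]addr0; apply: phP => //; exact: ph0. Qed.

Lemma memD f g : hmem H f -> hmem H g -> hmem H (f + g).
Proof. by move=> mf mg; rewrite -[f]scale1r; exact: phP. Qed.

Lemma memB f g : hmem H f -> hmem H g -> hmem H (f - g).
Proof. by move=> mf mg; rewrite addrC -scaleN1r; exact: phP. Qed.

Lemma mem_sum (I : eqType) (s : seq I) (F : I -> hvec H) :
  (forall i, i \in s -> hmem H (F i)) -> hmem H (\sum_(i <- s) F i).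
Proof.
move=> mF; rewrite big_seq; elim/big_ind: _ => //; first exact: ph0.
exact: memD.
Qed.

Lemma eqvZ (a : C) f g : heqv H f g -> heqv H (a *: f) (a *: g).
Proof.
by move=> fg; rewrite -[a *: f]addr0 -[a *: g]addr0; apply: ph_eqvP => //;
  exact: ph_refl.
Qed.

Lemma eqvD f f' g g' : heqv H f f' -> heqv H g g' -> heqv H (f + g) (f' + g').
Proof. by move=> fg; rewrite -[f]scale1r -[f']scale1r; exact: ph_eqvP. Qed.

Lemma eqvB f f' g g' : heqv H f f' -> heqv H g g' -> heqv H (f - g) (f' - g').
Proof.
by move=> ff gg; apply: eqvD => //; rewrite -[- g]scaleN1r -[- g']scaleN1r;
  exact: eqvZ.
Qed.

Lemma eqv_sum (I : eqType) (s : seq I) (F G : I -> hvec H) :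
  (forall i, i \in s -> heqv H (F i) (G i)) ->
  heqv H (\sum_(i <- s) F i) (\sum_(i <- s) G i).
Proof.
move=> FG; rewrite big_seq [X in heqv H _ X]big_seq.
elim/big_ind2: _ => //; first exact: ph_refl.
by move=> *; exact: eqvD.
Qed.

Lemma hipZl (a : C) f g : hmem H f -> hmem H g ->
  hip H (a *: f) g = a * hip H f g.
Proof.
move=> mf mg; have m0 := ph0 pH.
(* Linearity is available only for [a *: f + g]; applied with a = 1 to two zero vectors it says that
   the product equals its double. *)
have hip0 : hip H 0 g = 0.
  have := ph_lin pH 1 m0 m0 mg; rewrite scaler0 add0r mul1r => /esym/eqP.
  by rewrite -subr_eq0 addrK => /eqP.
by rewrite -[a *: f]addr0 ph_lin// hip0 addr0.
Qed.

Lemma hipZZ (a b : C) f g : hmem H f -> hmem H g ->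
  hip H (a *: f) (b *: g) = a * b^* * hip H f g.
Proof.
move=> mf mg; rewrite hipZl//; last exact: memZ.
by rewrite (ph_conj pH (memZ b mg) mf) hipZl// rmorphM mulrA (ph_conj pH mg mf).
Qed.

Lemma hip0l g : hmem H g -> hip H 0 g = 0.
Proof. by move=> mg; rewrite -(scale0r 0) hipZl ?mul0r//; exact: ph0. Qed.

Lemma hipDl f g h : hmem H f -> hmem H g -> hmem H h ->
  hip H (f + g) h = hip H f h + hip H g h.
Proof. by move=> mf mg mh; rewrite -[f]scale1r ph_lin// mul1r scale1r. Qed.

Lemma hip_suml (I : eqType) (s : seq I) (F : I -> hvec H) g : hmem H g ->
  (forall i, i \in s -> hmem H (F i)) ->
  hip H (\sum_(i <- s) F i) g = \sum_(i <- s) hip H (F i) g.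
Proof.
move=> mg; elim: s => [|i s IH] mF; first by rewrite !big_nil hip0l.
have mFs j : j \in s -> hmem H (F j).
  by move=> js; apply: mF; rewrite inE js orbT.
rewrite !big_cons hipDl ?IH//; last exact: mem_sum.
by apply: mF; rewrite inE eqxx.
Qed.

Lemma nsq_ge0 f : hmem H f -> 0 <= nsq f.
Proof. by move/(ph_ge0 pH); rewrite lecE => /andP[]. Qed.

Lemma nsqE f : hmem H f -> hip H f f = (nsq f)%:C%C.
Proof.
move=> mf; apply: eq_ReIm => //=.
by have := ph_ge0 pH mf; rewrite lecE => /andP[/eqP].
Qed.

Lemma hnorm_nsq f : hnorm f = Num.sqrt (nsq f).
Proof. by []. Qed.

Lemma nsqZ (a : C) f : hmem H f -> nsq (a *: f) = normc a ^+ 2 * nsq f.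
Proof.
move=> mf; rewrite /nsq hipZl//; last exact: memZ.
rewrite (ph_conj pH (memZ a mf) mf) hipZl// nsqE// ReM Re_conj Im_conj ReM ImM.
by rewrite normc_sqr /=; ring.
Qed.

Lemma nsqD f g : hmem H f -> hmem H g ->
  nsq (f + g) = nsq f + nsq g + 2 * Re (hip H f g).
Proof.
move=> mf mg; have mfg := memD mf mg.
rewrite /nsq hipDl// (ph_conj pH mfg mf) (ph_conj pH mfg mg) !hipDl// ReD.
by rewrite !Re_conj !ReD (ph_conj pH mf mg) Re_conj; ring.
Qed.

Lemma nsqN f : hmem H f -> nsq (- f) = nsq f.
Proof.
by move=> mf; rewrite -scaleN1r nsqZ// normc_sqr /= oppr0 expr0n addr0 sqrrN
  expr1n mul1r.
Qed.

Lemma nsqB_sym f g : hmem H f -> hmem H g -> nsq (f - g) = nsq (g - f).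
Proof. by move=> mf mg; rewrite -nsqN ?opprB//; exact: memB. Qed.

(* Weak triangle inequality; it dispenses with Cauchy-Schwarz. *)
Lemma nsqD_le f g : hmem H f -> hmem H g ->
  nsq (f + g) <= 2 * nsq f + 2 * nsq g.
Proof.
move=> mf mg; have mNg : hmem H (- g) by rewrite -scaleN1r; exact: memZ.
have := nsq_ge0 (memD mf mNg); rewrite !nsqD// nsqN// -scaleN1r.
rewrite (ph_conj pH (memZ _ mg) mf) hipZl// Re_conj ReM (ph_conj pH mf mg).
by rewrite Re_conj /=; lra.
Qed.

Lemma nsqB_le f g : hmem H f -> hmem H g ->
  nsq (f - g) <= 2 * nsq f + 2 * nsq g.
Proof.
move=> mf mg; rewrite -(nsqN mg); apply: nsqD_le => //.
by rewrite -scaleN1r; exact: memZ.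
Qed.

Lemma nsq_eqv f g : hmem H f -> hmem H g -> heqv H f g -> nsq f = nsq g.
Proof.
move=> mf mg fg; rewrite /nsq (ph_hip pH mf mg mf fg) (ph_conj pH mf mg).
by rewrite (ph_hip pH mf mg mg fg) Re_conj.
Qed.

Lemma hnorm_eqv f g : hmem H f -> hmem H g -> heqv H f g -> hnorm f = hnorm g.
Proof. by move=> mf mg fg; rewrite !hnorm_nsq (nsq_eqv mf mg). Qed.

Lemma nsq0_eqv f : hmem H f -> nsq f = 0 -> heqv H f 0.
Proof. by move=> mf f0; apply: ph_def => //; rewrite nsqE// f0. Qed.

Lemma nsqB0_eqv f g : hmem H f -> hmem H g -> nsq (f - g) = 0 -> heqv H f g.
Proof.
move=> mf mg /(nsq0_eqv (memB mf mg)) fg.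
by have := eqvD fg (ph_refl pH g); rewrite subrK add0r.
Qed.

Lemma hnorm_lt f (eps : R) : hmem H f -> 0 < eps ->
  (hnorm f < eps) = (nsq f < eps ^+ 2).
Proof.
move=> mf e0; rewrite hnorm_nsq -{1}[eps]gtr0_norm// -sqrtr_sqr.
by rewrite ltr_sqrt// exprn_gt0.
Qed.

Section Total.
Variables (I : choiceType) (S : set I) (e : I -> hvec H).
Hypothesis me : forall i, S i -> hmem H (e i).

Lemma total_nsq : total_family S e -> forall f, hmem H f ->
  forall eps : R, 0 < eps -> exists (s : seq I) (c : I -> C),
    (forall i, i \in s -> S i) /\ nsq (f - \sum_(i <- s) c i *: e i) < eps.
Proof.
move=> tot f mf eps e0.
have [|s [c [sS fs]]] := tot f mf (Num.sqrt eps); first by rewrite sqrtr_gt0.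
exists s, c; split=> //; rewrite hnorm_lt ?sqrtr_gt0// in fs.
  by rewrite sqr_sqrtr// ltW in fs.
by apply: memB => //; apply: mem_sum => i /sS Si; apply/memZ/me.
Qed.

Lemma nsq_total : (forall f, hmem H f ->
  forall eps : R, 0 < eps -> exists (s : seq I) (c : I -> C),
    (forall i, i \in s -> S i) /\ nsq (f - \sum_(i <- s) c i *: e i) < eps) ->
  total_family S e.
Proof.
move=> tot f mf eps e0; have [|s [c [sS fs]]] := tot f mf (eps ^+ 2).
  by rewrite exprn_gt0.
exists s, c; split=> //; rewrite hnorm_lt//.
by apply: memB => //; apply: mem_sum => i /sS Si; apply/memZ/me.
Qed.

(** Pythagoras: f is orthogonal to each finite combination g, so nsq (f - g) >= nsq f, whereas
    totality would bring nsq (f - g) below a positive nsq f. *)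
Lemma total_orth : total_family S e -> forall f, hmem H f ->
  (forall i, S i -> hip H f (e i) = 0) -> heqv H f 0.
Proof.
move=> tot f mf fe; apply: nsq0_eqv => //; apply/eqP.
rewrite eq_le nsq_ge0// andbT leNgt; apply/negP => f0.
have [s [c [sS]]] := total_nsq tot mf f0; apply/negP; rewrite -leNgt.
have ms i : i \in s -> hmem H (c i *: e i) by move=> /sS Si; apply/memZ/me.
have mg : hmem H (- \sum_(i <- s) c i *: e i).
  by rewrite -scaleN1r; apply/memZ/mem_sum.
rewrite nsqD// -addrA lerDl.
suff -> : hip H f (- \sum_(i <- s) c i *: e i) = 0.
  by rewrite /= mulr0 addr0 nsq_ge0.
rewrite (ph_conj pH mg mf) -scaleN1r hipZl//; last exact: mem_sum.
rewrite hip_suml// big_seq big1 ?mulr0 ?conjC0// => i /[dup] si /sS Si.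
by rewrite hipZl//; [rewrite (ph_conj pH mf (me Si)) fe// conjC0 mulr0|exact: me].
Qed.

(** [total_family] wants coefficients that are a function of the index, but sums arise over lists on
    which [u] may repeat values. Repetitions are merged by adding coefficients, and [undup] keeps an
    index from being counted twice. *)
Lemma comb_reindex (J : eqType) (t : seq J) (u : J -> I) (d : J -> C) :
  exists (s : seq I) (c : I -> C), (forall i, i \in s -> i \in map u t) /\
  \sum_(i <- s) c i *: e i = \sum_(j <- t) d j *: e (u j).
Proof.
exists (undup (map u t)), (fun i => \sum_(j <- t | u j == i) d j).
split=> [i|]; first by rewrite mem_undup.
under eq_bigr do rewrite scaler_suml.
rewrite (exchange_big_dep predT)//= big_seq [RHS]big_seq.
apply: eq_bigr => j tj; rewrite (eq_bigl (pred1 (u j))); last first.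
  by move=> i; rewrite /= eq_sym.
rewrite -big_filter filter_pred1_uniq ?undup_uniq ?big_seq1// mem_undup.
by apply/mapP; exists j.
Qed.

End Total.
End Basics.

Section Operators.
Variables (H K : hspace C) (pH : prehilbert H) (pK : prehilbert K).

Section Isometry.
Variables (A : hvec H -> hvec K) (iA : linear_isometry A).

Lemma iso_mem f : hmem H f -> hmem K (A f).
Proof. by case: iA => -[+ _] _ _; apply. Qed.

Lemma iso_eqv f g : hmem H f -> hmem H g -> heqv H f g -> heqv K (A f) (A g).
Proof. by case: iA => -[_ +] _ _; apply. Qed.

Lemma iso_lin (a : C) f g : hmem H f -> hmem H g ->
  heqv K (A (a *: f + g)) (a *: A f + A g).
Proof. by case: iA => _ + _; apply. Qed.

Lemma iso_nsq f : hmem H f -> nsq (A f) = nsq f.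
Proof.
move=> mf; case: iA => _ _ /(_ f mf) /eqP; rewrite !hnorm_nsq.
by rewrite eqr_sqrt ?(nsq_ge0 pK (iso_mem mf)) ?(nsq_ge0 pH)// => /eqP.
Qed.

Lemma iso_D f g : hmem H f -> hmem H g -> heqv K (A (f + g)) (A f + A g).
Proof. by move=> mf mg; have := iso_lin 1 mf mg; rewrite !scale1r. Qed.

Lemma iso_0 : heqv K (A 0) 0.
Proof.
have m0 := ph0 pH; apply: (nsq0_eqv pK (iso_mem m0)).
by rewrite iso_nsq// /nsq (hip0l pH).
Qed.

Lemma iso_Z (a : C) f : hmem H f -> heqv K (A (a *: f)) (a *: A f).
Proof.
move=> mf; have := iso_lin a mf (ph0 pH); rewrite addr0 => h.
apply: (ph_trans pK h); rewrite -[X in heqv K _ X]addr0.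
by apply: eqvD iso_0 => //; exact: ph_refl.
Qed.

Lemma iso_B f g : hmem H f -> hmem H g -> heqv K (A (f - g)) (A f - A g).
Proof.
by move=> mf mg; have := iso_lin (-1) mg mf; rewrite !scaleN1r addrC [in X in
  heqv K _ X]addrC.
Qed.

Lemma iso_sum (I : eqType) (s : seq I) (c : I -> C) (e : I -> hvec H) :
  (forall i, i \in s -> hmem H (e i)) ->
  heqv K (A (\sum_(i <- s) c i *: e i)) (\sum_(i <- s) c i *: A (e i)).
Proof.
elim: s => [|i s IH] me; first by rewrite !big_nil; exact: iso_0.
have mes j : j \in s -> hmem H (e j) by move=> js; apply: me; rewrite inE js orbT.
rewrite !big_cons; apply: (ph_trans pK (iso_lin _ _ _)).
- by apply: me; rewrite inE eqxx.
- by apply: mem_sum => // j /mes; exact: memZ.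
- by apply: eqvD; [|exact: ph_refl|exact: IH].
Qed.

(** Polarization: [nsqD] recovers the real part of the product from norms. *)
Lemma iso_hip f g : hmem H f -> hmem H g -> hip K (A f) (A g) = hip H f g.
Proof.
have ReE u v : hmem H u -> hmem H v -> Re (hip K (A u) (A v)) = Re (hip H u v).
  move=> mu mv; have muv := memD pH mu mv.
  have := iso_nsq muv; rewrite (nsqD pH)//.
  rewrite (nsq_eqv pK (iso_mem muv) _ (iso_D mu mv)); last first.
    by apply: (memD pK); exact: iso_mem.
  by rewrite (nsqD pK) ?iso_nsq//; [lra|exact: iso_mem|exact: iso_mem].
move=> mf mg; apply: eq_ReIm; first exact: ReE.
(* Re (- i z) = Im z, so the statement on real parts, applied to - i f, yields the imaginary
   part. *)
have mif : hmem H ((0 -i* 1)%C *: f) by exact: memZ.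
have := ReE _ _ mif mg; rewrite (hipZl pH)// ReM /= mul0r sub0r mulN1r opprK.
have mAf := iso_mem mf; have mAg := iso_mem mg.
rewrite (ph_hip pK (iso_mem mif) _ mAg (iso_Z _ mf)); last exact: memZ.
by rewrite (hipZl pK)// ReM /= mul0r sub0r mulN1r opprK.
Qed.

End Isometry.

(** If g is a finite combination close to f, then A g and B g agree, and A f - B f = (A f - A g) -
    (B f - B g) is a difference of two small vectors. *)
Lemma isometry_ext (I : choiceType) (S : set I) (e : I -> hvec H)
    (A B : hvec H -> hvec K) : (forall i, S i -> hmem H (e i)) ->
  total_family S e -> linear_isometry A -> linear_isometry B ->
  (forall i, S i -> heqv K (A (e i)) (B (e i))) ->
  forall f, hmem H f -> heqv K (A f) (B f).
Proof.
move=> me tot iA iB AB f mf.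
have mAf := iso_mem iA mf; have mBf := iso_mem iB mf.
apply: (nsqB0_eqv pK mAf mBf); apply/eqP; rewrite eq_le nsq_ge0 ?andbT//; last first.
  exact: memB.
apply/ler_addgt0Pl => eps e0; rewrite addr0.
(* [nsqB_le] doubles both errors: 2 (eps / 4) + 2 (eps / 4) = eps. *)
have [|s [c [sS fs]]] := total_nsq pH me tot mf (_ : 0 < eps / 4).
  by rewrite divr_gt0.
have ms i : i \in s -> hmem H (e i) by move/sS; exact: me.
set g := \sum_(i <- s) c i *: e i in fs.
have mg : hmem H g by apply: mem_sum => // i /ms; exact: memZ.
have ABg : heqv K (A g) (B g).
  apply: (ph_trans pK (iso_sum iA c ms)).
  apply: (ph_trans pK _ (ph_sym pK (iso_sum iB c ms))).
  by apply: eqv_sum => // i si; apply: eqvZ => //; apply/AB/sS.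
have mAg := iso_mem iA mg; have mBg := iso_mem iB mg.
have fg : heqv K ((A f - A g) - (B f - B g)) (A f - B f).
  have -> : A f - B f = (A f - A g) - (B f - A g).
    by rewrite opprB addrA subrK.
  apply: eqvB => //; first exact: ph_refl.
  by apply: eqvB => //; [exact: ph_refl|exact: ph_sym].
have nsqg (T : hvec H -> hvec K) : linear_isometry T ->
    nsq (T f - T g) < eps / 4.
  move=> iT; have mTf := iso_mem iT mf; have mTg := iso_mem iT mg.
  have mfg := memB pH mf mg.
  rewrite -(nsq_eqv pK (iso_mem iT mfg) _ (iso_B iT mf mg)) ?iso_nsq//.
  exact: memB.
have mA := memB pK mAf mAg; have mB := memB pK mBf mBg.
rewrite -(nsq_eqv pK (memB pK mA mB) (memB pK mAf mBf) fg).
apply: (le_trans (nsqB_le pK mA mB)).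
by have := nsqg A iA; have := nsqg B iB; lra.
Qed.

End Operators.

Lemma linear_isometry_comp H K L (A : hvec H -> hvec K) (B : hvec K -> hvec L) :
  prehilbert H -> prehilbert K -> prehilbert L ->
  linear_isometry A -> linear_isometry B -> linear_isometry (fun f => B (A f)).
Proof.
move=> pH pK pL [[mA eA] lA nA] [[mB eB] lB nB]; split=> [|a f g mf mg|f mf].
- by split=> [f /mA/mB //|f g mf mg fg]; apply: eB; [exact: mA..|exact: eA].
- have mAf := mA _ mf; have mAg := mA _ mg.
  apply: (ph_trans pL _ (lB a _ _ mAf mAg)).
  apply: eB; last exact: lA.
    exact/mA/phP.
  exact: phP.
- by rewrite nB ?nA//; exact: mA.
Qed.

Lemma inverse_operators_comp H K L (A : hvec H -> hvec K) (A' : hvec K -> hvec H)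
    (B : hvec K -> hvec L) (B' : hvec L -> hvec K) :
  prehilbert H -> prehilbert L ->
  inverse_operators H K A A' -> inverse_operators K L B B' ->
  inverse_operators H L (fun f => B (A f)) (fun f => A' (B' f)).
Proof.
move=> pH pL [[mA eA] [mA' eA'] A'A AA'] [[mB eB] [mB' eB'] B'B BB'].
split.
- by split=> [f /mA/mB //|f g mf mg fg]; apply: eB; [exact: mA..|exact: eA].
- by split=> [f /mB'/mA' //|f g mf mg fg]; apply: eA'; [exact: mB'..|exact: eB'].
- move=> f mf; apply: (ph_trans pH _ (A'A f mf)).
  by apply: eA'; [exact/mB'/mB/mA|exact: mA|apply/B'B/mA].
- move=> f mf; apply: (ph_trans pL _ (BB' f mf)).
  by apply: eB; [exact/mA/mA'/mB'|exact: mB'|apply/AA'/mB'].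
Qed.

Lemma inverse_operators_sym H K (A : hvec H -> hvec K) (B : hvec K -> hvec H) :
  inverse_operators H K A B -> inverse_operators K H B A.
Proof. by case. Qed.

(** B is given only as an inverse up to [heqv]; its linearity is pulled back from A, which sends a B
    f + B g to a f + g. *)
Lemma linear_isometry_inv H K (A : hvec H -> hvec K) (B : hvec K -> hvec H) :
  prehilbert H -> prehilbert K ->
  linear_isometry A -> inverse_operators H K A B -> linear_isometry B.
Proof.
move=> pH pK iA [_ [mB eB] BA AB]; split=> [//|a f g mf mg|f mf].
  have mBf := mB _ mf; have mBg := mB _ mg; have mfg := phP pH a mBf mBg.
  apply: (ph_trans pH _ (BA _ mfg)); apply: eB; [exact: phP|exact: iso_mem|].
  apply: (ph_trans pK _ (ph_sym pK (iso_lin iA a mBf mBg))).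
  by apply: (ph_eqvP pK); apply: (ph_sym pK); exact: AB.
have mBf := mB _ mf; have [_ _ <-//] := iA.
by apply: (hnorm_eqv pK) => //; [exact: iso_mem|exact: AB].
Qed.

(** An approximation of [B f] is carried by A to one of [A (B f)], which is equivalent to f. *)
Lemma total_isometry H K (I : choiceType) (S : set I) (e : I -> hvec H)
    (A : hvec H -> hvec K) (B : hvec K -> hvec H) :
  prehilbert H -> prehilbert K -> linear_isometry A ->
  inverse_operators H K A B -> (forall i, S i -> hmem H (e i)) ->
  total_family S e -> total_family S (fun i => A (e i) : hvec K).
Proof.
move=> pH pK iA [_ [mB _] _ AB] me tot; apply: nsq_total => //.
  by move=> i /me; exact: iso_mem.
move=> f mf eps e0; have mBf := mB _ mf.
have [s [c [sS fs]]] := total_nsq pH me tot mBf e0.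
exists s, c; split=> //.
have mes i : i \in s -> hmem H (e i) by move/sS; exact: me.
have mg : hmem H (\sum_(i <- s) c i *: e i) by apply: mem_sum => // i /mes; exact: memZ.
rewrite (_ : nsq _ = nsq (B f - \sum_(i <- s) c i *: e i))//.
have mBg := memB pH mBf mg.
rewrite -[RHS](iso_nsq pH pK iA mBg); apply: nsq_eqv => //.
- apply: memB => //; apply: mem_sum => // i si; apply: memZ => //.
  by apply: (iso_mem iA); exact: mes.
- exact: iso_mem.
- apply: (ph_sym pK).
  apply: (ph_trans pK (iso_B iA mBf mg)).
  by apply: eqvB => //; [exact: AB|exact: iso_sum].
Qed.

(** Transport along an isomorphism. With A = [W] it turns [Up] into a group of local translations,
    which settles their existence. *)
Lemma sc_unitary_group_conj H K (A : hvec H -> hvec K) (B : hvec K -> hvec H)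
    (U : R -> hvec K -> hvec K) :
  prehilbert H -> prehilbert K -> linear_isometry A ->
  inverse_operators H K A B -> sc_unitary_group K U ->
  sc_unitary_group H (fun t f => B (U t (A f))).
Proof.
move=> pH pK iA AB [Uiso U0 UD Ucont].
have iB := linear_isometry_inv pH pK iA AB.
have BA := inverse_operators_sym AB.
have [_ [mB eB] AK BK] := AB.
have mA := fun f => @iso_mem _ _ _ iA f.
have mU t f : hmem K f -> hmem K (U t f).
  by move=> mf; have [iU _] := Uiso t; exact: iso_mem.
split=> [t|f mf|s t f mf|f mf t].
- have [iU [U' UU']] := Uiso t; split.
    exact: (linear_isometry_comp pH pK pH (linear_isometry_comp pH pK pK iA iU) iB).
  exists (fun f => B (U' (A f))).
  have := inverse_operators_comp pH pH (inverse_operators_comp pH pK AB UU') BA.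
  exact.
- apply: (ph_trans pH _ (AK _ mf)); apply: eB; [exact/mU/mA|exact: mA|].
  exact/U0/mA.
- have mtf := mU t _ (mA _ mf).
  apply: eB; [exact/mU/mA|exact/mU/mA/mB|].
  apply: (ph_trans pK (UD s t _ (mA _ mf))).
  have [iU _] := Uiso s; apply: (iso_eqv iU); [exact: mtf|exact/mA/mB|].
  by apply: (ph_sym pK); exact: BK.
- have := Ucont _ (mA _ mf) t; apply: cvg_trans; apply: near_eq_cvg.
  near=> s; have msf := mU s _ (mA _ mf); have mtf := mU t _ (mA _ mf).
  have [_ _ <-] := iB; last exact: memB.
  apply: (hnorm_eqv pH); [apply: mB; exact: memB|apply: memB => //; exact: mB|].
  exact: iso_B.
Unshelve. all: by end_near. Qed.

(** Continuity of the eigenvalues gives continuity on finite combinations; since the U s are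
    isometries, the error of approximating a general f is uniform in s. *)
Lemma eigenvectors_continuous H (I : choiceType) (S : set I) (e : I -> hvec H)
    (U : R -> hvec H -> hvec H) (chi : I -> R -> C) : prehilbert H ->
  (forall t, linear_isometry (U t)) -> (forall i, S i -> hmem H (e i)) ->
  total_family S e ->
  (forall i t, S i -> heqv H (U t (e i)) (chi i t *: e i)) ->
  (forall i t, S i -> normc (chi i s - chi i t) @[s --> t] --> (0 : R)) ->
  forall f, hmem H f -> forall t, hnorm (U s f - U t f) @[s --> t] --> (0 : R).
Proof.
move=> pH iU me tot Ue chic f mf t.
have mU s g : hmem H g -> hmem H (U s g) by apply: iso_mem.
have cont_comb (l : seq I) (c : I -> C) : (forall i, i \in l -> S i) ->
    nsq (\sum_(i <- l) c i *: ((chi i s - chi i t) *: e i)) @[s --> t] --> (0 : R).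
  elim: l => [|i l IH] lS.
    under eq_fun do rewrite big_nil.
    rewrite (_ : nsq _ = 0); first exact: cvg_cst.
    by rewrite /nsq (hip0l pH)//; exact: ph0.
  have Si : S i by apply: lS; rewrite inE eqxx.
  have {}lS j : j \in l -> S j by move=> jl; apply: lS; rewrite inE jl orbT.
  (* The upper bound is [nsqD_le]: its first term tends to 0 with the eigenvalue, its second by
     induction. *)
  apply: (@squeeze_cvgr _ _ _ _ (cst 0)
    (fun s => 2 * (normc (c i) ^+ 2 * (normc (chi i s - chi i t) ^+ 2 * nsq (e i)))
      + 2 * nsq (\sum_(i <- l) c i *: ((chi i s - chi i t) *: e i)))).
  - near=> s; have mi := me _ Si.
    have ml : hmem H (\sum_(i <- l) c i *: ((chi i s - chi i t) *: e i)).
      by apply: mem_sum => // j /lS/me mj; do 2!apply: memZ => //.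
    have mci : hmem H (c i *: ((chi i s - chi i t) *: e i)).
      by do 2!apply: memZ => //.
    rewrite big_cons nsq_ge0 ?memD//=; last exact: memD.
    by rewrite -nsqZ// -nsqZ ?memZ//; [exact: nsqD_le|exact: memZ].
  - exact: cvg_cst.
  - rewrite -[X in _ --> X](_ : 2 * (normc (c i) ^+ 2 * (0 ^+ 2 * nsq (e i))) + 2 * 0 = 0);
      last by rewrite expr0n !(mul0r, mulr0) addr0.
    apply: cvgD; apply: cvgMr; last exact: IH.
    apply: cvgMr; apply: cvgMl; rewrite expr2.
    by under eq_fun do rewrite expr2; apply: cvgM; exact: chic.
apply/cvgrPdist_lt => eps e0.
have e20 : 0 < eps ^+ 2 by rewrite exprn_gt0.
(* The weak triangle inequality is used twice: the errors at s and at t, below eps^2 / 16, count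
   four times each, and the middle term, below eps^2 / 4, twice, for a total of eps^2. *)
have [|l [c [lS fl]]] := total_nsq pH me tot mf (_ : 0 < eps ^+ 2 / 16).
  by rewrite divr_gt0.
have mel i : i \in l -> hmem H (e i) by move/lS; exact: me.
set g := \sum_(i <- l) c i *: e i in fl.
have mg : hmem H g by apply: mem_sum => // i /mel; exact: memZ.
have Ug s : heqv H (U s g) (\sum_(i <- l) c i *: (chi i s *: e i)).
  apply: (ph_trans pH (iso_sum pH pH (iU s) c mel)).
  by apply: eqv_sum => // i /lS Si; apply: eqvZ => //; exact: Ue.
have Ufg s : nsq (U s f - U s g) < eps ^+ 2 / 16.
  have mfg := memB pH mf mg; have mUf := mU s _ mf; have mUg := mU s _ mg.
  rewrite -(nsq_eqv pH (mU s _ mfg) _ (iso_B (iU s) mf mg)).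
    by rewrite (iso_nsq pH pH (iU s) mfg).
  exact: memB.
near=> s; rewrite sub0r normrN ger0_norm ?sqrtr_ge0// hnorm_lt//; last first.
  by apply: memB => //; exact: mU.
have mUsf := mU s _ mf; have mUtf := mU t _ mf.
have mUsg := mU s _ mg; have mUtg := mU t _ mg.
have -> : U s f - U t f = (U s f - U s g) - (U t f - U t g) + (U s g - U t g).
  by rewrite opprB addrAC [_ - _ + (U s g - _)]addrA subrK addrA subrK.
have m1 := memB pH mUsf mUsg; have m2 := memB pH mUtf mUtg.
have m3 := memB pH mUsg mUtg.
apply: (le_lt_trans (nsqD_le pH (memB pH m1 m2) m3)).
have := nsqB_le pH m1 m2; have := Ufg s; have := Ufg t.
suff : nsq (U s g - U t g) < eps ^+ 2 / 4 by lra.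
have -> : nsq (U s g - U t g) =
    nsq (\sum_(i <- l) c i *: ((chi i s - chi i t) *: e i)).
  apply: nsq_eqv => //.
    by apply: mem_sum => // i /mel mi; do 2!apply: memZ => //.
  apply: (ph_trans pH (eqvB pH (Ug s) (Ug t))).
  rewrite -sumrB; under eq_bigr do rewrite -scalerBr -scalerBl.
  exact: ph_refl.
apply: (le_lt_trans (ler_norm _)); rewrite -normrN -sub0r.
near: s; have /cvgrPdist_lt := cont_comb l c lS; apply.
by rewrite divr_gt0.
Unshelve. all: by end_near. Qed.

End PreHilbert.

(** * Closed spans of a family *)

Section SpanLimit.
Variable R : realType.
Local Notation C := R[i].

(** Membership in the closed span: the condition of [total_family] at one vector. In this form
    totality can be assembled from summands and transported by isometries. *)
Definition span_limit (H : hspace C) (I : choiceType) (S : set I) (e : I -> hvec H)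
    (f : hvec H) : Prop :=
  forall eps : R, 0 < eps -> exists (s : seq I) (c : I -> C),
    (forall i, i \in s -> S i) /\ nsq (f - \sum_(i <- s) c i *: e i) < eps.

Section Closure.
Variables (H : hspace C) (pH : prehilbert H) (I : choiceType) (S : set I).
Variables (e : I -> hvec H) (me : forall i, S i -> hmem H (e i)).

Lemma comb_mem (s : seq I) (c : I -> C) : (forall i, i \in s -> S i) ->
  hmem H (\sum_(i <- s) c i *: e i).
Proof. by move=> sS; apply: mem_sum => // i /sS Si; apply/(memZ pH)/me. Qed.

Lemma span_limitD f g : hmem H f -> hmem H g ->
  span_limit S e f -> span_limit S e g -> span_limit S e (f + g).
Proof.
move=> mf mg fS gS eps e0; have e4 : 0 < eps / 4 by rewrite divr_gt0.
have [s [c [sS fs]]] := fS _ e4; have [t [d [tS gt]]] := gS _ e4.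
(* The two combinations are concatenated over the disjoint union [I + I]; indices common to both are
   merged by [comb_reindex]. *)
pose u (j : I + I) : I := match j with inl i => i | inr i => i end.
pose b (j : I + I) : C := match j with inl i => c i | inr i => d i end.
have [r [a [rS rE]]] := comb_reindex e (map inl s ++ map inr t) u b.
exists r, a; split.
  move=> i /rS /mapP[j + ->]; rewrite mem_cat => /orP[] /mapP[k kj ->] /=.
    exact: sS.
  exact: tS.
rewrite rE big_cat !big_map /= opprD addrACA.
have ms := comb_mem c sS; have mt := comb_mem d tS.
by apply: (le_lt_trans (nsqD_le pH (memB pH mf ms) (memB pH mg mt))); lra.
Qed.

Lemma span_limit_eqv f g : hmem H f -> hmem H g -> heqv H f g ->
  span_limit S e f -> span_limit S e g.
Proof.
move=> mf mg fg fS eps e0; have [s [c [sS fs]]] := fS _ e0.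
have ms := comb_mem c sS; exists s, c; split=> //.
rewrite -(nsq_eqv pH (memB pH mf ms) (memB pH mg ms))//.
by apply: (eqvB pH fg); exact: ph_refl.
Qed.

Lemma span_limit_sum (J : eqType) (s : seq J) (F : J -> hvec H) :
  (forall j, hmem H (F j)) -> (forall j, span_limit S e (F j)) ->
  span_limit S e (\sum_(j <- s) F j).
Proof.
move=> mF FS; elim: s => [|j s IH].
  rewrite big_nil => eps e0; exists [::], (fun=> 0); split=> //.
  by rewrite big_nil subrr /nsq (hip0l pH)//; exact: ph0.
rewrite big_cons; apply: span_limitD => //.
by apply: mem_sum => // i _; exact: mF.
Qed.

Lemma total_family_eqv (e' : I -> hvec H) : (forall i, S i -> hmem H (e' i)) ->
  (forall i, S i -> heqv H (e i) (e' i)) ->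
  total_family S e -> total_family S e'.
Proof.
move=> me' ee' tot; apply: (nsq_total pH me') => f mf eps e0.
have [s [c [sS fs]]] := total_nsq pH me tot mf e0; exists s, c; split=> //.
have ms := comb_mem c sS.
have ms' : hmem H (\sum_(i <- s) c i *: e' i).
  by apply: mem_sum => // i /sS Si; apply/(memZ pH)/me'.
rewrite -(nsq_eqv pH (memB pH mf ms) (memB pH mf ms'))//.
apply: (eqvB pH); first exact: ph_refl.
by apply: eqv_sum => // i /sS Si; apply: eqvZ => //; exact: ee'.
Qed.

End Closure.

(** The scalar b lets A carry the family to multiples of [e']. In the application A embeds scalar
    functions along a column, and b = 1 / sqrt p. *)
Lemma span_limit_isometry (H K : hspace C) (I J : choiceType) (S : set I)
    (S' : set J) (e : I -> hvec H) (e' : J -> hvec K) (A : hvec H -> hvec K)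
    (phi : I -> J) (b : C) : prehilbert H -> prehilbert K ->
  linear_isometry A -> (forall i, S i -> hmem H (e i)) ->
  (forall j, S' j -> hmem K (e' j)) -> (forall i, S i -> S' (phi i)) ->
  (forall i, S i -> heqv K (A (e i)) (b *: e' (phi i))) ->
  forall f, hmem H f -> span_limit S e f -> span_limit S' e' (A f).
Proof.
move=> pH pK iA me me' Sphi Ae f mf fS eps e0.
have [s [c [sS fs]]] := fS _ e0; have ms := comb_mem pH me c sS.
have [r [a [rS rE]]] := comb_reindex e' s phi (fun i => c i * b).
have rS' j : j \in r -> S' j by move=> /rS /mapP[i /sS/Sphi Si ->].
exists r, a; split=> //; have mr := comb_mem pK me' a rS'.
rewrite -(iso_nsq pH pK iA (memB pH mf ms)) in fs.
suff E : heqv K (A (f - \sum_(i <- s) c i *: e i))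
    (A f - \sum_(j <- r) a j *: e' j).
  rewrite -(nsq_eqv pK _ _ E)//; first exact/(iso_mem iA)/(memB pH).
  by apply: (memB pK) => //; exact: (iso_mem iA).
apply: (ph_trans pK (iso_B iA mf ms)); apply: (eqvB pK); first exact: ph_refl.
rewrite rE; apply: (ph_trans pK (iso_sum pH pK iA c _)).
  by move=> i /sS; exact: me.
apply: eqv_sum => // i /sS Si; rewrite -scalerA.
by apply: eqvZ => //; exact: Ae.
Qed.

End SpanLimit.

(** * The spaces L^2 *)

Section L2Prehilbert.
Context {d : measure_display} {T : measurableType d} {R : realType}.
Variables (mu : {measure set T -> \bar R}) (D : set T) (mD : measurable D).
Local Notation C := R[i].
Local Notation Re := complex.Re.
Local Notation Im := complex.Im.
Local Notation normc := ComplexField.Normc.normc.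
Implicit Types f g : T -> C.

Lemma cmeasurable_cst (a : C) : cmeasurable (fun _ : T => a).
Proof. by split; exact: measurable_cst. Qed.

Lemma cmeasurableD f g : cmeasurable f -> cmeasurable g ->
  cmeasurable (fun x => f x + g x).
Proof.
by move=> [mf mf'] [mg mg']; split; [under eq_fun do rewrite ReD|
  under eq_fun do rewrite ImD]; exact: measurable_funD.
Qed.

Lemma cmeasurableM f g : cmeasurable f -> cmeasurable g ->
  cmeasurable (fun x => f x * g x).
Proof.
move=> [mf mf'] [mg mg']; split.
  under eq_fun do rewrite ReM.
  by apply: measurable_funB; exact: measurable_funM.
under eq_fun do rewrite ImM.
by apply: measurable_funD; exact: measurable_funM.
Qed.

Lemma cmeasurable_conj f : cmeasurable f -> cmeasurable (fun x => (f x)^*).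
Proof.
move=> [mf mf']; split; first by under eq_fun do rewrite Re_conj.
under eq_fun do rewrite Im_conj.
exact: measurable_funN.
Qed.

Lemma cmeasurable_sum (I : Type) (s : seq I) (F : I -> T -> C) :
  (forall i, cmeasurable (F i)) -> cmeasurable (fun x => \sum_(i <- s) F i x).
Proof.
move=> mF; elim: s => [|i s IH].
  by under eq_fun do rewrite big_nil; exact: cmeasurable_cst.
by under eq_fun do rewrite big_cons; exact: cmeasurableD.
Qed.

Lemma measurable_normc2 f : cmeasurable f ->
  measurable_fun setT (fun x => normc (f x) ^+ 2).
Proof.
move=> [mf mf']; under eq_fun do rewrite normc_sqr.
by apply: measurable_funD; exact: measurable_funX.
Qed.

Definition cintegrable f : Prop :=
  mu.-integrable D (EFin \o (fun x => Re (f x))) /\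
  mu.-integrable D (EFin \o (fun x => Im (f x))).

Lemma cintegralD f g : cintegrable f -> cintegrable g ->
  cintegral mu D (fun x => f x + g x) = cintegral mu D f + cintegral mu D g.
Proof.
move=> [f1 f2] [g1 g2]; apply: eq_ReIm; rewrite /cintegral /=.
  by under eq_Rintegral do rewrite ReD; rewrite RintegralD.
by under eq_Rintegral do rewrite ImD; rewrite RintegralD.
Qed.

Lemma cintegrableZ (a : C) f : cintegrable f -> cintegrable (fun x => a * f x).
Proof.
move=> [f1 f2]; split.
  apply: eq_integrable (integrableB mD (integrableZl mD (Re a) f1)
    (integrableZl mD (Im a) f2)) => // x _.
  by rewrite /= ReM EFinB !EFinM.
apply: eq_integrable (integrableD mD (integrableZl mD (Re a) f2)
  (integrableZl mD (Im a) f1)) => // x _.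
by rewrite /= ImM EFinD !EFinM.
Qed.

Lemma cintegrableD f g : cintegrable f -> cintegrable g ->
  cintegrable (fun x => f x + g x).
Proof.
move=> [f1 f2] [g1 g2]; split.
  by apply: eq_integrable (integrableD mD f1 g1) => // x _; rewrite /= ReD EFinD.
by apply: eq_integrable (integrableD mD f2 g2) => // x _; rewrite /= ImD EFinD.
Qed.

Lemma cintegralZ (a : C) f : cintegrable f ->
  cintegral mu D (fun x => a * f x) = a * cintegral mu D f.
Proof.
move=> [f1 f2].
have i1 b : mu.-integrable D (EFin \o (fun x => b * Re (f x))).
  by apply: eq_integrable (integrableZl mD b f1) => // x _; rewrite /= EFinM.
have i2 b : mu.-integrable D (EFin \o (fun x => b * Im (f x))).
  by apply: eq_integrable (integrableZl mD b f2) => // x _; rewrite /= EFinM.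
apply: eq_ReIm; rewrite /cintegral ?ReM ?ImM /=.
  by under eq_Rintegral do rewrite ReM; rewrite RintegralB// !RintegralZl.
by under eq_Rintegral do rewrite ImM; rewrite RintegralD// !RintegralZl.
Qed.

Lemma cintegral0 : cintegral mu D (fun=> 0) = 0.
Proof. by apply: eq_ReIm; rewrite /= /Rintegral integral0. Qed.

Lemma cintegral_sum (I : Type) (s : seq I) (F : I -> T -> C) :
  (forall i, cintegrable (F i)) ->
  cintegral mu D (fun x => \sum_(i <- s) F i x) =
  \sum_(i <- s) cintegral mu D (F i).
Proof.
move=> iF; have i0 : cintegrable (fun=> 0) by split; exact: integrable0.
have [_] : cintegrable (fun x => \sum_(i <- s) F i x) /\
    cintegral mu D (fun x => \sum_(i <- s) F i x) =
    \sum_(i <- s) cintegral mu D (F i); last by [].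
elim: s => [|i s [IH1 IH2]].
  under eq_fun do rewrite big_nil; split=> //; rewrite big_nil.
  exact: cintegral0.
under eq_fun do rewrite big_cons; split; first exact: cintegrableD.
by rewrite cintegralD// IH2 big_cons.
Qed.

Lemma cintegral_conj f : cintegrable f ->
  cintegral mu D (fun x => (f x)^*) = (cintegral mu D f)^*.
Proof.
move=> [f1 f2]; apply: eq_ReIm; rewrite /cintegral ?Re_conj ?Im_conj /=.
  by under eq_Rintegral do rewrite Re_conj.
under eq_Rintegral do rewrite Im_conj -mulN1r.
by rewrite RintegralZl// mulN1r.
Qed.

Lemma cintegral_ae f g : cmeasurable f -> cmeasurable g ->
  f = g %[ae mu in D] -> cintegral mu D f = cintegral mu D g.
Proof.
have ext (u v : T -> R) : measurable_fun setT u -> measurable_fun setT v ->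
    {ae mu, forall x, D x -> u x = v x} ->
    \int[mu]_(x in D) u x = \int[mu]_(x in D) v x.
  move=> m1 m2 uv; congr fine; apply: ae_eq_integral => //.
  - by apply/measurable_EFinP; exact: measurable_funTS.
  - by apply/measurable_EFinP; exact: measurable_funTS.
  - by apply: filterS uv => x uvx Dx; rewrite uvx.
move=> [f1 f2] [g1 g2] fg; congr Complex; apply: ext => //;
  by apply: filterS fg => x fgx Dx; rewrite fgx.
Qed.

Local Notation H := (L2 mu D).

Lemma L2_memP f : hmem H f <->
  cmeasurable f /\ mu.-integrable D (EFin \o (fun x => normc (f x) ^+ 2)).
Proof.
split=> -[mf fi]; split=> //.
  apply/integrableP; split.
    by apply/measurable_EFinP; apply: measurable_funTS; exact: measurable_normc2.
  by under eq_integral do rewrite /= ger0_norm ?exprn_ge0 ?normc_ge0//.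
move/integrableP : fi => [_]; apply: le_lt_trans.
by under [leRHS]eq_integral do rewrite /= ger0_norm ?exprn_ge0 ?normc_ge0//.
Qed.

Lemma L2_le f g h : cmeasurable f -> hmem H g -> hmem H h ->
  (forall x, D x -> normc (f x) ^+ 2 <= normc (g x) ^+ 2 + normc (h x) ^+ 2) ->
  hmem H f.
Proof.
move=> mf /L2_memP[_ ig] /L2_memP[_ ih] fgh; apply/L2_memP; split=> //.
apply: le_integrable (integrableD mD ig ih) => //.
  by apply/measurable_EFinP; apply: measurable_funTS; exact: measurable_normc2.
move=> x Dx; rewrite /= !ger0_norm ?addr_ge0 ?exprn_ge0 ?normc_ge0//.
by rewrite lee_fin fgh.
Qed.

Lemma L2_mul_bounded (M : R) f g : cmeasurable f -> hmem H g ->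
  (forall x, D x -> normc (f x) <= M) -> hmem H (fun x => f x * g x).
Proof.
move=> mf [mg ig] fM; apply/L2_memP; split; first exact: cmeasurableM.
have /L2_memP[_ ig'] : hmem H g by [].
apply: le_integrable (integrableZl mD (M ^+ 2) ig') => //.
  apply/measurable_EFinP; apply: measurable_funTS; apply: measurable_normc2.
  exact: cmeasurableM.
move=> x Dx; rewrite /= !ger0_norm ?(sqr_ge0, mulr_ge0)//.
rewrite lee_fin ComplexField.Normc.normcM exprMn ler_wpM2r ?sqr_ge0//.
have M0 : 0 <= M by apply: le_trans (fM _ Dx); exact: normc_ge0.
by rewrite ler_sqr ?nnegrE ?normc_ge0//; exact: fM.
Qed.

(** The real and the imaginary part of the product are both dominated by |f|^2 + |g|^2, through the
    same estimate [amgm]. *)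
Lemma L2_prod_int f g : hmem H f -> hmem H g ->
  cintegrable (fun x => f x * (g x)^*).
Proof.
move=> /L2_memP[mf ifi] /L2_memP[mg ig].
have [mRe mIm] := cmeasurableM mf (cmeasurable_conj mg).
have amgm (a b p q : R) :
    `|a * p + b * q| <= a ^+ 2 + b ^+ 2 + (p ^+ 2 + q ^+ 2).
  have := sqr_ge0 (a - p); have := sqr_ge0 (a + p); have := sqr_ge0 (b - q).
  have := sqr_ge0 (b + q); rewrite ler_norml => *; apply/andP; split; nra.
split; apply: le_integrable (integrableD mD ifi ig) => //.
- exact/measurable_EFinP/measurable_funTS.
- move=> x Dx; rewrite /= lee_fin [leRHS]ger0_norm ?addr_ge0 ?sqr_ge0//.
  rewrite ReM Re_conj Im_conj !normc_sqr.
  by rewrite mulrN opprK; exact: amgm.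
- exact/measurable_EFinP/measurable_funTS.
- move=> x Dx; rewrite /= lee_fin [leRHS]ger0_norm ?addr_ge0 ?sqr_ge0//.
  rewrite ImM Re_conj Im_conj !normc_sqr.
  apply: le_trans (amgm _ _ _ _) _.
  by rewrite sqrrN [X in _ + X <= _]addrC.
Qed.

Lemma nsq_L2 f : nsq (f : hvec H) = \int[mu]_(x in D) (normc (f x) ^+ 2).
Proof. by rewrite /nsq /=; under eq_Rintegral do rewrite mulc_conj. Qed.

Lemma L2_prehilbert : prehilbert H.
Proof.
have mem0 : hmem H 0.
  split; first exact: cmeasurable_cst.
  rewrite (_ : integral _ _ _ = 0%E) ?ltry//; apply: integral0_eq => x Dx.
  by rewrite /= expr0n /= addr0 sqrtr0 expr0n.
have memP (a : C) (f g : hvec H) : hmem H f -> hmem H g -> hmem H (a *: f + g).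
  move=> /L2_memP[mf ifi] /L2_memP[mg ig]; apply/L2_memP; split.
    by apply: cmeasurableD => //; apply: cmeasurableM => //; exact: cmeasurable_cst.
  apply: le_integrable (integrableD mD
     (integrableZl mD (2 * normc a ^+ 2) ifi) (integrableZl mD 2 ig)) => //.
    apply/measurable_EFinP; apply: measurable_funTS; apply: measurable_normc2.
    by apply: cmeasurableD => //; apply: cmeasurableM => //; exact: cmeasurable_cst.
  move=> x Dx; rewrite /= lee_fin.
  rewrite !ger0_norm ?addr_ge0 ?(sqr_ge0, mulr_ge0)//.
  rewrite -mulrA -exprMn -ComplexField.Normc.normcM /GRing.scale /=.
  rewrite !normc_sqr ReD ImD.
  set u := a * _; move: (Re u) (Im u) (Re (g x)) (Im (g x)) => p q r s.
  by have := sqr_ge0 (p - r); have := sqr_ge0 (q - s); nra.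
split=> //.
- move=> a f g h mf mg mh /=.
  have ifh := L2_prod_int mf mh; have igh := L2_prod_int mg mh.
  rewrite -cintegralZ// -cintegralD//; last exact: cintegrableZ.
  by congr cintegral; apply/funext => x; rewrite mulrDl mulrA.
- move=> f g mf mg /=; rewrite -cintegral_conj; last exact: L2_prod_int.
  congr cintegral; apply/funext => x; rewrite rmorphM mulrC.
  by congr (_ * _); exact/esym/conjCK.
- move=> f mf /=; rewrite lecE /=.
  under eq_Rintegral do rewrite mulc_conj /=.
  under [X in _ <= X]eq_Rintegral do rewrite mulc_conj /=.
  rewrite /Rintegral integral0_eq//= eqxx/=.
  by apply: Rintegral_ge0 => x Dx; rewrite sqr_ge0.
- by move=> f; exact: ae_eq_refl.
- by move=> f g; apply: filterS => x fg Dx; rewrite fg.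
- by move=> f g h; apply: filterS2 => x fg gh Dx; rewrite fg ?gh.
- by move=> a f f' g g'; apply: filterS2 => x ff gg Dx; rewrite /= !fctE ff ?gg.
- move=> f f' g [mf _] [mf' _] [mg _] ff /=; apply: cintegral_ae.
  + by apply: cmeasurableM => //; exact: cmeasurable_conj.
  + by apply: cmeasurableM => //; exact: cmeasurable_conj.
  + by apply: filterS ff => x ff Dx; rewrite ff.
- move=> f /[dup] mf /L2_memP[mf' ifi] f0.
  (* [hip] is built on [fine], which sends an infinite integral to 0; integrability of the squared
     modulus is what turns [f0] into a vanishing integral. *)
  have : (\int[mu]_(x in D) `|(normc (f x) ^+ 2)%:E| = 0)%E.
    under eq_integral do rewrite /= ger0_norm ?sqr_ge0//.
    rewrite -[LHS]fineK ?(integrable_fin_num mD ifi)//.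
    by rewrite -[fine _]/(\int[mu]_(x in D) (normc (f x) ^+ 2)) -nsq_L2 /nsq f0.
  move/ae_eq_integral_abs => -[//||].
    by apply/measurable_EFinP; apply: measurable_funTS; exact: measurable_normc2.
  move=> N [mN N0 subN]; exists N; split=> //; apply: subset_trans subN.
  apply: subsetC => x /= h Dx; have [/eqP] := h Dx.
  rewrite sqrf_eq0 => /eqP; exact: ComplexField.Normc.eq0_normc.
Qed.

End L2Prehilbert.

Section L2vecPrehilbert.
Context {d : measure_display} {T : measurableType d} {R : realType}.
Variables (mu : {measure set T -> \bar R}) (D : set T) (mD : measurable D).
Variable n : nat.
Local Notation Re := complex.Re.
Local Notation normc := ComplexField.Normc.normc.
Local Notation H := (L2vec mu D n).
Local Notation pL2 := (L2_prehilbert mu mD).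

(** Reduced to countable intersections, the statement being vacuous for m >= n. *)
Lemma ae_all_ord (P : 'I_n -> T -> Prop) :
  (forall i, {ae mu, forall x, P i x}) -> {ae mu, forall x, forall i, P i x}.
Proof.
move=> aeP.
have : {ae mu, forall x, forall m, forall mn : (m < n)%N, P (Ordinal mn) x}.
  apply: ae_foralln => m; have [mn|nm] := pselect (m < n)%N; last by apply: aeW => x mn; case: nm.
  apply: filterS (aeP (Ordinal mn)) => x Px mn'.
  by rewrite (_ : Ordinal mn' = Ordinal mn)//; exact: val_inj.
by apply: filterS => x Px [m mn]; exact: Px.
Qed.

Lemma nsq_L2vec (F : hvec H) :
  nsq F = \sum_(i < n) \int[mu]_(x in D) (normc (F x i ord0) ^+ 2).
Proof.
rewrite /nsq /= (big_morph _ (@ReD R) (erefl : Re 0 = 0)).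
by apply: eq_bigr => i _; rewrite -nsq_L2.
Qed.

Lemma L2vec_prehilbert : prehilbert H.
Proof.
split.
- move=> i /=; have := ph0 pL2; congr (hmem (L2 mu D) _).
  by apply/funext => x; rewrite mxE.
- move=> a f g mf mg i; have := phP pL2 a (mf i) (mg i).
  by congr (hmem (L2 mu D) _); apply/funext => x; rewrite !mxE.
- move=> a f g h mf mg mh; rewrite /hip /= mulr_sumr -big_split /=.
  apply: eq_bigr => i _; rewrite -(ph_lin pL2 a (mf i) (mg i) (mh i)) /=.
  by congr cintegral; apply/funext => x; rewrite !mxE.
- move=> f g mf mg; rewrite /hip /= rmorph_sum.
  by apply: eq_bigr => i _; exact: (ph_conj pL2 (mf i) (mg i)).
- move=> f mf; rewrite /hip /=; apply: sumr_ge0 => i _.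
  exact: (ph_ge0 pL2 (mf i)).
- by move=> f; exact: ae_eq_refl.
- by move=> f g; apply: filterS => x fg Dx; rewrite fg.
- by move=> f g h; apply: filterS2 => x fg gh Dx; rewrite fg ?gh.
- by move=> a f f' g g'; apply: filterS2 => x ff gg Dx; rewrite /= !fctE ff ?gg.
- move=> f f' g mf mf' mg ff; rewrite /hip /=; apply: eq_bigr => i _.
  apply: (ph_hip pL2 (mf i) (mf' i) (mg i)).
  by apply: filterS ff => x ffx Dx; rewrite ffx.
- move=> f mf f0.
  have : {ae mu, forall x, forall i, D x -> f x i ord0 = 0}.
    apply: ae_all_ord => i; apply: (nsq0_eqv pL2 (mf i)).
    apply/eqP; rewrite eq_le (nsq_ge0 pL2 (mf i)) andbT.
    have <- : nsq f = 0 by rewrite /nsq f0.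
    rewrite nsq_L2vec nsq_L2 (bigD1 i)//= lerDl sumr_ge0// => j _.
    by rewrite -nsq_L2; exact: (nsq_ge0 pL2 (mf j)).
  apply: filterS => x fx Dx; apply/matrixP => i j.
  by rewrite ord1 fx// mxE.
Qed.

End L2vecPrehilbert.

(** * Translations, periodic functions and the lattice *)

Section AlmostEverywhere.
Context {d : measure_display} {T : measurableType d} {R : realType}.
Variable mu : {measure set T -> \bar R}.

Lemma aeS (P Q : T -> Prop) : (forall x, P x -> Q x) ->
  {ae mu, forall x, P x} -> {ae mu, forall x, Q x}.
Proof. exact: filterS. Qed.

Lemma aeS2 (P Q S : T -> Prop) : (forall x, P x -> Q x -> S x) ->
  {ae mu, forall x, P x} -> {ae mu, forall x, Q x} -> {ae mu, forall x, S x}.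
Proof. exact: filterS2. Qed.

Lemma aeS3 (P Q S U : T -> Prop) : (forall x, P x -> Q x -> S x -> U x) ->
  {ae mu, forall x, P x} -> {ae mu, forall x, Q x} -> {ae mu, forall x, S x} ->
  {ae mu, forall x, U x}.
Proof. exact: filterS3. Qed.

Lemma ae_all_int (P : int -> T -> Prop) :
  (forall n, {ae mu, forall x, P n x}) -> {ae mu, forall x, forall n, P n x}.
Proof.
move=> aeP.
have : {ae mu, forall x, forall n : nat, P n x /\ P (Negz n) x}.
  apply: ae_foralln => n.
  by have := aeP (Negz n); move: (aeP n); apply: aeS2 => x.
by apply: aeS => x Px [] n; [exact: (Px n).1|exact: (Px n).2].
Qed.

End AlmostEverywhere.

Section Translation.
Variable R : realType.
Local Notation leb := (@lebesgue_measure R).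
Local Notation mR := (measurableTypeR R).

Let shift_ (t : R) : mR -> mR := fun x : mR => (x : R) + t.

Let measurable_shift_ (t : R) : measurable_fun setT (shift_ t).
Proof. exact: measurable_funD. Qed.

Lemma measurable_translate (A : set R) t : measurable (A : set mR) ->
  measurable ([set x | A (x + t)] : set mR).
Proof.
by move=> mA; rewrite -[X in measurable X]setTI; exact: (measurable_shift_ t).
Qed.

Lemma measurable_fun_translate d' (Y : measurableType d') (f : mR -> Y) t :
  measurable_fun setT f -> measurable_fun setT (fun x : mR => f (x + t) : Y).
Proof.
by move=> mf; apply: (measurableT_comp mf); exact: (measurable_shift_ t).
Qed.

(** Uniqueness of Lebesgue measure: its pushforward under a translation gives half-open intervals
    the same mass. *)
Lemma lebesgue_measure_translate (A : set R) t : measurable (A : set mR) ->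
  leb [set x | A (x + t)] = leb A.
Proof.
move=> mA; apply/esym.
have -> : leb [set x | A (x + t)] = pushforward leb (shift_ t) A by [].
apply: lebesgue_measure_unique => // _ [[a b]] _ <-.
rewrite [RHS](_ : _ = leb `]a - t, b - t]%classic); last first.
  by congr (leb _); apply/seteqP; split => x /=; rewrite /shift_ !in_itv /= ltrBlDr lerBrDr.
rewrite !lebesgue_measure_itv/= !lte_fin ltrD2r.
by case: ifP => // _; rewrite -!EFinB; congr EFin; lra.
Qed.

Lemma ae_translate (P : R -> Prop) t :
  {ae leb, forall x, P x} -> {ae leb, forall x, P (x + t)}.
Proof.
move=> [N [mN N0 subN]]; exists [set x | N (x + t)]; split.
- exact: measurable_translate.
- by rewrite -[RHS]N0; exact: lebesgue_measure_translate.
- by move=> x /= nP; apply: subN.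
Qed.

Lemma ge0_integral_translate (D : set R) (f : R -> \bar R) t :
  measurable (D : set mR) -> measurable_fun setT (f : mR -> \bar R) ->
  (forall x, (0 <= f x)%E) ->
  (\int[leb]_(x in D) f x = \int[leb]_(x in [set x | D (x + t)%R]) f (x + t)%R)%E.
Proof.
move=> mD mf f0.
have mfD : measurable_fun D (f : mR -> \bar R) by exact: measurable_funTS.
have := ge0_integral_pushforward (measurable_shift_ t) leb mD mfD.
move=> /(_ (fun y _ => f0 y)); rewrite /preimage /comp => <-.
apply: eq_measure_integral => A mA _.
exact/esym/lebesgue_measure_translate.
Qed.

Section Periodic.
Variables (h : R) (h0 : 0 < h).
Local Notation cell := (`[0, h[%classic : set R).

Lemma periodic_int (V : Type) (f : R -> V) : (forall x, f (x + h) = f x) ->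
  forall (n : int) x, f (x + n%:~R * h) = f x.
Proof.
move=> fp.
have fpn (n : nat) x : f (x + n%:R * h) = f x.
  elim: n x => [|n IH] x; first by rewrite mul0r addr0.
  by rewrite -addn1 natrD mulrDl mul1r addrA fp IH.
case=> n x; first by rewrite fpn.
by rewrite -(fpn n.+1) NegzE rmorphN mulNr /= subrK.
Qed.

Lemma floor_cell (x : R) : 0 <= x - (Num.floor (x / h))%:~R * h < h.
Proof.
have /andP[] := floor_itv (x / h).
by rewrite ler_pdivlMr// ltr_pdivrMr// intrD mulrDl mul1r => ? ?; apply/andP; lra.
Qed.

(** With t reduced to r in [0, h), the shifted cell [r, h + r) consists of [r, h) and [h, h + r),
    and by periodicity the second piece contributes what [0, r) does. *)
Lemma ge0_integral_periodic (f : R -> \bar R) t :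
  measurable_fun setT (f : mR -> \bar R) -> (forall x, (0 <= f x)%E) ->
  (forall x, f (x + h) = f x) ->
  (\int[leb]_(x in cell) f (x + t)%R = \int[leb]_(x in cell) f x)%E.
Proof.
move=> mf f0 fp; have := floor_cell t; set r := t - _ => /andP[r0 rh].
transitivity (\int[leb]_(x in cell) f (x + r)%R)%E.
  apply: eq_integral => x _.
  by rewrite -(periodic_int fp (Num.floor (t / h)) (x + r)) /r addrA subrK.
have mfD D : measurable_fun D (f : mR -> \bar R) by exact: measurable_funTS.
transitivity (\int[leb]_(x in `[r, (h + r)%R[) f x)%E.
  rewrite (@ge0_integral_translate `[r, h + r[%classic _ r)//.
  congr integral; apply/seteqP; split=> x /=; rewrite !in_itv /= => /andP[? ?];
    apply/andP; lra.
have -> : `[r, h + r[%classic = `[r, h[%classic `|` `[h, h + r[%classic :> set R.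
  apply/seteqP; split=> x /=; rewrite !in_itv /=.
    move=> /andP[? ?]; have [xh|hx] := ltP x h; [left|right]; apply/andP; lra.
  by case=> /andP[? ?]; apply/andP; lra.
have -> : cell = `[0, r[%classic `|` `[r, h[%classic.
  apply/seteqP; split=> x /=; rewrite !in_itv /=.
    move=> /andP[? ?]; have [xh|hx] := ltP x r; [left|right]; apply/andP; lra.
  by case=> /andP[? ?]; apply/andP; lra.
rewrite !ge0_integral_setU//; last 2 first.
- apply/disj_setPS => x [] /=; rewrite !in_itv /= => /andP[? ?] /andP[? ?]; lra.
- apply/disj_setPS => x [] /=; rewrite !in_itv /= => /andP[? ?] /andP[? ?]; lra.
rewrite addeC; congr (_ + _)%E.
rewrite (@ge0_integral_translate `[h, h + r[%classic _ h)//.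
under [LHS]eq_integral => x _ do rewrite fp.
congr integral; apply/seteqP; split=> x /=; rewrite !in_itv /= => /andP[? ?];
  apply/andP; lra.
Qed.

(** Each x is moved into the cell by one of the countably many translations n h, which preserve null
    sets and leave P invariant. *)
Lemma ae_periodic (P : R -> Prop) : (forall x, P x -> P (x + h)) ->
  (forall x, P (x + h) -> P x) ->
  {ae leb, forall x, cell x -> P x} -> {ae leb, forall x, P x}.
Proof.
move=> Pu Pd aeP.
have Pp (n : int) x : P (x + n%:~R * h) = P x.
  by apply: (periodic_int (f := P)) => y; apply/propext; split; [exact: Pd|exact: Pu].
have : {ae leb, forall x, forall n : int, cell (x + n%:~R * h) -> P (x + n%:~R * h)}.
  by apply: ae_all_int => n; exact: ae_translate (n%:~R * h) aeP.
apply: aeS => x Px; have := floor_cell x; set n := Num.floor _ => nx.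
rewrite -(Pp (- n)); apply: Px.
by rewrite rmorphN mulNr /= in_itv.
Qed.

(** D is cut into the slices [F n] over the translated cells, and each slice is moved back to the
    cell. The list [s] must contain every n whose slice is nonempty. *)
Lemma ge0_integral_cells (D : set R) (s : seq int) (f : R -> \bar R) :
  measurable (D : set mR) -> uniq s ->
  (forall x n, cell x -> D (x + n%:~R * h) -> n \in s) ->
  measurable_fun setT (f : mR -> \bar R) -> (forall x, (0 <= f x)%E) ->
  (\int[leb]_(x in D) f x = \int[leb]_(x in cell)
    \sum_(n <- s) ((f \_ D) (x + n%:~R * h)%R))%E.
Proof.
move=> mD us covD mf f0.
pose F (n : int) := D `&` [set x | cell (x - n%:~R * h)].
have mF n : measurable (F n : set mR).
  by apply: measurableI => //; exact: measurable_translate.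
have DE : D = \big[setU/set0]_(n <- s) F n.
  apply/seteqP; split=> x.
    move=> Dx; rewrite -bigcup_seq; exists (Num.floor (x / h)) => /=.
      apply: (covD (x - (Num.floor (x / h))%:~R * h)); last by rewrite subrK.
      by rewrite /= in_itv /=; exact: floor_cell.
    by split=> //=; rewrite in_itv /=; exact: floor_cell.
  by rewrite -bigcup_seq => -[n _ []].
rewrite {1}DE ge0_integral_bigsetU//; last 2 first.
- apply/trivIsetP => m n _ _ mn; apply/seteqP; split=> // x [[_ /= xm] [_ /= xn]].
  exfalso; move: xm xn; rewrite !in_itv /= => /andP[m0 mh] /andP[n0 nh].
  (* From a h <= x < (b + 1) h follows a < b + 1; by symmetry a point lies in only one cell. *)
  have lt_h (a b : int) : 0 <= x - a%:~R * h -> x - b%:~R * h < h -> (a <= b)%R.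
    move=> a0 bh; rewrite -ltzD1 -(ltr_int R) intrD -(ltr_pM2r h0).
    by rewrite mulrDl mul1r; lra.
  by move/eqP : mn; apply; apply/eqP; rewrite eq_le !lt_h.
- exact: measurable_funTS.
have mfD : measurable_fun setT (f \_ D : mR -> \bar R).
  by apply/(measurable_restrictT _ _).1 => //; exact: measurable_funTS.
rewrite ge0_integral_sum//; last 2 first.
- by move=> n; apply: measurable_funTS; exact: (measurable_fun_translate _ mfD).
- by move=> n x _; rewrite patchE; case: ifP.
apply: eq_bigr => n _.
rewrite (@ge0_integral_translate (F n) _ (n%:~R * h))//.
have -> : [set x | F n (x + n%:~R * h)] = cell `&` [set x | D (x + n%:~R * h)].
  by apply/seteqP; split=> x; rewrite /F /= addrK => -[].
rewrite integral_mkcondr; apply: eq_integral => x _.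
by rewrite !patchE; congr (if _ then _ else _); apply/idP/idP; rewrite !inE.
Qed.

End Periodic.
End Translation.

Definition int_window (N : nat) : seq int :=
  [seq (i%:Z - N%:Z) | i <- iota 0 (N.*2.+1)].

Lemma mem_int_window N (k : int) : (k \in int_window N) = (`|k| <= N%:Z).
Proof.
apply/mapP/idP => [[n]|kN].
  by rewrite mem_iota => iN ->; lia.
exists (absz (k + N%:Z)); last lia.
by rewrite mem_iota; lia.
Qed.

Lemma int_window_sorted N : sorted <%O (int_window N).
Proof.
rewrite sorted_map; apply: sub_sorted (iota_ltn_sorted 0 _) => i j /= ij.
lia.
Qed.

(** * Fibers and the operator W *)

Section Fibers.
Variable R : realType.
Local Notation leb := (@lebesgue_measure R).
Local Notation mR := (measurableTypeR R).
Variables (Omega : set R) (p : nat) (hp : (0 < p)%N).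
Hypothesis Obnd : bounded_set (Omega : set R^o).
Hypothesis Omeas : measurable (Omega : set mR).
Local Notation h := ((p%:R : R)^-1).
Local Notation cell := (cell p : set R).
Local Notation fiber := (fiber Omega p).
Local Notation k_ := (k_ Omega p).

Lemma h_gt0 : 0 < h.
Proof. by rewrite invr_gt0 ltr0n. Qed.

Definition kseq (x : R) : seq int := sort <=%R (fset_set (fiber x)).

Lemma k_E i x : k_ i x = nth 0 (kseq x) i.
Proof. by []. Qed.

(** |k| / p <= |x + k/p| + |x|, where the first term is bounded because x + k/p lies in Omega. *)
Lemma fiber_window (r : R) : exists N : nat, forall x k,
  `|x| <= r -> fiber x k -> k \in int_window N.
Proof.
(* [bounded_set] provides a bound for every real strictly above M, hence M + 1. *)
have [M [_ OM]] := Obnd; have := OM (M + 1); rewrite ltrDl ltr01 => /(_ isT) {}OM.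
have [N rN] : exists N : nat, p%:R * (M + 1 + r) < N%:R.
  by exists (Num.truncn (p%:R * (M + 1 + r))).+1; exact: truncnS_gt.
exists N => x k xr fk; rewrite mem_int_window -(ler_int R) intr_norm.
have := OM _ fk; rewrite /= => kM.
have : `|k%:~R / p%:R| <= M + 1 + r.
  rewrite -[k%:~R / _](addKr x) addrC; apply: (le_trans (ler_normB _ _)).
  by rewrite lerD.
rewrite normrM (ger0_norm (ltW h_gt0)) ler_pdivrMr ?ltr0n//.
by rewrite mulrC => /le_trans; apply; exact: ltW.
Qed.

Lemma fiber_finite x : finite_set (fiber x).
Proof.
have [N xN] := fiber_window `|x|.
apply: (@sub_finite_set _ _ [set` int_window N]) => [k /xN|]; first exact.
exact: finite_seq.
Qed.

Lemma kseq_sorted x : sorted <%O (kseq x).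
Proof. by rewrite sort_lt_sorted fset_uniq. Qed.

Lemma mem_kseq x k : (k \in kseq x) = `[< fiber x k >].
Proof.
rewrite mem_sort; apply/idP/asboolP; last first.
  by move=> fk; rewrite in_fset_set ?inE//; exact: fiber_finite.
by rewrite in_fset_set ?inE//; exact: fiber_finite.
Qed.

Lemma kseq_uniq x : uniq (kseq x).
Proof. by rewrite sort_uniq fset_uniq. Qed.

Lemma kseq_eq x (s : seq int) : sorted <%O s -> (forall k, (k \in s) = `[< fiber x k >]) ->
  kseq x = s.
Proof.
by move=> ss sE; apply: (lt_sorted_eq (kseq_sorted x) ss) => k; rewrite mem_kseq sE.
Qed.

(** For bounded x the fiber is filtered out of one fixed sorted list by conditions measurable in x;
    this is the source of the measurability of k_i. *)
Lemma kseq_window (r : R) : exists N : nat, forall x, `|x| <= r ->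
  kseq x = [seq k <- int_window N | `[< fiber x k >]].
Proof.
have [N xN] := fiber_window r; exists N => x xr; apply: kseq_eq.
  by apply: sorted_filter; [exact: lt_trans|exact: int_window_sorted].
move=> k; rewrite mem_filter andb_idr// => /asboolP fk.
exact: (xN x).
Qed.

Lemma measurable_fiber k : measurable ([set x | fiber x k] : set mR).
Proof. exact: measurable_translate. Qed.

(** An arbitrary G carries the induction: whether the head k is kept is a measurable test, and a
    kept k is absorbed into G. *)
Lemma measurable_filter_fiber (G : seq int -> R) (s : seq int) :
  measurable_fun setT (fun x : mR => G [seq k <- s | `[< fiber x k >]]).
Proof.
elim: s G => [|k s IH] G /=; first exact: measurable_cst.
under eq_fun do rewrite (fun_if G).
apply: measurable_fun_ifT; [|exact: (IH (fun s => G (k :: s)))|exact: IH].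
apply: (measurable_fun_bool true); rewrite setTI.
rewrite (_ : _ @^-1` _ = [set x | fiber x k]); first exact: measurable_fiber.
by apply/seteqP; split=> x /= /asboolP.
Qed.

Lemma measurable_kseq (G : seq int -> R) :
  measurable_fun setT (fun x : mR => G (kseq x)).
Proof.
have -> : [set: mR] = \bigcup_(n : nat) `[- n%:R, n%:R]%classic.
  apply/seteqP; split=> // x _; exists (Num.truncn `|x : R|).+1 => //=.
  by rewrite in_itv /= -ler_norml ltW//; exact: truncnS_gt.
apply/measurable_fun_bigcup => [n|n]; first exact: measurable_itv.
have [N xN] := kseq_window n%:R.
apply: (eq_measurable_fun (fun x : mR => G [seq k <- int_window N | `[< fiber x k >]])).
  by move=> x; rewrite inE /= in_itv /= -ler_norml => /xN ->.
by apply: measurable_funTS; exact: measurable_filter_fiber.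
Qed.

Lemma measurable_k i : measurable_fun setT (fun x : mR => (k_ i x)%:~R : R).
Proof. exact: (measurable_kseq (fun s => (nth 0 s i)%:~R)). Qed.

Lemma fiber_shift x k (n : int) : fiber (x + n%:~R / p%:R) k = fiber x (k + n).
Proof. by rewrite /Defs.fiber /= intrD mulrDl addrA addrAC. Qed.

Lemma kseq_shift x (n : int) : kseq (x + n%:~R / p%:R) = [seq k - n | k <- kseq x].
Proof.
apply: kseq_eq.
  rewrite sorted_map; apply: sub_sorted (kseq_sorted x) => a b /=.
  by rewrite ltrD2r.
move=> k; rewrite fiber_shift -mem_kseq -[k in LHS](addrK n).
by apply: (mem_map (f := fun k => k - n)) => a b /addIr.
Qed.

(** Stated through the length of the list, so that [nth] with an index below p never falls back on
    its default value. *)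
Definition good x := size (kseq x) = p.

Lemma good_shift x (n : int) : good (x + n%:~R / p%:R) = good x.
Proof. by rewrite /good kseq_shift size_map. Qed.

Lemma k_shift x (n : int) i : good x -> (i < p)%N ->
  k_ i (x + n%:~R / p%:R) = k_ i x - n.
Proof. by move=> gx ip; rewrite !k_E kseq_shift (nth_map 0)// gx. Qed.

Lemma k_periodic x i : good x -> (i < p)%N -> k_ i (x + h) = k_ i x - 1.
Proof. by move=> gx ip; have := k_shift 1 gx ip; rewrite mul1r. Qed.

Lemma k_fiber x i : good x -> (i < p)%N -> fiber x (k_ i x).
Proof.
by move=> gx ip; apply/asboolP; rewrite -mem_kseq; apply: mem_nth; rewrite gx.
Qed.

Lemma fiber_kP x k : good x -> fiber x k -> exists i : 'I_p, k = k_ i x.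
Proof.
move=> gx /asboolP; rewrite -mem_kseq => /(nthP 0)[n]; rewrite gx => ip <-.
by exists (Ordinal ip).
Qed.

Lemma k_inj x (i j : 'I_p) : good x -> k_ i x = k_ j x -> i = j.
Proof.
move=> gx /eqP; rewrite !k_E nth_uniq ?gx// ?kseq_uniq//.
by move/eqP/val_inj.
Qed.

Lemma k_lt x (i j : 'I_p) : good x -> (i < j)%N -> k_ i x < k_ j x.
Proof.
move=> gx ij; rewrite !k_E.
by apply: (sorted_ltn_nth lt_trans 0 (kseq_sorted x)) => //; rewrite inE gx.
Qed.

Lemma good_card x : good x -> fiber x #= `I_p.
Proof.
move=> gx; apply/(fcard_eq (fiber_finite x) (finite_II p)).
by rewrite (card_fset_set (card_eqxx _)) -[RHS]gx /kseq size_sort.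
Qed.

Lemma ae_good : p_tiles Omega p -> {ae leb, forall x, good x}.
Proof.
apply: aeS => x tx.
have : fiber x #= `I_p.
  apply: card_eq_trans tx.
  (* Tiling counts the j with x - j/p in Omega, the fiber the k with x + k/p in Omega; hence the
     sign. *)
  have -> : [set j : int | [set w + j%:~R / p%:R | w in Omega] x] = -%R @` fiber x.
    apply/seteqP; split=> j /=.
      move=> [w Ow <-]; exists (- j); last by rewrite opprK.
      by rewrite /Defs.fiber /= rmorphN mulNr addrK.
    move=> [k fk <-]; exists (x + k%:~R / p%:R) => //.
    by rewrite rmorphN mulNr addrK.
  by rewrite card_eq_sym; apply: inj_card_eq => k l _ _; exact: oppr_inj.
by move/card_fset_set; rewrite /good size_sort.
Qed.

End Fibers.

(** * Decomposition of Omega over the cell, and the inverse of W *)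

Section FiberDecomposition.
Variable R : realType.
Local Notation leb := (@lebesgue_measure R).
Local Notation mR := (measurableTypeR R).
Local Notation C := R[i].
Local Notation normc := ComplexField.Normc.normc.
Variables (Omega : set R) (p : nat) (hp : (0 < p)%N).
Hypothesis Obnd : bounded_set (Omega : set R^o).
Hypothesis Omeas : measurable (Omega : set mR).
Hypothesis Otile : p_tiles Omega p.
Local Notation h := ((p%:R : R)^-1).
Local Notation cell := (cell p : set R).
Local Notation fiber := (fiber Omega p).
Local Notation k_ := (k_ Omega p).
Local Notation good := (good Omega p).
Local Notation W := (W Omega p).
Local Notation H := (L2Omega Omega).
Local Notation K := (L2cell R p).
Let h0 : 0 < h := h_gt0 R hp.
Let mcell : measurable (cell : set mR) := measurable_itv _.

Lemma cellE (y : R) : cell y = (0 <= y < h) :> Prop.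
Proof. by rewrite /Defs.cell /= in_itv. Qed.

Lemma prehilbert_Omega : prehilbert H.
Proof. exact: L2_prehilbert. Qed.

Lemma prehilbert_cell : prehilbert K.
Proof. exact: L2vec_prehilbert. Qed.

(** Integer part relative to the lattice (1/p) Z; with the fractional part [cell_part],
    [periodize F] is by definition the composite of F and [cell_part]. *)
Definition cell_index (x : R) : int := Num.floor (x * p%:R).

Definition cell_part (x : R) : R := x - (cell_index x)%:~R / p%:R.

Lemma cell_partP x : cell (cell_part x).
Proof. by have := floor_cell h0 x; rewrite cellE invrK. Qed.

Lemma cell_partE x : cell_part x + (cell_index x)%:~R / p%:R = x.
Proof. by rewrite subrK. Qed.

Lemma cell_index_add y (n : int) : cell y -> cell_index (y + n%:~R / p%:R) = n.
Proof.
rewrite cellE => /andP[y0 yh]; apply: floor_def.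
have p0 : (0 : R) < p%:R by rewrite ltr0n.
rewrite mulrDl divfK ?gt_eqF// intrD lerDr addrC ltrD2l mulr_ge0 ?(ltW p0)//=.
by rewrite -ltr_pdivlMr// mul1r.
Qed.

Lemma cell_part_add y (n : int) : cell y -> cell_part (y + n%:~R / p%:R) = y.
Proof. by move=> cy; rewrite /cell_part cell_index_add// addrK. Qed.

Lemma cell_part_id y : cell y -> cell_part y = y.
Proof. by move=> cy; have := cell_part_add 0 cy; rewrite mul0r addr0. Qed.

Lemma cell_part_periodic x (n : int) : cell_part (x + n%:~R / p%:R) = cell_part x.
Proof.
rewrite -{1}(cell_partE x) -addrA -mulrDl -intrD cell_part_add//.
exact: cell_partP.
Qed.

Lemma good_cell_part x : good (cell_part x) = good x.
Proof. by rewrite -{2}(cell_partE x) good_shift. Qed.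

Lemma periodizeE (F : R -> 'cV[C]_p) x : periodize F x = F (cell_part x).
Proof. by []. Qed.

Lemma ae_cell_part (P : R -> Prop) : {ae leb, forall x, cell x -> P x} ->
  {ae leb, forall x, P (cell_part x)}.
Proof.
move=> aeP; apply: (ae_periodic h0).
- by move=> x; have := cell_part_periodic x 1; rewrite mul1r => ->.
- by move=> x; have := cell_part_periodic x 1; rewrite mul1r => ->.
- by apply: aeS aeP => x Px cx; rewrite cell_part_id//; exact: Px.
Qed.

Lemma measurable_cell_index : measurable_fun setT (fun x : mR => (cell_index x)%:~R : R).
Proof.
apply: nondecreasing_measurable => // x y xy.
rewrite ler_int /cell_index; apply: (@le_floor R).
by apply: ler_wpM2r xy; exact: ler0n.
Qed.

Lemma measurable_cell_part : measurable_fun setT (cell_part : mR -> mR).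
Proof.
apply: (@measurable_funB _ mR R) => //; apply: (@measurable_funM _ mR R) => //.
exact: measurable_cell_index.
Qed.

Lemma measurable_fiber_point i : measurable_fun setT
  (fun x : mR => (x + (k_ i x)%:~R / p%:R : R) : mR).
Proof.
apply: (@measurable_funD _ mR R) => //; apply: (@measurable_funM _ mR R) => //.
exact: measurable_k.
Qed.

(** After slicing Omega by lattice cells, the terms that survive at a point x of the cell are those
    with n in the fiber, and in increasing order these are k_0(x), ..., k_(p-1)(x). Applied to
    squared moduli, this makes W isometric. *)
Lemma ge0_integral_fiber (f : R -> \bar R) :
  measurable_fun setT (f : mR -> \bar R) -> (forall x, (0 <= f x)%E) ->
  (\int[leb]_(x in Omega) f x = \sum_(i < p)
    \int[leb]_(x in cell) f (x + (k_ i x)%:~R / p%:R)%R)%E.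
Proof.
move=> mf f0; have [N kN] := kseq_window hp Obnd h.
have cN x : cell x -> `|x| <= h.
  by rewrite cellE => /andP[x0 /ltW]; rewrite ger0_norm.
have usN := sorted_uniq lt_trans ltxx (int_window_sorted N).
rewrite (ge0_integral_cells h0 Omeas usN)//; last first.
  move=> x n /cN xh fn; have : n \in kseq Omega p x by rewrite mem_kseq//; exact/asboolP.
  by rewrite kN// mem_filter => /andP[].
have mfD : measurable_fun setT (f \_ Omega : mR -> \bar R).
  by apply/(measurable_restrictT _ _).1 => //; exact: measurable_funTS.
have mfk i : measurable_fun setT (fun x : mR => f (x + (k_ i x)%:~R / p%:R)%R).
  by apply: (measurableT_comp mf); exact: measurable_fiber_point.
rewrite -ge0_integral_sum//; last by move=> i; exact: measurable_funTS.
apply: ae_eq_integral => //.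
- apply: emeasurable_sum => n; apply: measurable_funTS.
  exact: (measurable_fun_translate _ mfD).
- by apply: emeasurable_sum => i; exact: measurable_funTS.
apply: aeS (ae_good Otile) => x gx cx.
rewrite (eq_bigr (fun n : int => if `[< fiber x n >] then
    f (x + n%:~R / p%:R)%R else 0%E)); last first.
  by move=> n _; rewrite patchE; congr (if _ then _ else _);
     apply/idP/asboolP; rewrite inE.
rewrite -big_mkcond -big_filter -kN; last exact: cN.
by rewrite (big_nth 0) big_mkord gx.
Qed.

(** k_i(x) varies with x but is an integer, so discarding countably many translates of one null set
    is enough. *)
Lemma ae_fiber_point (P : R -> Prop) : {ae leb, forall x, P x} ->
  {ae leb, forall x, forall i, P (x + (k_ i x)%:~R / p%:R)}.
Proof.
move=> aeP; have : {ae leb, forall x, forall n : int, P (x + n%:~R / p%:R)}.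
  by apply: ae_all_int => n; exact: ae_translate.
by apply: aeS => x Px i.
Qed.

Lemma cmeasurable_fiber_point (f : R -> C) i : cmeasurable (f : mR -> C) ->
  cmeasurable (fun x : mR => f (x + (k_ i x)%:~R / p%:R)).
Proof.
by move=> [mf1 mf2]; split; [apply: (measurableT_comp mf1)|
  apply: (measurableT_comp mf2)]; exact: measurable_fiber_point.
Qed.

Lemma integral_normc2_fiber (f : R -> C) : cmeasurable (f : mR -> C) ->
  (\int[leb]_(x in Omega) (normc (f x) ^+ 2)%:E = \sum_(i < p)
    \int[leb]_(x in cell) (normc (W f x i ord0) ^+ 2)%:E)%E.
Proof.
move=> mf; rewrite ge0_integral_fiber//.
- by apply: eq_bigr => i _; apply: eq_integral => x _; rewrite mxE.
- by apply/measurable_EFinP; exact: measurable_normc2.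
- by move=> x; rewrite lee_fin sqr_ge0.
Qed.

Lemma W_mem f : hmem H f -> hmem K (W f).
Proof.
move=> [mf fi] i.
have -> : (fun x => W f x i ord0) = (fun x => f (x + (k_ i x)%:~R / p%:R)).
  by apply/funext => x; rewrite mxE.
split; first exact: cmeasurable_fiber_point.
rewrite integral_normc2_fiber// in fi; apply: le_lt_trans fi.
rewrite (bigD1 i)//= (_ : integral _ _ _ =
  \int[leb]_(x in cell) (normc (W f x i ord0) ^+ 2)%:E)%E; last first.
  by apply: eq_integral => x _; rewrite mxE.
apply: leeDl; apply: sume_ge0 => j _.
by apply: integral_ge0 => x _; rewrite lee_fin sqr_ge0.
Qed.

Lemma L2_fin_num D f : measurable (D : set mR) -> hmem (L2 leb D) f ->
  (\int[leb]_(x in D) (normc (f x) ^+ 2)%:E)%E \is a fin_num.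
Proof.
by move=> mD /L2_memP[_]; exact: integrable_fin_num.
Qed.

Lemma W_nsq f : hmem H f -> nsq (W f : hvec K) = nsq f.
Proof.
move=> mf; rewrite nsq_L2vec nsq_L2 /Rintegral.
rewrite (integral_normc2_fiber mf.1) -sum_fine// => i _.
exact: (L2_fin_num mcell (W_mem mf i)).
Qed.

Lemma W_eqv f g : heqv H f g -> heqv K (W f) (W g).
Proof.
move=> /ae_fiber_point fg.
move: (ae_good Otile) fg; apply: aeS2 => x gx fg cx.
apply/matrixP => i j; rewrite !mxE; apply: fg.
exact: (k_fiber hp Obnd gx (ltn_ord i)).
Qed.

Lemma W_isometry : linear_isometry (W : hvec H -> hvec K).
Proof.
split.
- by split=> [|f g _ _]; [exact: W_mem|exact: W_eqv].
- move=> a f g _ _; suff -> : W (a *: f + g) = a *: (W f : hvec K) + W g.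
    exact: (ph_refl prehilbert_cell).
  by apply/funext => x; apply/matrixP => i j; rewrite !mxE.
- by move=> f mf; rewrite !hnorm_nsq W_nsq.
Qed.

(** When [cell_part x] is good, [k_inj] leaves at most one nonzero term. A sum of cases replaces the
    choice of i, so that measurability is checked term by term. *)
Definition Winv (F : R -> 'cV[C]_p) (x : R) : C :=
  \sum_(i < p) if k_ i (cell_part x) == cell_index x
    then F (cell_part x) i ord0 else 0.

Lemma Winv_fiber F y (i : 'I_p) : good y -> cell y ->
  Winv F (y + (k_ i y)%:~R / p%:R) = F y i ord0.
Proof.
move=> gy cy; rewrite /Winv cell_part_add// cell_index_add// (bigD1 i)//= eqxx.
rewrite big1 ?addr0// => j ji; case: eqP => // /(k_inj gy) ij.
by rewrite ij eqxx in ji.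
Qed.

Lemma cmeasurable_Winv F : hmem K F -> cmeasurable (Winv F : mR -> C).
Proof.
move=> mF; apply: cmeasurable_sum => i; have [[mF1 mF2] _] := mF i.
have mb : measurable_fun setT (fun x : mR => k_ i (cell_part x) == cell_index x).
  rewrite (_ : (fun _ => _) = (fun x : mR =>
    ((k_ i (cell_part x))%:~R == (cell_index x)%:~R :> R))); last first.
    by apply/funext => x; rewrite eqr_int.
  apply: measurable_fun_eqr; last exact: measurable_cell_index.
  by apply: (measurableT_comp (measurable_k hp Obnd Omeas i)); exact: measurable_cell_part.
split.
  under eq_fun do rewrite (fun_if (@complex.Re R)); apply: measurable_fun_ifT => //.
  by apply: (measurableT_comp mF1); exact: measurable_cell_part.
under eq_fun do rewrite (fun_if (@complex.Im R)); apply: measurable_fun_ifT => //.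
by apply: (measurableT_comp mF2); exact: measurable_cell_part.
Qed.

Lemma W_Winv F : heqv K (W (Winv F)) F.
Proof.
apply: aeS (ae_good Otile) => x gx cx; apply/matrixP => i j.
by rewrite mxE Winv_fiber// (ord1 j).
Qed.

Lemma cell_decomposition x : good x -> Omega x ->
  exists i : 'I_p, cell_part x + (k_ i (cell_part x))%:~R / p%:R = x.
Proof.
move=> gx Ox; have gy : good (cell_part x) by rewrite good_cell_part.
have fy : fiber (cell_part x) (cell_index x) by rewrite /Defs.fiber /= cell_partE.
have [i ki] := fiber_kP hp Obnd gy fy.
by exists i; rewrite -ki cell_partE.
Qed.

Lemma Winv_W f : heqv H (Winv (W f)) f.
Proof.
apply: aeS (ae_good Otile) => x gx Ox.
have gy : good (cell_part x) by rewrite good_cell_part.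
have [i ix] := cell_decomposition gx Ox.
by rewrite -[in LHS]ix Winv_fiber//; [rewrite mxE ix|exact: cell_partP].
Qed.

(** The integral over Omega becomes one of [W (Winv F)] over the cell, where [W_Winv] identifies the
    integrand with that of F. *)
Lemma Winv_mem F : hmem K F -> hmem H (Winv F).
Proof.
move=> mF; have mV := cmeasurable_Winv mF; split=> //.
rewrite integral_normc2_fiber//; apply: lte_sum_pinfty => i _.
have [mFi Fi] := mF i; apply: le_lt_trans Fi; rewrite le_eqVlt; apply/orP; left.
apply/eqP; apply: ae_eq_integral => //.
- apply/measurable_EFinP; apply: measurable_funTS; apply: measurable_normc2.
  rewrite (_ : (fun _ => _) = (fun x => Winv F (x + (k_ i x)%:~R / p%:R))).
    exact: cmeasurable_fiber_point.
  by apply/funext => x; rewrite mxE.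
- by apply/measurable_EFinP; apply: measurable_funTS; exact: measurable_normc2.
- by apply: aeS (W_Winv F) => x WV cx; rewrite WV.
Qed.

Lemma Winv_eqv F G : heqv K F G -> heqv H (Winv F) (Winv G).
Proof.
move=> /ae_cell_part; apply: aeS => x FG Ox.
by apply: eq_bigr => i _; rewrite FG.
Qed.

Lemma W_Winv_inverse : inverse_operators H K W Winv.
Proof.
split.
- by split=> [|f g _ _]; [exact: W_mem|exact: W_eqv].
- by split=> [|f g _ _]; [exact: Winv_mem|exact: Winv_eqv].
- by move=> f _; exact: Winv_W.
- by move=> F _; exact: W_Winv.
Qed.

Lemma fiber_structure : {ae leb, forall x : R,
  [/\ fiber x #= `I_p, fiber x = range (fun i : 'I_p => k_ i x) &
      forall i j : 'I_p, (i < j)%N -> k_ i x < k_ j x]}.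
Proof.
apply: aeS (ae_good Otile) => x gx; split.
- exact: good_card.
- apply/seteqP; split=> [k /(fiber_kP hp Obnd gx)[i ->]|k [i _ <-]].
    by exists i.
  exact: (k_fiber hp Obnd gx (ltn_ord i)).
- by move=> i j; exact: k_lt.
Qed.

Lemma cell_decomposition_unique : {ae leb, forall x : R, Omega x ->
  exists! yi : R * 'I_p, cell yi.1 /\ yi.1 + (k_ yi.2 yi.1)%:~R / p%:R = x}.
Proof.
apply: aeS (ae_good Otile) => x gx Ox.
have [i ix] := cell_decomposition gx Ox.
exists (cell_part x, i); split; first by split=> //; exact: cell_partP.
move=> [y j] /= [cy jx].
have yE : y = cell_part x by rewrite -jx cell_part_add.
have gy : good (cell_part x) by rewrite good_cell_part.
rewrite yE; congr (_, _); apply: (k_inj gy).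
have cx := cell_partP x.
(* k_i and k_j at [cell_part x] are both the cell index of x. *)
have e1 := cell_index_add (k_ i (cell_part x)) cx; rewrite ix in e1.
have e2 := cell_index_add (k_ j (cell_part x)) cx; rewrite -yE jx in e2.
by rewrite -e1 e2 yE.
Qed.

Lemma k_periodic_ae : {ae leb, forall x : R, forall i : 'I_p,
  k_ i (x + h) = k_ i x - 1}.
Proof.
by apply: aeS (ae_good Otile) => x gx i; exact: k_periodic.
Qed.

Lemma Winv_formula F : {ae leb, forall x : R, Omega x ->
  forall (y : R) (i : 'I_p), cell y ->
    x = y + (k_ i y)%:~R / p%:R -> Winv F x = F y i ord0}.
Proof.
apply: aeS (ae_good Otile) => x gx Ox y i cy xE.
have gy : good y by rewrite -(cell_part_add (k_ i y) cy) good_cell_part -xE.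
by rewrite xE Winv_fiber.
Qed.

End FiberDecomposition.

(** * Exponential functions *)

Section Exponentials.
Variable R : realType.
Local Notation C := R[i].
Local Notation mR := (measurableTypeR R).
Local Notation normc := ComplexField.Normc.normc.
Implicit Types a b x y : R.

Lemma e_C a x : e_ a x = e_ x a.
Proof. by rewrite /e_ mulrC [a * x]mulrC mulrC. Qed.

Lemma e_Dr a x y : e_ a (x + y) = e_ a x * e_ a y.
Proof.
by apply: eq_ReIm; rewrite ?ReM ?ImM /e_ /= !mulrDr ?cosD ?sinD// addrC.
Qed.

Lemma e_Dl a b x : e_ (a + b) x = e_ a x * e_ b x.
Proof. by rewrite ![e_ _ x]e_C e_Dr. Qed.

Lemma e_0l x : e_ 0 x = 1.
Proof. by rewrite /e_ mul0r mulr0 cos0 sin0. Qed.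

Lemma e_0r a : e_ a 0 = 1.
Proof. by rewrite e_C e_0l. Qed.

Lemma e_conj a x : (e_ a x)^* = e_ (- a) x.
Proof.
by apply: eq_ReIm; rewrite ?Re_conj ?Im_conj /e_ /= mulNr mulrN ?cosN ?sinN.
Qed.

Lemma normc_e a x : normc (e_ a x) = 1.
Proof. by rewrite /e_ /= cos2Dsin2 sqrtr1. Qed.

Lemma e_int a (n : int) : e_ a 1 = 1 -> e_ a n%:~R = 1.
Proof.
move=> a1; have en (m : nat) : e_ a m%:R = 1.
  by elim: m => [|m IH]; rewrite ?e_0r// -natr1 e_Dr IH a1 mulr1.
case: n => n; first exact: en.
rewrite NegzE rmorphN -[LHS]mulr1 -[X in _ * X](en n.+1) -e_Dr.
by rewrite addNr e_0r.
Qed.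

Lemma e_int_int (m n : int) : e_ (m%:~R : R) n%:~R = 1.
Proof.
apply: e_int; rewrite e_C; apply: e_int.
by rewrite /e_ !mulr1 mulr_natl cos2pi sin2pi.
Qed.

Lemma e_natM (p : nat) (m n : int) : (0 < p)%N ->
  e_ (m%:~R * p%:R : R) (n%:~R / p%:R) = 1.
Proof.
move=> hp; rewrite -(e_int_int m n) /e_.
have -> // : m%:~R * p%:R * (n%:~R / p%:R) = m%:~R * n%:~R :> R.
by field; rewrite pnatr_eq0 -lt0n.
Qed.

Lemma continuous_cos_e a : continuous (fun x => cos (2 * pi * (a * x))).
Proof.
move=> x; apply: (@continuous_comp _ _ _ (fun y : R => 2 * pi * (a * y)) cos).
  by apply: cvgMr; apply: cvgMr; exact: cvg_id.
exact: continuous_cos.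
Qed.

Lemma continuous_sin_e a : continuous (fun x => sin (2 * pi * (a * x))).
Proof.
move=> x; apply: (@continuous_comp _ _ _ (fun y : R => 2 * pi * (a * y)) sin).
  by apply: cvgMr; apply: cvgMr; exact: cvg_id.
exact: continuous_sin.
Qed.

Lemma cmeasurable_e a : cmeasurable (e_ a : mR -> C).
Proof.
split; apply: continuous_measurable_fun.
  exact: continuous_cos_e.
exact: continuous_sin_e.
Qed.

Lemma normc_e_dist a t : normc (e_ a s - e_ a t) @[s --> t] --> (0 : R).
Proof.
pose F (s : R) := (cos (2 * pi * (a * s)) - cos (2 * pi * (a * t))) ^+ 2 +
  (sin (2 * pi * (a * s)) - sin (2 * pi * (a * t))) ^+ 2.
have F0 : F s @[s --> t] --> (0 : R).
  rewrite (_ : 0 = F t); last by rewrite /F !subrr expr0n addr0.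
  by apply: cvgD; rewrite expr2; under eq_fun do rewrite expr2; apply: cvgM;
    apply: cvgB (cvg_cst _); [exact: continuous_cos_e|exact: continuous_cos_e|
    exact: continuous_sin_e|exact: continuous_sin_e].
rewrite (_ : (fun s => _) = Num.sqrt \o F)// -sqrtr0.
by apply: cvg_comp F0 _; exact: sqrt_continuous.
Qed.

Lemma L2_bounded (mu : {measure set mR -> \bar R}) (D : set R) (f : R -> C) M :
  measurable (D : set mR) -> (mu D < +oo)%E -> cmeasurable (f : mR -> C) ->
  (forall x, D x -> normc (f x) <= M) -> hmem (L2 mu D) f.
Proof.
move=> mD muD mf fM; split=> //.
apply: (@le_lt_trans _ _ (\int[mu]_(x in D) (M ^+ 2)%:E)%E).
  apply: ge0_le_integral => //.
  - by move=> x _; rewrite lee_fin sqr_ge0.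
  - by apply/measurable_EFinP; apply: measurable_funTS; exact: measurable_normc2.
  - move=> x Dx; rewrite lee_fin ler_sqr ?nnegrE ?normc_ge0 ?fM//.
    by apply: le_trans (fM _ Dx); exact: normc_ge0.
rewrite integral_cst//=; apply: lte_mul_pinfty => //.
by rewrite lee_fin; exact: sqr_ge0.
Qed.

Lemma L2_e (mu : {measure set mR -> \bar R}) (D : set R) a :
  measurable (D : set mR) -> (mu D < +oo)%E -> hmem (L2 mu D) (e_ a : mR -> C^o).
Proof.
move=> mD muD; apply: (@L2_bounded mu D _ 1) => //; first exact: cmeasurable_e.
by move=> x _; rewrite normc_e.
Qed.

End Exponentials.

(** * Completeness of the exponentials on the cell *)

Section Fourier.
Variable R : realType.
Local Notation leb := (@lebesgue_measure R).
Local Notation mR := (measurableTypeR R).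
Local Notation C := R[i].
Local Notation Re := complex.Re.
Local Notation Im := complex.Im.
Local Notation normc := ComplexField.Normc.normc.
Variables (p : nat) (hp : (0 < p)%N).
Local Notation h := ((p%:R : R)^-1).
Local Notation cell := (cell p : set R).
Local Notation H := (L2 leb cell).
Let h0 : 0 < h := h_gt0 R hp.
Let mcell : measurable (cell : set mR) := measurable_itv _.
Let pH : prehilbert H := L2_prehilbert leb mcell.
Local Notation "x %:RC" := (x%:C%C : C) (at level 2, format "x %:RC").
Local Notation cst_RC f := (fun x : mR => (f x)%:C%C : C).

Lemma leb_cell : leb cell = h%:E.
Proof. by rewrite lebesgue_measure_itv /= lte_fin h0 sube0. Qed.

Lemma leb_cell_fin : (leb cell < +oo)%E.
Proof. by rewrite leb_cell ltry. Qed.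

(** Trigonometric polynomials as lists of coefficients with frequencies, repetitions allowed: a sum
    is a concatenation and a product a list of all pairs. *)
Definition trig (f : R -> C) : Prop := exists t : seq (C * int),
  f = fun x => \sum_(u <- t) u.1 * e_ (u.2%:~R * p%:R) x.

Lemma trig_e (n : int) : trig (e_ (n%:~R * p%:R)).
Proof. by exists [:: (1, n)]; apply/funext => x; rewrite big_seq1 mul1r. Qed.

Lemma trig_cst (c : C) : trig (fun=> c).
Proof.
by exists [:: (c, 0)]; apply/funext => x; rewrite big_seq1 /= mul0r e_0l mulr1.
Qed.

Lemma trigD f g : trig f -> trig g -> trig (fun x => f x + g x).
Proof. by move=> [s ->] [t ->]; exists (s ++ t); apply/funext => x; rewrite big_cat. Qed.

Lemma trigM f g : trig f -> trig g -> trig (fun x => f x * g x).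
Proof.
move=> [s ->] [t ->].
exists [seq (u.1 * v.1, u.2 + v.2) | u <- s, v <- t]; apply/funext => x.
rewrite big_allpairs_dep mulr_suml; apply: eq_bigr => u _.
rewrite mulr_sumr; apply: eq_bigr => v _ /=.
by rewrite intrD mulrDl e_Dl mulrACA.
Qed.

Lemma trigX f n : trig f -> trig (fun x => f x ^+ n).
Proof.
move=> tf; elim: n => [|n IH]; first exact: trig_cst.
by under eq_fun do rewrite exprS; exact: trigM.
Qed.

Lemma trig_cmeasurable f : trig f -> cmeasurable (f : mR -> C).
Proof.
move=> [t ->]; apply: cmeasurable_sum => u.
by apply: cmeasurableM; [exact: cmeasurable_cst|exact: cmeasurable_e].
Qed.

Lemma trig_bounded f : trig f -> exists M, forall x, normc (f x) <= M.
Proof.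
move=> [t ->]; exists (\sum_(u <- t) normc u.1) => x.
elim: t => [|u t IH]; first by rewrite !big_nil ComplexField.Normc.normc0.
rewrite !big_cons; apply: (le_trans (le_normcD _ _)); apply: lerD => //.
by rewrite ComplexField.Normc.normcM normc_e mulr1.
Qed.

Lemma trig_mem f : trig f -> hmem H f.
Proof.
move=> tf; have [M fM] := trig_bounded tf.
apply: (@L2_bounded _ _ _ _ M) => //; first exact: leb_cell_fin.
exact: trig_cmeasurable.
Qed.

Definition trig_limit (f : R -> C) : Prop := hmem H f /\
  forall eps : R, 0 < eps -> exists T, trig T /\ nsq ((f : hvec H) - T) < eps.

Lemma trig_limit_trig f : trig f -> trig_limit f.
Proof.
move=> tf; split; first exact: trig_mem.
move=> eps e0; exists f; split=> //.
by rewrite subrr /nsq (hip0l pH)//; exact: ph0.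
Qed.

Lemma trig_limit_lim f : hmem H f -> (forall eps : R, 0 < eps ->
  exists g, trig_limit g /\ nsq ((f : hvec H) - g) < eps) -> trig_limit f.
Proof.
move=> mf fg; split=> // eps e0.
have e4 : 0 < eps / 4 by rewrite divr_gt0.
have [g [[mg /(_ _ e4)[T [tT gT]]] {}fg]] := fg _ e4.
exists T; split=> //; have mT := trig_mem tT.
have -> : (f : hvec H) - T = (f - g) + (g - T) by rewrite addrA subrK.
apply: (le_lt_trans (nsqD_le pH (memB pH mf mg) (memB pH mg mT))).
by move: fg gT; lra.
Qed.

Lemma trig_limitD f g : trig_limit f -> trig_limit g ->
  trig_limit (fun x => f x + g x).
Proof.
move=> [mf fT] [mg gT]; split; first exact: (memD pH mf mg).
move=> eps e0; have e4 : 0 < eps / 4 by rewrite divr_gt0.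
have [S [tS fS]] := fT _ e4; have [T [tT {}gT]] := gT _ e4.
exists (fun x => S x + T x); split; first exact: trigD.
have mS := trig_mem tS; have mT := trig_mem tT.
have -> : ((fun x => f x + g x) : hvec H) - (fun x => S x + T x) =
  ((f : hvec H) - S) + ((g : hvec H) - T) by rewrite addrACA -opprD.
apply: (le_lt_trans (nsqD_le pH (memB pH mf mS) (memB pH mg mT))).
by move: fS gT; lra.
Qed.

Lemma nsq_mul_bounded (M : R) f g : cmeasurable (f : mR -> C) -> hmem H g ->
  (forall x, cell x -> normc (f x) <= M) ->
  nsq ((fun x => f x * g x) : hvec H) <= M ^+ 2 * nsq (g : hvec H).
Proof.
move=> mf mg fM; have mfg : hmem H (fun x => f x * g x) by exact: (L2_mul_bounded mcell mf mg fM).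
have /L2_memP[_ ig] := mg; have /L2_memP[_ ifg] := mfg.
rewrite !nsq_L2 -RintegralZl//; apply: le_Rintegral => //.
  by apply: eq_integrable (integrableZl mcell (M ^+ 2) ig).
move=> x cx; rewrite ComplexField.Normc.normcM exprMn ler_wpM2r ?sqr_ge0//.
have M0 : 0 <= M by apply: le_trans (fM _ cx); exact: normc_ge0.
by rewrite ler_sqr ?nnegrE ?normc_ge0//; exact: fM.
Qed.

Lemma trig_limitM_trig f T : trig_limit f -> trig T ->
  trig_limit (fun x => T x * f x).
Proof.
move=> [mf fT] tT; have [M TM] := trig_bounded tT; have mT := trig_cmeasurable tT.
split; first by apply: (@L2_mul_bounded _ _ _ leb cell mcell M).
(* The 1 added to M^2 keeps the denominator positive. *)
move=> eps e0; have [|S [tS fS]] := fT (eps / (M ^+ 2 + 1)).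
  by rewrite divr_gt0// ltr_wpDl// sqr_ge0.
exists (fun x => T x * S x); split; first exact: trigM.
have mS := trig_mem tS.
have -> : ((fun x => T x * f x) : hvec H) - (fun x => T x * S x) =
   (fun x => T x * ((f : hvec H) - S) x).
  by apply/funext => x; rewrite !fctE /= -mulrBr.
apply: le_lt_trans (nsq_mul_bounded mT (memB pH mf mS) (fun x _ => TM x)) _.
rewrite ltr_pdivlMr in fS; last by rewrite ltr_wpDl// sqr_ge0.
apply: le_lt_trans fS; rewrite mulrC ler_wpM2l ?(nsq_ge0 pH (memB pH mf mS))//.
by rewrite lerDl.
Qed.

(** A product of limits in two rounds: g is replaced by a trigonometric S at a cost controlled by M,
    and S f is a limit by [trig_limitM_trig]. *)
Lemma trig_limitM (M : R) f g : trig_limit f -> (forall x, normc (f x) <= M) ->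
  trig_limit g -> trig_limit (fun x => f x * g x).
Proof.
move=> lf fM [mg gT]; have [mf _] := lf; have mfg : hmem H (fun x => f x * g x).
  by apply: (@L2_mul_bounded _ _ _ leb cell mcell M) => //; exact: mf.1.
apply: trig_limit_lim => // eps e0.
have [|S [tS gS]] := gT (eps / (M ^+ 2 + 1)).
  by rewrite divr_gt0// ltr_wpDl// sqr_ge0.
exists (fun x => S x * f x); split; first exact: trig_limitM_trig.
have mS := trig_mem tS.
have -> : ((fun x => f x * g x) : hvec H) - (fun x => S x * f x) =
   (fun x => f x * ((g : hvec H) - S) x).
  by apply/funext => x; rewrite !fctE /= mulrBr [S x * _]mulrC.
apply: le_lt_trans (nsq_mul_bounded mf.1 (memB pH mg mS) (fun x _ => fM x)) _.
rewrite ltr_pdivlMr in gS; last by rewrite ltr_wpDl// sqr_ge0.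
apply: le_lt_trans gS; rewrite mulrC ler_wpM2l ?(nsq_ge0 pH (memB pH mg mS))//.
by rewrite lerDl.
Qed.

Lemma trig_limitZ (c : C) f : trig_limit f -> trig_limit (fun x => c * f x).
Proof. by move=> lf; apply: (trig_limitM_trig lf (trig_cst c)). Qed.

Lemma trig_limit_ae f g : cmeasurable (g : mR -> C) -> heqv H f g ->
  trig_limit f -> trig_limit g.
Proof.
move=> mg fg [mf fT].
have mg' : hmem H g.
  split=> //; rewrite (_ : integral _ _ _ =
    \int[leb]_(x in cell) (normc (f x) ^+ 2)%:E)%E; first exact: mf.2.
  apply: ae_eq_integral => //.
  - by apply/measurable_EFinP; apply: measurable_funTS; exact: measurable_normc2.
  - apply/measurable_EFinP; apply: measurable_funTS; apply: measurable_normc2.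
    exact: mf.1.
  - by apply: aeS fg => x fgx cx; rewrite fgx.
apply: trig_limit_lim => // eps e0; exists f; split=> //.
rewrite (_ : nsq _ = 0)//.
rewrite (nsq_eqv pH _ (ph0 pH)) ?/nsq ?(hip0l pH)//; first exact: ph0.
  exact: memB.
have := eqvB pH (ph_sym pH fg) (ph_refl pH f); by rewrite subrr.
Qed.

Lemma cmeasurable_real (f : R -> R) : measurable_fun setT (f : mR -> R) ->
  cmeasurable (cst_RC f).
Proof. by move=> mf; split=> //; exact: measurable_cst. Qed.

Lemma normc_real (x : R) : normc (x%:C%C) ^+ 2 = x ^+ 2.
Proof. by rewrite normc_sqr /= expr0n addr0. Qed.

(** Dominated convergence for (g n - f)^2, whose integrals are squared L^2 distances. *)
Lemma trig_limit_dct (f : R -> R) (g : nat -> R -> R) (G : R -> R) :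
  hmem H (cst_RC f) -> (forall n, trig_limit (cst_RC (g n))) ->
  leb.-integrable cell (EFin \o G) ->
  (forall n x, cell x -> (g n x - f x) ^+ 2 <= G x) ->
  {ae leb, forall x, cell x -> g n x @[n --> \oo] --> f x} ->
  trig_limit (cst_RC f).
Proof.
move=> mf lg iG gG gf; apply: trig_limit_lim => // eps e0.
have mfR : measurable_fun setT (f : mR -> R) := mf.1.1.
have mgR n : measurable_fun setT (g n : mR -> R) := (lg n).1.1.1.
have md n : measurable_fun cell ((fun x => ((g n x - f x) ^+ 2)%:E) : mR -> \bar R).
  have mgf := measurable_funB (mgR n) mfR.
  by apply/measurable_EFinP; apply: measurable_funTS; exact: (measurable_funX 2 mgf).
have [] := @dominated_convergence _ mR R leb cell mcell
  (fun n x => ((g n x - f x) ^+ 2)%:E) (fun=> 0%E) (EFin \o G) md _ _ iG _.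
- exact: measurable_cst.
- apply: aeS gf => x gfx cx; have {}gfx := gfx cx.
  apply: cvg_EFin; first by near=> n.
  rewrite (_ : 0 = (f x - f x) * (f x - f x)); last by rewrite subrr mulr0.
  by apply: cvgM; apply: cvgB => //; exact: cvg_cst.
- apply: aeW => x n cx; rewrite /= ger0_norm ?sqr_ge0// lee_fin; exact: gG.
move=> _ _; rewrite integral0 => /fine_cvgP[_] /cvgrPdist_lt /(_ eps e0)[N _ /(_ N (leqnn N))].
rewrite /= sub0r normrN => lt_eps; exists (cst_RC (g N)); split=> //.
apply: le_lt_trans lt_eps; rewrite (nsqB_sym pH mf (lg N).1) nsq_L2.
apply: le_trans (ler_norm _); rewrite le_eqVlt; apply/orP; left; apply/eqP.
congr fine; apply: eq_integral => x _; congr EFin.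
by rewrite normc_sqr !fctE ReD ImD ReN ImN /= subr0 expr0n addr0.
Unshelve. all: by end_near. Qed.

Lemma trig_limit_bounded_cvg (f : R -> R) (g : nat -> R -> R) :
  measurable_fun setT (f : mR -> R) -> (forall x, 0 <= f x <= 1) ->
  (forall n x, 0 <= g n x <= 1) -> (forall n, trig_limit (cst_RC (g n))) ->
  {ae leb, forall x, cell x -> g n x @[n --> \oo] --> f x} ->
  trig_limit (cst_RC f).
Proof.
move=> mf f01 g01 lg gf; apply: (@trig_limit_dct f g (fun=> 1)) => //.
- apply: (@L2_bounded _ _ _ _ 1) => //; first exact: leb_cell_fin.
  move=> x _; have /andP[f0 f1] := f01 x.
  by rewrite -ler_sqr ?nnegrE ?normc_ge0// normc_real expr1n expr_le1.
- apply: measurable_bounded_integrable => //; first exact: leb_cell_fin.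
  exact: bounded_cst.
- move=> n x _; have /andP[f0 f1] := f01 x; have /andP[g0 g1] := g01 n x.
  nra.
Qed.

Definition trig_set (A : set R) : Prop :=
  measurable (A : set mR) /\ trig_limit (cst_RC (\1_A : R -> R)).

Lemma trig_setC A : trig_set A -> trig_set (~` A).
Proof.
move=> [mA lA]; split; first exact: measurableC.
have := trig_limitD (trig_limit_trig (trig_cst 1)) (trig_limitZ (-1) lA).
congr trig_limit; apply/funext => x; rewrite !indicE in_setC.
by case: (x \in A); apply: eq_ReIm; rewrite ?ReD ?ImD ?ReM ?ImM /=; ring.
Qed.

Lemma trig_setI A B : trig_set A -> trig_set B -> trig_set (A `&` B).
Proof.
move=> [mA lA] [mB lB]; split; first exact: measurableI.
have : forall x, normc ((\1_A x : R)%:C%C) <= 1.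
  move=> x; rewrite -ler_sqr ?nnegrE ?normc_ge0// normc_real expr1n indicE.
  by case: (x \in A); rewrite ?expr1n// expr0n.
move=> b1; have := trig_limitM lA b1 lB; congr trig_limit; apply/funext => x.
rewrite !indicE in_setI.
by case: (x \in A); case: (x \in B); apply: eq_ReIm; rewrite ?ReM ?ImM /=; ring.
Qed.

Lemma trig_setU A B : trig_set A -> trig_set B -> trig_set (A `|` B).
Proof.
move=> tA tB; rewrite -[A `|` B]setCK setCU; apply: trig_setC.
by apply: trig_setI; exact: trig_setC.
Qed.

Lemma trig_set0 : trig_set set0.
Proof.
split=> //; rewrite (_ : (fun x : mR => _) = fun=> 0).
  exact: trig_limit_trig (trig_cst 0).
by apply/funext => x; rewrite indic0.
Qed.

(** At each point the indicators of the finite unions are eventually constant, so bounded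
    convergence applies. *)
Lemma trig_set_bigcup (A : (set R)^nat) : (forall n, trig_set (A n)) ->
  trig_set (\bigcup_n A n).
Proof.
move=> tA; have mA : measurable (\bigcup_n A n : set mR).
  by apply: bigcup_measurable => n _; exact: (tA n).1.
split=> //; pose B n := \big[setU/set0]_(i < n) A i.
have tB n : trig_set (B n).
  rewrite /B; elim/big_ind: _ => // *; [exact: trig_set0|exact: trig_setU].
have ind01 (D : set R) x : 0 <= (\1_D x : R) <= 1.
  by rewrite indicE; case: (x \in D); rewrite /= ?lexx ?ler01.
apply: (trig_limit_bounded_cvg (g := fun n => \1_(B n))) => //.
  by move=> n; exact: (tB n).2.
apply: aeW => x _; have [[n _ An]|nA] := pselect ((\bigcup_n A n) x).
  apply: (@cvg_trans _ (@cst nat R 1 x @[x --> \oo])); last first.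
    by rewrite indicE mem_set//; [exact: cvg_cst|exists n].
  apply: near_eq_cvg; near=> m; rewrite indicE mem_set//.
  rewrite /B -bigcup_mkord; exists n => //=.
  by near: m; exact: nbhs_infty_gt.
rewrite indicE memNset// (_ : (fun n => _) = cst 0); first exact: cvg_cst.
apply/funext => n; rewrite indicE memNset//.
by rewrite /B -bigcup_mkord => -[m _ Am]; apply: nA; exists m.
Unshelve. all: by end_near. Qed.

Lemma bernoulli_ineq (a : R) n : -1 <= a -> 1 + n%:R * a <= (1 + a) ^+ n.
Proof.
move=> a1; elim: n => [|n IH]; first by rewrite mul0r addr0 expr0.
rewrite exprS; apply: (@le_trans _ _ ((1 + a) * (1 + n%:R * a))).
  by rewrite -natr1; have := sqr_ge0 a; have : (0:R) <= n%:R by []; nra.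
by rewrite ler_wpM2l//; lra.
Qed.

(* The Brosowski-Deutsch polynomials [(1 - u^n)^(2^n)] tend to the indicator
   of [u < 1/2] off [u = 1/2]. *)
Lemma bump_cvg1 (u : R) : 0 <= u < 1 / 2 ->
  (1 - u ^+ n) ^+ (2 ^ n) @[n --> \oo] --> (1 : R).
Proof.
move=> /andP[u0 u2].
(* Bernoulli's inequality at - u^n: (1 - u^n)^(2^n) >= 1 - 2^n u^n = 1 - (2u)^n. *)
apply: (@squeeze_cvgr _ _ _ _ (fun n => 1 - (2 * u) ^+ n) (cst 1)).
- near=> n; have un0 : 0 <= u ^+ n by rewrite exprn_ge0.
  have un1 : u ^+ n <= 1 by rewrite exprn_ile1//; lra.
  apply/andP; split; last by rewrite /= exprn_ile1//; lra.
  have := @bernoulli_ineq (- u ^+ n) (2 ^ n) _; rewrite lerN2 => /(_ un1).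
  by rewrite mulrN natrX -exprMn.
- rewrite -[X in _ --> X]subr0; apply: cvgB; first exact: cvg_cst.
  by apply: cvg_expr; rewrite ger0_norm; lra.
- exact: cvg_cst.
Unshelve. all: by end_near. Qed.

(** Since (1 - u^n)(1 + u^n) <= 1 and, by Bernoulli, (1 + u^n)^(2^n) >= 1 + (2u)^n, the power is at
    most (2u)^(-n). *)
Lemma bump_cvg0 (u : R) : 1 / 2 < u <= 1 ->
  (1 - u ^+ n) ^+ (2 ^ n) @[n --> \oo] --> (0 : R).
Proof.
move=> /andP[u2 u1].
apply: (@squeeze_cvgr _ _ _ _ (cst 0) (fun n => ((2 * u)^-1) ^+ n)).
- near=> n; have un0 : 0 <= u ^+ n by rewrite exprn_ge0//; lra.
  have un1 : u ^+ n <= 1 by rewrite exprn_ile1//; lra.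
  have c0 : 0 <= (1 - u ^+ n) ^+ (2 ^ n) by rewrite exprn_ge0//; lra.
  rewrite /= c0 /= exprVn -[leRHS]mul1r ler_pdivlMr ?exprn_gt0//; last lra.
  have := @bernoulli_ineq (u ^+ n) (2 ^ n) _; rewrite natrX -exprMn.
  have -> : -1 <= u ^+ n by lra.
  move=> /(_ isT) bern.
  apply: (@le_trans _ _ ((1 - u ^+ n) ^+ (2 ^ n) * (1 + u ^+ n) ^+ (2 ^ n))).
    by rewrite ler_wpM2l//; lra.
  rewrite -exprMn exprn_ile1//; nra.
- exact: cvg_cst.
- apply: cvg_expr; rewrite ger0_norm ?invr_ge0; last lra.
  by rewrite invf_lt1; lra.
Unshelve. all: by end_near. Qed.

Lemma trig_set_sublevel (u : R -> R) : trig (cst_RC u) ->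
  (forall x, 0 <= u x <= 1) -> {ae leb, forall x, cell x -> u x <> 1 / 2} ->
  trig_set [set x | u x < 1 / 2].
Proof.
move=> tu u01 u12; have [mu _] := trig_cmeasurable tu.
have mS : measurable ([set x | u x < 1 / 2] : set mR).
  have mh : measurable_fun setT ((fun=> 1 / 2) : mR -> R) by exact: measurable_cst.
  have := measurable_fun_ltr mu mh; move=> /(_ measurableT [set true]).
  by rewrite setTI; apply.
split=> //; have ind01 (D : set R) x : 0 <= (\1_D x : R) <= 1.
  by rewrite indicE; case: (x \in D); rewrite /= ?lexx ?ler01.
apply: (trig_limit_bounded_cvg (g := fun n x => (1 - u x ^+ n) ^+ (2 ^ n))) => //.
- move=> n x; have /andP[u0 u1] := u01 x.
  have un0 : 0 <= u x ^+ n by rewrite exprn_ge0.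
  have un1 : u x ^+ n <= 1 by rewrite exprn_ile1.
  by rewrite exprn_ge0 ?exprn_ile1//; lra.
- move=> n; apply: trig_limit_trig.
  have := trigX (2 ^ n) (trigD (trig_cst 1) (trigM (trig_cst (-1)) (trigX n tu))).
  congr trig; apply/funext => x.
  by rewrite !(rmorphXn, rmorphB) rmorph1 mulN1r.
- apply: aeS u12 => x u12 cx; have {}u12 := u12 cx; have /andP[u0 u1] := u01 x.
  have [lt|le] := ltP (u x) (1 / 2).
    by rewrite indicE mem_set//; apply: bump_cvg1; rewrite u0.
  rewrite indicE memNset//=; last by apply/negP; rewrite -leNgt.
  by apply: bump_cvg0; rewrite u1 andbT lt_neqAle le andbT eq_sym; apply/eqP.
Qed.

(** The angle that runs once around the circle while x runs through the cell. *)
Let theta (x : R) : R := 2 * pi * (p%:R * x).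

Lemma theta_half x : theta x = pi * (x / (h / 2)).
Proof. by rewrite /theta; field; rewrite pnatr_eq0 -lt0n. Qed.

Lemma theta_reflect x : theta (h - x) = pi *+ 2 - theta x.
Proof. by rewrite /theta -mulr_natr; field; rewrite pnatr_eq0 -lt0n. Qed.

Lemma theta_itv x : 0 <= x <= h / 2 -> 0 <= theta x <= pi.
Proof.
have h2 : 0 < h / 2 by rewrite divr_gt0.
move=> /andP[x0 xh]; have pi0 := pi_gt0 R; rewrite theta_half; apply/andP; split.
  by rewrite mulr_ge0 ?(ltW pi0)// divr_ge0// ltW.
by rewrite -[leRHS]mulr1 ler_wpM2l ?(ltW pi0)// ler_pdivrMr// mul1r.
Qed.

Lemma sin_theta_gt0 x : 0 < x < h / 2 -> 0 < sin (theta x).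
Proof.
have h2 : 0 < h / 2 by rewrite divr_gt0.
move=> /andP[x0 xh]; have pi0 := pi_gt0 R; apply: sin_gt0_pi; rewrite theta_half.
rewrite mulr_gt0 ?divr_gt0//=.
by rewrite -[ltRHS]mulr1 ltr_pM2l// ltr_pdivrMr// mul1r.
Qed.

Lemma sin_theta_lt0 x : h / 2 < x < h -> sin (theta x) < 0.
Proof.
move=> /andP[hx xh]; rewrite -oppr_gt0 -sinN.
have -> : sin (- theta x) = sin (theta (h - x)).
  by rewrite theta_reflect addrC sinD2pi.
by apply: sin_theta_gt0; apply/andP; lra.
Qed.

Lemma cos_theta_reflect x : cos (theta (h - x)) = cos (theta x).
Proof. by rewrite theta_reflect addrC cosD2pi cosN. Qed.

Lemma ltr_cos_theta x y : 0 <= x <= h / 2 -> 0 <= y <= h / 2 ->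
  (cos (theta y) < cos (theta x)) = (x < y).
Proof.
have h2 : 0 < h / 2 by rewrite divr_gt0.
move=> /theta_itv xI /theta_itv yI; rewrite ltr_cos ?in_itv//=.
by rewrite !theta_half ltr_pM2l ?pi_gt0// ltr_pM2r// invr_gt0.
Qed.

Lemma trig_cos : trig (cst_RC (fun x => cos (theta x))).
Proof.
have := trigD (trigM (trig_cst (2^-1)%:C%C) (trig_e 1))
   (trigM (trig_cst (2^-1)%:C%C) (trig_e (-1))).
congr trig; apply/funext => x; rewrite /theta mulrN1z mul1r mulN1r -e_conj.
by apply: eq_ReIm; rewrite ?ReD ?ImD ?ReM ?ImM ?Re_conj ?Im_conj /=; field.
Qed.

Lemma trig_sin : trig (cst_RC (fun x => sin (theta x))).
Proof.
(* sin = (e - conj e) / (2 i), where 1 / (2 i) = - i / 2. *)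
have := trigD (trigM (trig_cst (0 -i* (2^-1))%C) (trig_e 1))
   (trigM (trig_cst (0 +i* (2^-1))%C) (trig_e (-1))).
congr trig; apply/funext => x; rewrite /theta mulrN1z mul1r mulN1r -e_conj.
by apply: eq_ReIm; rewrite ?ReD ?ImD ?ReM ?ImM ?Re_conj ?Im_conj /=; field.
Qed.

Lemma ae_neq (a : R) : {ae leb, forall x, x <> a}.
Proof.
exists [set a]; split => //; first exact: lebesgue_measure_set1.
by move=> x /= /contrapT.
Qed.

Lemma trig_affine (a b : R) u : trig (cst_RC u) ->
  trig (cst_RC (fun x => a + b * u x)).
Proof.
move=> tu; have := trigD (trig_cst a%:C%C) (trigM (trig_cst b%:C%C) tu).
by congr trig; apply/funext => x; rewrite rmorphD rmorphM.
Qed.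

Lemma trig_set_cos (b : R) : 0 <= b <= h / 2 ->
  trig_set [set x | cos (theta b) < cos (theta x)].
Proof.
move=> bh.
(* An affine change that moves the threshold to 1/2 and, both cosines being in [-1, 1], keeps the
   values in [0, 1]. *)
have -> : [set x | cos (theta b) < cos (theta x)] =
    [set x | (1 / 2 + cos (theta b) / 4) + (- (1 / 4)) * cos (theta x) < 1 / 2].
  by apply/seteqP; split=> x /=; lra.
apply: trig_set_sublevel.
- by apply: trig_affine; exact: trig_cos.
- move=> x; have := cos_geN1 (theta x); have := cos_le1 (theta x).
  by have := cos_geN1 (theta b); have := cos_le1 (theta b) => *; apply/andP; lra.
(* On the cell the two cosines agree only at b and at its mirror image h - b. *)
- move: (ae_neq b) (ae_neq (h - b)); apply: aeS2 => x xb xhb.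
  rewrite cellE => /andP[x0 xh] cE.
  have {cE} : cos (theta x) = cos (theta b) by lra.
  have [xh2|hx2] := leP x (h / 2).
    have xI : 0 <= x <= h / 2 by rewrite x0.
    have [xltb|bltx|//] := ltgtP x b.
      by move: xltb; rewrite -ltr_cos_theta// => /[swap] ->; rewrite ltxx.
    by move: bltx; rewrite -ltr_cos_theta// => /[swap] ->; rewrite ltxx.
  have xI : 0 <= h - x <= h / 2 by apply/andP; lra.
  rewrite -cos_theta_reflect.
  have [xltb|bltx|] := ltgtP (h - x) b; last lra.
    by move: xltb; rewrite -ltr_cos_theta// => /[swap] ->; rewrite ltxx.
  by move: bltx; rewrite -ltr_cos_theta// => /[swap] ->; rewrite ltxx.
Qed.

Lemma trig_set_sin (s : R) : s = 1 \/ s = -1 ->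
  trig_set [set x | 0 < s * sin (theta x)].
Proof.
move=> s1.
have -> : [set x | 0 < s * sin (theta x)] =
    [set x | 1 / 2 + (- (s / 4)) * sin (theta x) < 1 / 2].
  by apply/seteqP; split=> x /=; lra.
apply: trig_set_sublevel.
- by apply: trig_affine; exact: trig_sin.
- move=> x; have := sin_geN1 (theta x); have := sin_le1 (theta x).
  by case: s1 => -> *; apply/andP; lra.
- move: (ae_neq 0) (ae_neq (h / 2)); apply: aeS2 => x xb xhb.
  rewrite cellE => /andP[x0 xh] sE.
  have {}sE : sin (theta x) = 0 by case: s1 sE => ->; lra.
  have [xh2|hx2|//] := ltgtP x (h / 2).
    have := @sin_theta_gt0 x; rewrite sE ltxx xh2 andbT lt_neqAle x0 andbT.
    by rewrite eq_sym; move/eqP : xb => -> /(_ isT).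
  by have := @sin_theta_lt0 x; rewrite sE ltxx hx2 xh => /(_ isT).
Qed.

Lemma trig_set_ae (A B : set R) : measurable (B : set mR) ->
  {ae leb, forall x, cell x -> (A x <-> B x)} -> trig_set A -> trig_set B.
Proof.
move=> mB AB [mA lA]; split=> //; apply: trig_limit_ae lA.
  by apply: cmeasurable_real; exact: measurable_indic.
apply: aeS AB => x AB cx; rewrite !indicE.
suff -> : (x \in A) = (x \in B) by [].
by apply/idP/idP; rewrite !inE; apply AB.
Qed.

(** On the cell, cos theta decreases up to h / 2 and the sign of sin theta separates the halves. For
    b in the first half the ray is, up to null sets, where sin theta > 0 and cos theta > cos (theta
    b); for b in the second half it is the complement of the mirror image, with sin theta < 0 and h
    - b. For b outside the cell its trace is empty or everything. *)
Lemma trig_set_ray (b : R) : trig_set `]-oo, b].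
Proof.
have mb : measurable (`]-oo, b]%classic : set mR) by exact: measurable_itv.
have h2 : 0 < h / 2 by rewrite divr_gt0.
have ray x : `]-oo, b]%classic x = (x <= b) :> Prop by rewrite /= in_itv.
have s1 : (1 : R) = 1 \/ (1 : R) = -1 by left.
have sN1 : (-1 : R) = 1 \/ (-1 : R) = -1 by right.
have [b0|b0] := ltP b 0.
  apply: trig_set_ae trig_set0 => //; apply: aeW => x; rewrite cellE ray.
  by move=> /andP[x0 _]; split=> //; lra.
have [hb|bh] := leP h b.
  apply: trig_set_ae (trig_setC trig_set0) => //; apply: aeW => x.
  rewrite cellE ray setC0 => /andP[x0 xh]; split=> // _.
  by apply: ltW; exact: lt_le_trans hb.
have [bh2|hb2] := leP b (h / 2).
  have bI : 0 <= b <= h / 2 by rewrite b0.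
  apply: trig_set_ae (trig_setI (trig_set_sin s1) (trig_set_cos bI)) => //.
  move: (ae_neq 0) (ae_neq (h / 2)) (ae_neq b); apply: aeS3 => x x0 xh2 xb.
  rewrite cellE ray /= mul1r => /andP[x0' xh].
  have [xlt|xgt|//] := ltgtP x (h / 2).
    have xI : 0 <= x <= h / 2 by rewrite x0' ltW.
    rewrite ltr_cos_theta//; split=> [[_ /ltW//]|xleb]; split.
      by apply: sin_theta_gt0; rewrite xlt andbT lt_neqAle x0' andbT eq_sym; apply/eqP.
    by rewrite lt_neqAle xleb andbT; apply/eqP.
  have := @sin_theta_lt0 x; rewrite xgt xh => /(_ isT) sx.
  by split=> [[]|xleb]; lra.
have bI : 0 <= h - b <= h / 2 by apply/andP; lra.
apply: trig_set_ae (trig_setC (trig_setI (trig_set_sin sN1) (trig_set_cos bI))) => //.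
move: (ae_neq 0) (ae_neq (h / 2)) (ae_neq b); apply: aeS3 => x x0 xh2 xb.
rewrite cellE ray /= mulN1r oppr_gt0 => /andP[x0' xh].
have [xlt|xgt|//] := ltgtP x (h / 2).
  have : 0 < sin (theta x).
    by apply: sin_theta_gt0; rewrite xlt andbT lt_neqAle x0' andbT eq_sym; apply/eqP.
  by move=> sx; split=> [_|_ []]; lra.
have := @sin_theta_lt0 x; rewrite xgt xh => /(_ isT) sx.
have xI : 0 <= h - x <= h / 2 by apply/andP; lra.
rewrite -(cos_theta_reflect x) ltr_cos_theta//; split=> [nb|xleb [_]]; last lra.
by rewrite leNgt; apply/negP => bx; apply: nb; split=> //; lra.
Qed.

(** Half-open intervals are differences of rays and generate the measurable sets. *)
Lemma trig_set_measurable (A : set R) : measurable (A : set mR) -> trig_set A.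
Proof.
apply: smallest_sub; last first.
  move=> _ [[a b] _ <-] /=.
  have -> : `]a, b]%classic = `]-oo, b]%classic `&` ~` `]-oo, a]%classic.
    apply/seteqP; split=> x /=; rewrite !in_itv /=.
      by move=> /andP[ax xb]; split=> //; apply/negP; rewrite -ltNge.
    by move=> [xb /negP]; rewrite -ltNge => ->.
  by apply: trig_setI (trig_set_ray b) (trig_setC (trig_set_ray a)).
split; [exact: trig_set0| |exact: trig_set_bigcup].
by move=> B; rewrite setTD; exact: trig_setC.
Qed.

Import HBNNSimple.

Lemma trig_limit_simple (f : {nnsfun mR >-> R}) : trig_limit (cst_RC f).
Proof.
have -> : cst_RC f = fun x => \sum_(y <- fset_set (range f))
    (y%:C%C : C) * (\1_(f @^-1` [set y]) x)%:C%C.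
  apply/funext => x; rewrite fimfunE fsbig_finite//= rmorph_sum.
  by apply: eq_bigr => y _; rewrite rmorphM.
elim: (fset_set _ : seq R) => [|y s IH].
  by under eq_fun do rewrite big_nil; exact: trig_limit_trig (trig_cst 0).
under eq_fun do rewrite big_cons; apply: trig_limitD => //.
apply: trig_limitZ; apply: (trig_set_measurable _).2.
by rewrite -[X in measurable X]setTI; exact: measurable_funP.
Qed.

(** The approximating simple functions lie between 0 and f, so (g n - f)^2 is dominated by f^2. *)
Lemma trig_limit_ge0 (f : R -> R) : (forall x, 0 <= f x) -> hmem H (cst_RC f) ->
  trig_limit (cst_RC f).
Proof.
move=> f0 /[dup] Hf /L2_memP[[mf _] if2].
have mfE : measurable_fun setT ((EFin \o f) : mR -> \bar R) by exact/measurable_EFinP.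
pose g := nnsfun_approx measurableT mfE.
have gcv x : g n x @[n --> \oo] --> f x.
  have /fine_cvgP[_] := @cvg_nnsfun_approx _ mR R setT measurableT _ mfE
    (fun y _ => f0 y) x Logic.I.
  exact.
have gf n x : g n x <= f x.
  rewrite -(cvg_lim _ (gcv x))//.
  apply: (nondecreasing_cvgn_le (u_ := fun n => g n x)); last first.
    by apply/cvg_ex; exists (f x); exact: gcv.
  by move=> m k mk; exact/lefP/nd_nnsfun_approx.
apply: (@trig_limit_dct f g (fun x => normc ((f x)%:C%C : C) ^+ 2)) => //.
- by move=> n; exact: trig_limit_simple.
- move=> n x _; rewrite normc_real; have := gf n x; have := f0 x.
  have : 0 <= g n x by []; nra.
- by apply: aeW => x _; exact: gcv.
Qed.

Lemma trig_limit_real (f : R -> R) : hmem H (cst_RC f) -> trig_limit (cst_RC f).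
Proof.
move=> Hf; have [[mf _] _] := Hf.
have le_f (g : R -> R) : measurable_fun setT (g : mR -> R) ->
    (forall x, `|g x| <= `|f x|) -> hmem H (cst_RC g).
  move=> mg gf; apply: (@L2_le _ mR R leb cell mcell _ (cst_RC f) (cst_RC f)) => //.
  move=> x _; rewrite !normc_real -(real_normK (num_real (g x))) -(real_normK (num_real (f x))).
  by have := gf x; have := normr_ge0 (g x); nra.
have -> : cst_RC f = fun x => (Num.max (f x) 0)%:C%C +
    (-1) * (Num.max (- f x) 0)%:C%C.
  apply/funext => x; rewrite mulN1r -rmorphB.
  by congr (_%:C%C); rewrite /Num.max; case: ifP; case: ifP; lra.
apply: trig_limitD; last apply: trig_limitZ.
- apply: trig_limit_ge0 => [x|]; first by rewrite le_max lexx orbT.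
  apply: le_f => [|x]; first by apply: measurable_maxr => //; exact: measurable_cst.
  by rewrite /Num.max; case: ifP; rewrite ?normr0.
- apply: trig_limit_ge0 => [x|]; first by rewrite le_max lexx orbT.
  apply: le_f => [|x].
    apply: measurable_maxr; last exact: measurable_cst.
    exact: measurable_funN.
  by rewrite /Num.max; case: ifP; rewrite ?normr0 ?normrN.
Qed.

Lemma trig_limit_L2 (f : R -> C) : hmem H f -> trig_limit f.
Proof.
move=> Hf; have [[mf mf'] _] := Hf.
have le_f (g : R -> R) : measurable_fun setT (g : mR -> R) ->
    (forall x, g x ^+ 2 <= normc (f x) ^+ 2) -> hmem H (cst_RC g).
  move=> mg gf; apply: (@L2_le _ mR R leb cell mcell _ f f) => //.
  by move=> x _; rewrite normc_real; apply: le_trans (gf x) _; rewrite lerDl sqr_ge0.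
have -> : f = fun x => (Re (f x))%:C%C + (0 +i* 1)%C * (Im (f x))%:C%C.
  by apply/funext => x; apply: eq_ReIm; rewrite ?ReD ?ImD ?ReM ?ImM /=; ring.
apply: trig_limitD; [|apply: trig_limitZ]; apply: trig_limit_real; apply: le_f => //.
  by move=> x; rewrite normc_sqr lerDl sqr_ge0.
by move=> x; rewrite normc_sqr lerDr sqr_ge0.
Qed.

Lemma fourier_total : total_family (H := H) [set: int]
  (fun n => e_ (n%:~R * p%:R)).
Proof.
have me (n : int) : [set: int] n -> hmem H (e_ (n%:~R * p%:R)).
  by move=> _; apply: L2_e => //; exact: leb_cell_fin.
apply: (nsq_total pH me) => f /trig_limit_L2[mf fT] eps e0.
have [T [[t TE] fT']] := fT _ e0.
have [s [c [_ sE]]] := @comb_reindex R H int (fun n => e_ (n%:~R * p%:R))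
  (C * int)%type t (fun u => u.2) (fun u => u.1).
exists s, c; split=> //; rewrite sE.
suff -> : \sum_(u <- t) u.1 *: (e_ (u.2%:~R * p%:R) : hvec H) = T by [].
rewrite TE; apply/funext => x.
by rewrite (big_morph (fun g : hvec H => g x) (id1 := 0) (op1 := +%R)).
Qed.

End Fourier.

(** * Spectra and unitarity of the fiber matrices *)

Section FiberExponentials.
Variable R : realType.
Local Notation leb := (@lebesgue_measure R).
Local Notation mR := (measurableTypeR R).
Local Notation C := R[i].
Local Notation normc := ComplexField.Normc.normc.
Variables (Omega : set R) (p : nat) (hp : (0 < p)%N).
Hypothesis Obnd : bounded_set (Omega : set R^o).
Hypothesis Omeas : measurable (Omega : set mR).
Hypothesis O1 : leb Omega = 1%E.
Hypothesis Otile : p_tiles Omega p.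
Local Notation h := ((p%:R : R)^-1).
Local Notation cell := (cell p : set R).
Local Notation fiber := (fiber Omega p).
Local Notation k_ := (k_ Omega p).
Local Notation good := (good Omega p).
Local Notation W := (W Omega p).
Local Notation H := (L2Omega Omega).
Local Notation K := (L2cell R p).
Local Notation H1 := (L2 leb cell).
Variable lam : 'I_p -> R.
Local Notation v_ := (v_ Omega lam).
Local Notation M_ := (M_ Omega lam).
Local Notation Lam := (spectrum_form lam).
Let h0 : 0 < h := h_gt0 R hp.
Let mcell : measurable (cell : set mR) := measurable_itv _.
Let pH : prehilbert H := prehilbert_Omega Omeas.
Let pK : prehilbert K := prehilbert_cell R p.
Let pH1 : prehilbert H1 := L2_prehilbert leb mcell.
Local Notation sqp := ((Num.sqrt (p%:R : R))%:C%C : C).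

Lemma sqrtp_gt0 : 0 < Num.sqrt (p%:R : R).
Proof. by rewrite sqrtr_gt0 ltr0n. Qed.

Lemma sqp_neq0 : sqp != 0.
Proof. by rewrite (inj_eq (@complexI R)) gt_eqF// sqrtp_gt0. Qed.

Lemma sqp_conj : sqp * sqp^* = p%:R.
Proof. by rewrite mulc_conj normc_real sqr_sqrtr// rmorph_nat. Qed.

Lemma vE i x k : v_ i x k ord0 = sqp^-1 * e_ (lam i) ((k_ k x)%:~R / p%:R).
Proof. by rewrite !mxE; congr (_ * _); rewrite fmorphV. Qed.

Lemma W_exp (i : 'I_p) (n : int) (x : R) :
  W (e_ (lam i + n%:~R * p%:R)) x = e_ (lam i + n%:~R * p%:R) x *:
    \col_(j < p) e_ (lam i) ((k_ j x)%:~R / p%:R).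
Proof.
apply/matrixP => j m; rewrite !mxE e_Dr; congr (_ * _).
by rewrite e_Dl e_natM// mulr1.
Qed.

Lemma W_exp_v (i : 'I_p) (n : int) (x : R) :
  W (e_ (lam i + n%:~R * p%:R)) x =
    (sqp * e_ (lam i + n%:~R * p%:R) x) *: v_ i x.
Proof.
rewrite W_exp; apply/matrixP => j m; rewrite (ord1 m) [RHS]mxE vE [LHS]mxE mxE.
by rewrite [RHS]mulrACA mulfV ?sqp_neq0// mul1r.
Qed.

Lemma W_exp_entry i (n : int) x k : W (e_ (lam i + n%:~R * p%:R)) x k ord0 =
  sqp * e_ (lam i + n%:~R * p%:R) x * v_ i x k ord0.
Proof. by rewrite W_exp_v mxE. Qed.

Lemma cmeasurable_v i k : cmeasurable (fun x : mR => v_ i x k ord0).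
Proof.
under eq_fun do rewrite vE; apply: cmeasurableM; first exact: cmeasurable_cst.
have mk : measurable_fun setT ((fun x : mR => (k_ k x)%:~R / p%:R) : mR -> mR).
  by apply: (@measurable_funM _ mR R) => //; exact: measurable_k.
have [m1 m2] := @cmeasurable_e R (lam i).
by split; [exact: (measurableT_comp m1 mk)|exact: (measurableT_comp m2 mk)].
Qed.

Lemma normc_v_sqr i x k : normc (v_ i x k ord0) ^+ 2 = h.
Proof.
rewrite vE ComplexField.Normc.normcM normc_e mulr1 -fmorphV.
by rewrite normc_real exprVn sqr_sqrtr.
Qed.

Lemma normc_v_le1 i x k : normc (v_ i x k ord0) <= 1.
Proof.
rewrite -ler_sqr ?nnegrE ?normc_ge0// normc_v_sqr expr1n.
by rewrite invf_le1 ?ltr0n// ler1n.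
Qed.

Definition vgram i j x : C := \sum_k v_ i x k ord0 * (v_ j x k ord0)^*.

Lemma vgram_diag i x : vgram i i x = 1.
Proof.
rewrite /vgram; under eq_bigr do rewrite mulc_conj normc_v_sqr.
rewrite sumr_const card_ord -rmorphMn -[h *+ p]mulr_natl mulfV//.
by rewrite pnatr_eq0 -lt0n.
Qed.

(** [unitarymx] asks for M M^* = 1; for a square matrix this amounts to M^* M = 1, whose (i, j)
    entry is [vgram j i]. *)
Lemma M_unitaryE x : (M_ x \is unitarymx) <-> forall i j, vgram i j x = (i == j)%:R.
Proof.
have E i j : ((M_ x ^t*)%sesqui *m M_ x) i j = vgram j i x.
  rewrite mxE; apply: eq_bigr => k _.
  by rewrite !mxE mulrC.
split=> [/unitarymxP/mulmx1C MM i j|gr].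
  by rewrite -E MM mxE eq_sym.
by apply/unitarymxP/mulmx1C/matrixP => i j; rewrite E gr mxE eq_sym.
Qed.

Lemma v_shift i x (n : int) k : good x ->
  v_ i (x + n%:~R / p%:R) k ord0 = e_ (lam i) (- (n%:~R / p%:R)) * v_ i x k ord0.
Proof.
move=> gx; rewrite !vE k_shift//.
by rewrite intrB mulrBl e_Dr [RHS]mulrCA; congr (_ * _); rewrite mulrC.
Qed.

(** The phase at the contracted index i enters once as c i and once conjugated. *)
Lemma mulmx_adj_phase m n q (A A' : 'M[C]_(m, n)) (B B' : 'M[C]_(q, n))
    (c : 'I_n -> C) : (forall i, c i * (c i)^* = 1) ->
  (forall k i, A' k i = c i * A k i) -> (forall k i, B' k i = c i * B k i) ->
  A' *m (B' ^t*)%sesqui = A *m (B ^t*)%sesqui.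
Proof.
move=> c1 AE BE; apply/matrixP => k l; rewrite !mxE; apply: eq_bigr => i _.
by rewrite !mxE AE BE rmorphM mulrACA c1 mul1r.
Qed.

Lemma ME x k i : M_ x k i = v_ i x k ord0.
Proof. by rewrite mxE. Qed.

Lemma M_mul_shift x y (n : int) : good x -> good y ->
  M_ (x + n%:~R / p%:R) *m (M_ (y + n%:~R / p%:R) ^t*)%sesqui =
  M_ x *m (M_ y ^t*)%sesqui.
Proof.
move=> gx gy.
apply: (@mulmx_adj_phase _ _ _ _ _ _ _ (fun i => e_ (lam i) (- (n%:~R / p%:R)))).
- by move=> i; rewrite mulc_conj normc_e expr1n.
- by move=> k i; rewrite (ME _ k i) (ME x k i) v_shift.
- by move=> k i; rewrite (ME _ k i) (ME y k i) v_shift.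
Qed.

Lemma M_unitary_shift x (n : int) : good x -> M_ x \is unitarymx ->
  M_ (x + n%:~R / p%:R) \is unitarymx.
Proof.
move=> gx /M_unitaryE gr; apply/M_unitaryE => i j.
have [->|ij] := eqVneq i j; first by rewrite vgram_diag.
transitivity ((e_ (lam i) (- (n%:~R / p%:R)) * (e_ (lam j) (- (n%:~R / p%:R)))^*) *
  vgram i j x); last by rewrite gr (negbTE ij) mulr0.
rewrite /vgram mulr_sumr; apply: eq_bigr => k _.
by rewrite (v_shift i n k gx) (v_shift j n k gx) rmorphM mulrACA.
Qed.

(** A copy of L^2 of the cell along the i-th column. The twist by e_(lam i) is chosen so that e_(n
    p) goes to W e_(lam i + n p) / sqrt p, as [W_exp_embed] records. *)
Definition column_embed (i : 'I_p) (d : R -> C) (x : R) : 'cV[C]_p :=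
  (d x * e_ (lam i) x) *: v_ i x.

Lemma column_embed_entry i d x k :
  column_embed i d x k ord0 = (e_ (lam i) x * v_ i x k ord0) * d x.
Proof. by rewrite mxE -mulrA mulrC. Qed.

(** Each of the p entries has modulus |d| / sqrt p. *)
Lemma column_embed_isometry i : linear_isometry (column_embed i : hvec H1 -> hvec K).
Proof.
have cE := column_embed_entry i.
have nE d x k : normc (column_embed i d x k ord0) ^+ 2 = h * normc (d x) ^+ 2.
  rewrite cE !ComplexField.Normc.normcM !exprMn normc_v_sqr normc_e expr1n mul1r.
  by [].
have mem d : hmem H1 d -> hmem K (column_embed i d).
  move=> md k; under eq_fun do rewrite cE.
  apply: (@L2_mul_bounded _ mR R leb cell mcell 1) => //.
    by apply: cmeasurableM; [exact: cmeasurable_e|exact: cmeasurable_v].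
  move=> x _; rewrite ComplexField.Normc.normcM normc_e mul1r.
  exact: normc_v_le1.
split.
- split=> // f g _ _; apply: aeS => x fg cx.
  by rewrite /column_embed fg.
- move=> a f g _ _; suff -> : column_embed i (a *: f + g) =
    a *: (column_embed i f : hvec K) + column_embed i g by exact: (ph_refl pK).
  apply/funext => x; apply/matrixP => k m; rewrite (ord1 m) cE.
  have L (u y z : C) : u * (a * y + z) = a * (u * y) + u * z by ring.
  apply: (etrans (L _ (f x) (g x))).
  by rewrite -!cE [RHS]mxE [X in _ = X + _]mxE.
- move=> d md; rewrite !hnorm_nsq nsq_L2vec nsq_L2.
  under eq_bigr do under eq_Rintegral do rewrite nE.
  have /L2_memP[_ id] := md.
  rewrite RintegralZl// sumr_const card_ord; congr Num.sqrt.
  by rewrite -[LHS]mulr_natl mulrA mulfV ?mul1r// pnatr_eq0 -lt0n.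
Qed.

Lemma hip_column_embed i j d c : hmem H1 d -> hmem H1 c ->
  hip K (column_embed i d) (column_embed j c) =
  hip H1 (fun x => d x * (e_ (lam i - lam j) x * vgram i j x)) c.
Proof.
move=> md mc.
have md' : hmem K (column_embed i d) by exact: (iso_mem (column_embed_isometry i)).
have mc' : hmem K (column_embed j c) by exact: (iso_mem (column_embed_isometry j)).
rewrite /hip /= -(cintegral_sum mcell); last by move=> k; exact: L2_prod_int (md' k) (mc' k).
congr cintegral; apply/funext => x.
rewrite e_Dl -e_conj /vgram !mulr_sumr mulr_suml; apply: eq_bigr => k _.
rewrite !column_embed_entry !rmorphM.
have L (a b u a' b' w : C) : a * b * u * (a' * b' * w) =
    u * (a * a' * (b * b')) * w by ring.
exact: L.
Qed.

Lemma H_e l : hmem H (e_ l).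
Proof.
have fO : (leb Omega < +oo)%E by rewrite O1 ltry.
exact: L2_e.
Qed.

Lemma H1_e l : hmem H1 (e_ l).
Proof. by apply: L2_e => //; exact: leb_cell_fin. Qed.

Lemma W_exp_embed i (n : int) : W (e_ (lam i + n%:~R * p%:R)) =
  sqp *: (column_embed i (e_ (n%:~R * p%:R)) : hvec K).
Proof.
apply/funext => x; rewrite W_exp_v /column_embed e_Dl [in LHS]mulrC.
rewrite [e_ (lam i) x * _]mulrC mulrC.
by rewrite -scalerA.
Qed.

Definition cross i j (x : R) : C := e_ (lam i - lam j) x * vgram i j x.

Lemma normc_sum_le (I : Type) (s : seq I) (F : I -> C) :
  normc (\sum_(i <- s) F i) <= \sum_(i <- s) normc (F i).
Proof.
elim: s => [|i s IH]; first by rewrite !big_nil ComplexField.Normc.normc0.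
by rewrite !big_cons; apply: (le_trans (le_normcD _ _)); apply: lerD.
Qed.

Lemma normc_mul_le1 (a b : C) : normc a <= 1 -> normc b <= 1 -> normc (a * b) <= 1.
Proof.
move=> a1 b1; rewrite ComplexField.Normc.normcM -[leRHS]mulr1.
by apply: ler_pM => //; exact: normc_ge0.
Qed.

Lemma normc_conj (a : C) : normc a^* = normc a.
Proof. by case: a => a b /=; rewrite sqrrN. Qed.

Lemma cmeasurable_vv i j k l : cmeasurable (fun x : mR => v_ i x k ord0 * (v_ j x l ord0)^*).
Proof.
by apply: cmeasurableM; [|apply: cmeasurable_conj]; exact: cmeasurable_v.
Qed.

Lemma normc_vv i j k l x : normc (v_ i x k ord0 * (v_ j x l ord0)^*) <= 1.
Proof. by apply: normc_mul_le1; rewrite ?normc_conj; exact: normc_v_le1. Qed.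

Lemma cmeasurable_cross i j : cmeasurable (cross i j : mR -> C).
Proof.
apply: cmeasurableM; first exact: cmeasurable_e.
by apply: cmeasurable_sum => k; exact: cmeasurable_vv.
Qed.

Lemma H1_cross i j : hmem H1 (cross i j).
Proof.
apply: (@L2_bounded _ _ _ _ (\sum_(k < p) 1)) => //; first exact: leb_cell_fin.
  exact: cmeasurable_cross.
move=> x _; rewrite /cross ComplexField.Normc.normcM normc_e mul1r.
apply: (le_trans (normc_sum_le _ _)); apply: ler_sum => k _; exact: normc_vv.
Qed.

Lemma hip_exp i j (n m : int) :
  hip H (e_ (lam i + n%:~R * p%:R)) (e_ (lam j + m%:~R * p%:R)) =
  p%:R * hip H1 (cross i j) (e_ ((m - n)%:~R * p%:R)).
Proof.
have iW := W_isometry hp Obnd Omeas Otile.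
rewrite -(iso_hip pH pK iW (H_e _) (H_e _)) !W_exp_embed.
have mE l q : hmem K (column_embed l (e_ q)).
  by apply: (iso_mem (column_embed_isometry l)); exact: H1_e.
rewrite (hipZZ pK _ _ (mE i _) (mE j _)) sqp_conj hip_column_embed; last 2 first.
- exact: H1_e.
- exact: H1_e.
congr (_ * _); rewrite /hip /=; congr cintegral; apply/funext => x.
rewrite -/(cross i j x) intrB mulrBl e_Dl rmorphM -e_conj.
have L (a b q : C) : a * b * q = b * (q * a) by ring.
by rewrite L; congr (_ * (_ * _)); rewrite -[LHS]conjCK.
Qed.

(** For q = n p nonzero, translation by 1 / (2 q) changes the sign of e_q but not the integral of a
    periodic function over a period, so that integral is its own opposite. *)
Lemma hip_scale_e (n : int) : hip H1 (fun=> 1) (e_ (n%:~R * p%:R)) = (n == 0)%:R * h%:C%C.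
Proof.
have [->|n0] := eqVneq n 0.
  have -> : e_ ((0 : int)%:~R * p%:R) = (fun=> 1) :> (R -> C).
    by apply/funext => x; rewrite mul0r e_0l.
  rewrite mul1r /hip /=; under [X in cintegral _ _ X]eq_fun do rewrite mul1r.
  apply: eq_ReIm; rewrite /cintegral /=.
    rewrite Rintegral_cst// mul1r.
    exact: (congr1 fine (leb_cell R hp)).
  by rewrite Rintegral_cst// oppr0 mul0r.
set q := n%:~R * p%:R; rewrite mul0r /hip /=.
under [X in cintegral _ _ X]eq_fun do rewrite mul1r.
have ie : cintegrable leb cell (e_ q).
  have := L2_prod_int mcell (H1_e q) (H1_e 0); congr cintegrable; apply/funext => x.
  by apply: etrans (mulr1 _); congr (_ * _); rewrite e_0l; exact: conjc1.
rewrite cintegral_conj //.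
pose t : R := (2 * q)^-1.
have q0 : q != 0 by rewrite mulf_neq0// ?intr_eq0// pnatr_eq0 -lt0n.
have et : e_ q t = -1.
  rewrite /e_ /t; have -> : 2 * pi * (q * (2 * q)^-1) = pi by field.
  by rewrite cospi sinpi; apply: eq_ReIm; rewrite /= ?oppr0.
have per (u : R -> R) : measurable_fun setT (u : mR -> R) ->
    (forall x, `|u x| <= 1) -> (forall x, u (x + h) = u x) ->
    \int[leb]_(x in cell) u (x + t) = \int[leb]_(x in cell) u x.
  move=> mu u1 uh.
  have iu (v : R -> R) : measurable_fun setT (v : mR -> R) ->
      (forall x, `|v x| <= 1) -> leb.-integrable cell (EFin \o v).
    move=> mv v1; apply: measurable_bounded_integrable => //.
    - exact: leb_cell_fin.
    - exact: measurable_funTS.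
    - exists 1; split; rewrite ?num_real// => M M1 x _ /=.
      exact: le_trans (v1 x) (ltW M1).
  have mut := measurable_fun_translate t mu.
  have i1 : leb.-integrable cell (EFin \o (fun=> 1 : R)).
    by apply: iu => [|x]; [exact: measurable_cst|rewrite normr1].
  (* Adding 1 makes u nonnegative, as [ge0_integral_periodic] requires. *)
  suff : \int[leb]_(x in cell) (u (x + t) + 1) = \int[leb]_(x in cell) (u x + 1).
    by rewrite !RintegralD//; [lra|exact: iu|exact: iu].
  congr fine; apply: (@ge0_integral_periodic R h h0 (fun x => (u x + 1)%:E) t).
  - by apply/measurable_EFinP; apply: measurable_funD => //; exact: measurable_cst.
  - by move=> x; rewrite lee_fin; have := u1 x; rewrite ler_norml => /andP[]; lra.
  - by move=> x; rewrite uh.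
have eh x : e_ q (x + h) = e_ q x.
  by have := e_natM R n 1 hp; rewrite mul1r e_Dr => ->; rewrite mulr1.
have Ic : cintegral leb cell (e_ q) = - cintegral leb cell (e_ q).
  rewrite -mulN1r -{1}et -cintegralZ//.
  rewrite (_ : (fun x => e_ q t * e_ q x) = (fun x => e_ q (x + t))); last first.
    by apply/funext => x; rewrite e_Dr mulrC.
  have [m1 m2] := @cmeasurable_e R q.
  congr Complex; apply/esym.
    apply: (per (fun x => complex.Re (e_ q x))) => // x; last by rewrite eh.
    by rewrite ler_norml cos_geN1 cos_le1.
  apply: (per (fun x => complex.Im (e_ q x))) => // x; last by rewrite eh.
  by rewrite ler_norml sin_geN1 sin_le1.
suff -> : cintegral leb cell (e_ q) = 0 by rewrite conjC0.
move: Ic; set I := cintegral _ _ _ => Ic.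
have self_opp (y : R) : y = - y -> y = 0 by lra.
by apply: eq_ReIm; apply: self_opp; rewrite -?ReN -?ImN -Ic.
Qed.

Lemma fourier_unique (c : R -> C) : hmem H1 c ->
  (forall n : int, hip H1 c (e_ (n%:~R * p%:R)) = 0) ->
  {ae leb, forall x, cell x -> c x = 0}.
Proof.
move=> mc c0.
have me (n : int) : [set: int] n -> hmem H1 (e_ (n%:~R * p%:R)) by move=> _; exact: H1_e.
have := total_orth pH1 me (fourier_total hp) mc (fun n _ => c0 n).
by apply: aeS => x cx0 cx; exact: cx0.
Qed.

Lemma ae_cell_ex (P : R -> Prop) : {ae leb, forall x, cell x -> P x} ->
  exists x, cell x /\ P x.
Proof.
move=> aeP; apply: contrapT => nP.
have : leb.-negligible cell.
  move: aeP => [N [mN N0 subN]]; exists N; split=> // x cx; apply: subN => /= Px.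
  by apply: nP; exists x; split=> //; exact: Px.
move/(measure_negligible mcell) => c0; have {}c0 : leb cell = 0%E := c0.
by have := leb_cell R hp; rewrite c0 => /eqP; rewrite eqe lt_eqF.
Qed.

Section Orthogonal.
Hypothesis orth : forall l l', Lam l -> Lam l' -> l <> l' -> hip H (e_ l) (e_ l') = 0.

(** For congruent i and j the sets lam i + p Z and lam j + p Z coincide and v_i = v_j, so
    orthogonality over [Lam] gives no relation between the two columns. Until such pairs are
    excluded, one index per class is used. *)
Definition congruent i j := exists n : int, lam i = lam j + n%:~R * p%:R.

Lemma Lam_exp i (n : int) : Lam (lam i + n%:~R * p%:R).
Proof. by exists i, n. Qed.

Lemma congruent_v i j x k : congruent i j -> v_ i x k ord0 = v_ j x k ord0.
Proof.
by move=> [n lE]; rewrite !vE lE e_Dl e_natM// mulr1.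
Qed.

Lemma congruent_sym i j : congruent i j -> congruent j i.
Proof. by move=> [n lE]; exists (- n); rewrite lE rmorphN mulNr addrK. Qed.

(** All Fourier coefficients of [cross i j] vanish, because lam i and lam j + n p are distinct
    elements of [Lam] for every n. *)
Lemma vgram0_ae i j : ~ congruent i j -> {ae leb, forall x, cell x -> vgram i j x = 0}.
Proof.
move=> nij; have : {ae leb, forall x, cell x -> cross i j x = 0}.
  apply: fourier_unique => [|n]; first exact: H1_cross.
  have ne : lam i + (0 : int)%:~R * p%:R <> lam j + n%:~R * p%:R.
    by move=> le; apply: nij; exists n; rewrite -le mul0r addr0.
  have := orth (Lam_exp i 0) (Lam_exp j n) ne; rewrite hip_exp subr0 => /eqP.
  by rewrite mulf_eq0 pnatr_eq0 eqn0Ngt hp => /eqP.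
apply: aeS => x + cx => /(_ cx) /eqP; rewrite mulf_eq0 => /orP[/eqP e0|/eqP//].
by have := normc_e (lam i - lam j) x; rewrite e0 ComplexField.Normc.normc0 => /eqP;
  rewrite eq_sym oner_eq0.
Qed.

Let rep (i : 'I_p) : bool := `[< forall j : 'I_p, (j < i)%N -> ~ congruent i j >].

Let rep_ex i : exists2 j, rep j & congruent i j.
Proof.
have [n] := ubnP (i : nat); elim: n i => // n IH i; rewrite ltnS => iN.
have [ri|/asboolPn] := boolP (rep i).
  by exists i => //; exists 0; rewrite mul0r addr0.
move=> /existsNP[j /not_implyP[ji /contrapT[m mE]]].
have [k rk [m' mE']] := IH j (leq_trans ji iN).
by exists k => //; exists (m' + m); rewrite mE mE' intrD mulrDl addrA.
Qed.

Let vgram_rep_ae : {ae leb, forall x, forall i j, cell x -> rep i -> rep j ->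
  vgram i j x = (i == j)%:R}.
Proof.
apply: (@ae_all_ord _ mR R leb p (fun i x => forall j, cell x -> rep i -> rep j ->
  vgram i j x = (i == j)%:R)) => i.
apply: (@ae_all_ord _ mR R leb p (fun j x => cell x -> rep i -> rep j ->
  vgram i j x = (i == j)%:R)) => j.
have [->|ij] := eqVneq i j; first by apply: aeW => x _ _ _; exact: vgram_diag.
have [nij|] := pselect (~ congruent i j).
  by apply: aeS (vgram0_ae nij) => x g0 cx _ _; exact: g0.
move=> /contrapT cij; apply: aeW => x _ /asboolP ri /asboolP rj; exfalso.
move: ij; rewrite neq_ltn => /orP[lt|lt]; first exact: (rj i lt (congruent_sym cij)).
exact: (ri j lt cij).
Qed.

(* [proj a b x] is the entry of [1 - \sum_i v_i v_i^*], summed over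
   representatives of the classes of [lam] mod p. Its columns are orthogonal to
   every [W (e_ l)], hence vanish if the [e_ l] are total, and its trace, p minus
   the number of classes, then shows that the [lam i] are incongruent. *)
Let proj (a b : 'I_p) (x : R) : C :=
  (a == b)%:R - \sum_(i | rep i) v_ i x a ord0 * (v_ i x b ord0)^*.

Let proj_col (b : 'I_p) (x : R) : 'cV[C]_p := \col_a proj a b x.

Let K_proj_col b : hmem K (proj_col b).
Proof.
move=> a; rewrite (_ : (fun x => _) = proj a b); last first.
  by apply/funext => x; rewrite mxE.
apply: (@L2_bounded _ _ _ _ (1 + \sum_(i < p | rep i) 1)) => //.
- exact: leb_cell_fin.
- apply: cmeasurableD; first exact: cmeasurable_cst.
  under eq_fun do rewrite -sumrN -big_filter; apply: cmeasurable_sum => i.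
  by under eq_fun do rewrite -mulN1r; apply: cmeasurableM;
    [exact: cmeasurable_cst|exact: cmeasurable_vv].
- move=> x _; apply: (le_trans (le_normcD _ _)); apply: lerD.
    by case: (a == b); rewrite ?ComplexField.Normc.normc1 ?ComplexField.Normc.normc0.
  rewrite normcN -big_filter -[X in _ <= X]big_filter.
  apply: (le_trans (normc_sum_le _ _)); apply: ler_sum => i _; exact: normc_vv.
Qed.

(** v_i equals v_j for the representative j of its class, and the columns of the representatives are
    orthonormal almost everywhere, so the complementary projection annihilates them. *)
Let proj_orth b i (n : int) : hip K (proj_col b) (W (e_ (lam i + n%:~R * p%:R))) = 0.
Proof.
have mW : hmem K (W (e_ (lam i + n%:~R * p%:R))).
  by apply: (iso_mem (W_isometry hp Obnd Omeas Otile)); exact: H_e.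
rewrite /hip /= -(cintegral_sum mcell); last first.
  by move=> k; exact: L2_prod_int (K_proj_col b k) (mW k).
have mz : cmeasurable (fun _ : mR => 0 : C) by exact: cmeasurable_cst.
rewrite (@cintegral_ae _ mR R leb cell mcell _ (fun=> 0)) => //.
- exact: cintegral0.
- apply: cmeasurable_sum => k; apply: cmeasurableM; first exact: (K_proj_col b k).1.
  by apply: cmeasurable_conj; exact: (mW k).1.
- apply: aeS vgram_rep_ae => x gr cx.
  have [j rj cij] := rep_ex i.
  transitivity ((sqp * e_ (lam i + n%:~R * p%:R) x)^* *
      \sum_a proj a b x * (v_ j x a ord0)^*).
    rewrite mulr_sumr; apply: eq_bigr => a _.
    have -> : proj_col b x a ord0 = proj a b x by rewrite mxE.
    rewrite W_exp_entry (congruent_v x a cij) rmorphM.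
    by rewrite mulrCA.
  rewrite (_ : \sum_a _ = 0) ?mulr0//.
  rewrite /proj; under eq_bigr do rewrite mulrBl mulr_suml.
  rewrite sumrB (bigD1 b)//= eqxx mul1r big1 ?addr0; last first.
    by move=> a /negbTE ab; rewrite ab mul0r.
  rewrite exchange_big /= (bigD1 j)//= [X in _ - (_ + X)]big1; last first.
    move=> k /andP[rk kj]; transitivity ((v_ k x b ord0)^* * vgram k j x).
      by rewrite mulr_sumr; apply: eq_bigr => a _; rewrite mulrAC mulrC mulrA.
    by rewrite gr// (negbTE kj) mulr0.
  rewrite addr0; apply/eqP; rewrite subr_eq0; apply/eqP.
  transitivity ((v_ j x b ord0)^* * vgram j j x); first by rewrite vgram_diag mulr1.
  by rewrite mulr_sumr; apply: eq_bigr => a _; rewrite mulrAC [RHS]mulrC mulrA.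
Qed.

Lemma orthogonal_total_unitary : total_family (H := H) Lam (@e_ R) ->
  {ae leb, forall x, cell x -> M_ x \is unitarymx}.
Proof.
move=> tot.
have totW : total_family (H := K) Lam (fun l => W (e_ l)).
  apply: (total_isometry pH pK (W_isometry hp Obnd Omeas Otile)
    (W_Winv_inverse hp Obnd Omeas Otile)) tot.
  by move=> l _; exact: H_e.
have proj0 : {ae leb, forall x, forall b, cell x -> proj_col b x = 0}.
  apply: (@ae_all_ord _ mR R leb p (fun b x => cell x -> proj_col b x = 0)) => b.
  apply: (total_orth pK _ totW) => //.
    move=> l _; apply: (iso_mem (W_isometry hp Obnd Omeas Otile)); exact: H_e.
  by move=> _ [i [n ->]]; exact: proj_orth.
(* The representatives do not depend on x, so a single point of the cell decides their number. *)
have [x [cx px]] : exists x, cell x /\ forall b, proj_col b x = 0.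
  by apply: ae_cell_ex; apply: aeS proj0 => x px cx b; exact: px.
have all_rep i : rep i.
  have : \sum_b proj b b x = 0.
    by apply: big1 => b _; have := congr1 (fun A : 'cV[C]_p => A b ord0) (px b); rewrite !mxE.
  rewrite /proj sumrB; under eq_bigr do rewrite eqxx.
  rewrite exchange_big /=.
  rewrite [X in _ - X](eq_bigr (fun=> 1)); last first.
    by move=> j _; exact: vgram_diag.
  rewrite !sumr_const card_ord => /eqP; rewrite subr_eq0 eqr_nat => /eqP cardE.
  have : [pred i | rep i] =i predT.
    by apply/subset_cardP; rewrite ?subset_predT// cardT size_enum_ord -cardE.
  by move/(_ i).
apply: aeS vgram_rep_ae => y gr cy; apply/M_unitaryE => i j.
by apply: gr.
Qed.

End Orthogonal.

Section Unitary.
Hypothesis aeU : {ae leb, forall x, cell x -> M_ x \is unitarymx}.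

Lemma unitary_hip_exp i j (n m : int) :
  hip H (e_ (lam i + n%:~R * p%:R)) (e_ (lam j + m%:~R * p%:R)) =
  ((i == j) && (n == m))%:R.
Proof.
rewrite hip_exp; have [->|ij] := eqVneq i j.
  have -> : cross j j = fun=> 1.
    by apply/funext => x; rewrite /cross subrr e_0l vgram_diag mulr1.
  rewrite hip_scale_e subr_eq0 [m == n]eq_sym; case: (n == m); last by rewrite mul0r mulr0.
  by rewrite mul1r -[p%:R](rmorph_nat (real_complex R)) -rmorphM mulfV// pnatr_eq0 -lt0n.
have z : hmem H1 0 by exact: (ph0 pH1).
rewrite (ph_hip pH1 (H1_cross i j) z (H1_e _)).
  by rewrite (hip0l pH1 (H1_e _)) mulr0.
apply: aeS aeU => x /[apply] /M_unitaryE U.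
by rewrite /cross U (negbTE ij) mulr0.
Qed.

(** Coordinate of F along v_i with the twist of [column_embed] removed; M_x M_x^* = 1 then says that
    F is the sum of the embedded coordinates. *)
Let coef (F : R -> 'cV[C]_p) i (x : R) : C :=
  \sum_k (e_ (- lam i) x * (v_ i x k ord0)^*) * F x k ord0.

Let H1_coef F i : hmem K F -> hmem H1 (coef F i).
Proof.
move=> mF; rewrite /coef.
have -> : (fun x => \sum_k (e_ (- lam i) x * (v_ i x k ord0)^*) * F x k ord0) =
   \sum_k ((fun x => (e_ (- lam i) x * (v_ i x k ord0)^*) * F x k ord0) : hvec H1).
  apply/funext => x.
  by rewrite (big_morph (fun g : hvec H1 => g x) (id1 := 0) (op1 := +%R)).
apply: (mem_sum pH1) => k _.
apply: (@L2_mul_bounded _ mR R leb cell mcell 1) => //.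
  apply: cmeasurableM; first exact: cmeasurable_e.
  by apply: cmeasurable_conj; exact: cmeasurable_v.
move=> x _; apply: normc_mul_le1; first by rewrite normc_e.
by rewrite normc_conj; exact: normc_v_le1.
Qed.

Let expansion F : heqv K (\sum_i (column_embed i (coef F i) : hvec K)) F.
Proof.
apply: aeS aeU => x /[apply] /unitarymxP U; apply/matrixP => a b.
rewrite (ord1 b).
have -> : (\sum_i (column_embed i (coef F i) : hvec K)) x =
    \sum_i column_embed i (coef F i) x.
  by rewrite (big_morph (fun g : hvec K => g x) (id1 := 0) (op1 := +%R)).
rewrite summxE -[F x]mul1mx -U -mulmxA mxE; apply: eq_bigr => i _.
rewrite column_embed_entry ME [e_ _ _ * _]mulrC -mulrA; congr (_ * _).
rewrite /coef mulr_sumr [RHS]mxE; apply: eq_bigr => k _.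
have -> : (M_ x ^t*)%sesqui i k = (v_ i x k ord0)^* by rewrite mxE mxE ME.
have L (y z c d : C) : y * ((z * c) * d) = (y * z) * (c * d) by ring.
by rewrite L -e_conj mulc_conj normc_e expr1n mul1r.
Qed.

(** Each coordinate of F lies in the closed span of the e_(n p) on the cell, [column_embed] carries
    it into the closed span of the W e_l, and the coordinates add up to F. *)
Lemma unitary_total : total_family (H := H) Lam (@e_ R).
Proof.
have iW := W_isometry hp Obnd Omeas Otile.
have WV := W_Winv_inverse hp Obnd Omeas Otile.
have iV := linear_isometry_inv pH pK iW WV.
have mWe l : Lam l -> hmem K (W (e_ l)) by move=> _; apply: (iso_mem iW); exact: H_e.
have me (n : int) : [set: int] n -> hmem H1 (e_ (n%:~R * p%:R)) by move=> _; exact: H1_e.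
have totW : total_family (H := K) Lam (fun l => W (e_ l)).
  apply: (nsq_total pK mWe) => F mF.
  have mc i : hmem K (column_embed i (coef F i)).
    by apply: (iso_mem (column_embed_isometry i)); exact: H1_coef.
  apply: (span_limit_eqv pK mWe _ mF (expansion F)).
    by apply: (mem_sum pK) => i _; exact: mc.
  apply: (span_limit_sum pK mWe) => // i.
  apply: (@span_limit_isometry _ H1 K int R [set: int] Lam
    (fun n => e_ (n%:~R * p%:R)) (fun l => W (e_ l)) (column_embed i)
    (fun n => lam i + n%:~R * p%:R) sqp^-1 pH1 pK (column_embed_isometry i) me mWe).
  - by move=> n _; exact: Lam_exp.
  - move=> n _; rewrite W_exp_embed scalerA mulVf ?sqp_neq0// scale1r.
    exact: (ph_refl pK).
  - exact: H1_coef.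
  - by move=> eps e0; apply: (total_nsq pH1 me (fourier_total hp)) => //; exact: H1_coef.
(* Pulling back along [Winv] returns e_l only up to [heqv]. *)
apply: (total_family_eqv pH _ _ _ (total_isometry pK pH iV
  (inverse_operators_sym WV) mWe totW)) => l _; last exact: Winv_W.
- by apply: (iso_mem iV); apply: (iso_mem iW); exact: H_e.
- exact: H_e.
Qed.

End Unitary.

Lemma spectrumE : spectrum Omega Lam <-> orthonormal_basis H Lam (@e_ R).
Proof.
suff E : (fun l x => (Num.sqrt (fine (leb Omega)))^-1%:C%C * e_ l x) = @e_ R.
  by rewrite /spectrum E.
apply/funext => l; apply/funext => x.
have -> : leb Omega = 1%E := O1.
by rewrite /= sqrtr1 invr1 mul1r.
Qed.

Lemma spectrum_unitary : spectrum Omega Lam <->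
  {ae leb, forall x, cell x -> M_ x \is unitarymx}.
Proof.
split=> [/spectrumE[[_ orth tot] _]|U].
  by apply: orthogonal_total_unitary => // l l' Ll Ll' ll'; exact: orth.
apply/spectrumE; split; last first.
  by move=> _ [i [n ->]]; rewrite unitary_hip_exp// !eqxx.
split.
- move=> _ [i [n ->]]; split; first exact: H_e.
  by rewrite unitary_hip_exp// !eqxx /=; apply/eqP; exact: oner_neq0.
- move=> _ _ [i [n ->]] [j [m ->]] ne; rewrite unitary_hip_exp//.
  case: eqP => //= ij; case: eqP => // nm; exfalso; apply: ne.
  by rewrite ij nm.
- exact: unitary_total.
Qed.

End FiberExponentials.

(** * Finite spectra *)

Section FiniteSpectrum.
Variable R : realType.
Local Notation mR := (measurableTypeR R).
Local Notation C := R[i].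
Local Notation Re := complex.Re.
Local Notation normc := ComplexField.Normc.normc.

Section ColumnSpace.
Variable n : nat.

(** C^n with plain equality as [heqv]: the model to which L^2 of the uniform measure on n points is
    compared. *)
Definition column_space : hspace C :=
  {| hvec := 'cV[C]_n;
     hmem := setT;
     heqv := fun u v => u = v;
     hip := fun u v => \sum_i u i ord0 * (v i ord0)^* |}.

Lemma column_prehilbert : prehilbert column_space.
Proof.
split=> //.
- move=> a f g k _ _ _; rewrite /hip /= mulr_sumr -big_split; apply: eq_bigr => i _.
  by rewrite !mxE mulrDl mulrA.
- move=> f g _ _; rewrite /hip /= rmorph_sum; apply: eq_bigr => i _.
  rewrite rmorphM mulrC; congr (_ * _); exact/esym/conjCK.
- by move=> f _; rewrite /hip /=; apply: sumr_ge0 => i _; exact: mul_conjC_ge0.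
- by move=> f g k -> ->.
- by move=> a f f' g g' -> ->.
- by move=> f f' g _ _ _ ->.
- move=> f _; rewrite /hip /= => /eqP; rewrite psumr_eq0; last first.
    by move=> i _; exact: mul_conjC_ge0.
  move=> /allP f0; apply/matrixP => i j; rewrite (ord1 j) mxE.
  by have := f0 i (mem_index_enum i); rewrite mul_conjC_eq0 => /eqP.
Qed.

Lemma nsq_column (u : hvec column_space) : nsq u = \sum_i normc (u i ord0) ^+ 2.
Proof.
rewrite /nsq /= (big_morph _ (@ReD R) (erefl : Re 0 = 0)).
by apply: eq_bigr => i _; rewrite mulc_conj.
Qed.

End ColumnSpace.

Variables (A : set R) (n : nat) (a : 'I_n -> R).
Hypotheses (n0 : (0 < n)%N) (a_inj : injective a) (AE : A = range a).
Local Notation mu := (uniform_measure A).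
Local Notation U := (L2 mu setT).
Local Notation E := (column_space n).
Let pU : prehilbert U := L2_prehilbert mu measurableT.
Let pE : prehilbert E := column_prehilbert n.

Lemma finite_range_ord : finite_set A.
Proof. by rewrite AE; apply: finite_image; exact: finite_finset. Qed.

Lemma enum_range_perm : perm_eq (fset_set A) [seq a i | i <- enum 'I_n].
Proof.
apply: uniq_perm; [exact: fset_uniq| |].
  by rewrite map_inj_uniq// enum_uniq.
move=> y; rewrite in_fset_set; last exact: finite_range_ord.
rewrite AE; apply/idP/mapP.
  by rewrite inE => -[i _ <-]; exists i => //; rewrite mem_enum.
by move=> [i _ ->]; rewrite inE; exists i.
Qed.

(** [uniform_measure] follows the internal enumeration of [fset_set A]; a permutation leads to the
    enumeration a. *)
Lemma ge0_integral_uniform (f : R -> \bar R) :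
  measurable_fun setT (f : mR -> \bar R) -> (forall x, (0 <= f x)%E) ->
  (\int[mu]_x f x = ((n%:R : R)^-1)%:E * \sum_(i < n) f (a i))%E.
Proof.
move=> mf f0; have szE : size (fset_set A) = n.
  by rewrite (perm_size enum_range_perm) size_map size_enum_ord.
rewrite /uniform_measure ge0_integral_mscale//= ge0_integral_measure_sum// szE.
congr (_ * _)%E.
pose t : seq R := fset_set A.
transitivity (\sum_(i < n) f (nth 0%R t i))%E.
  apply: eq_bigr => i _; apply: etrans (integral_dirac _ measurableT mf) _.
  by rewrite diracT mul1e.
rewrite -(big_mkord xpredT (fun i => f (nth 0%R t i))) -{1}szE -(big_nth 0%R xpredT).
by rewrite (perm_big _ enum_range_perm)/= big_map big_enum.
Qed.

Lemma uniform_mem (f : R -> C) : hmem U f <-> cmeasurable (f : mR -> C).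
Proof.
split=> [[]//|mf]; split=> //; rewrite ge0_integral_uniform//.
- by rewrite sumEFin -EFinM ltry.
- by apply/measurable_EFinP; exact: measurable_normc2.
- by move=> x; rewrite lee_fin sqr_ge0.
Qed.

(** The factor 1 / sqrt n turns the mean over A into the plain sum of [column_space]. On a scaled
    fiber the sampled exponentials are the columns v_i(x). *)
Definition sample (f : R -> C) : 'cV[C]_n :=
  ((Num.sqrt (n%:R : R))%:C%C)^-1 *: \col_i f (a i).

Lemma sample_linear (b : C) f g :
  sample (fun x => b * f x + g x) = b *: sample f + sample g.
Proof.
apply/matrixP => i j; rewrite !mxE.
have L (s y z : C) : s * (b * y + z) = b * (s * y) + s * z by ring.
exact: L.
Qed.

Lemma nsq_sample f : cmeasurable (f : mR -> C) ->
  nsq (sample f : hvec E) = nsq (f : hvec U).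
Proof.
move=> mf; rewrite nsq_column nsq_L2 /Rintegral.
rewrite ge0_integral_uniform//; last 2 first.
- by apply/measurable_EFinP; exact: measurable_normc2.
- by move=> x; rewrite lee_fin sqr_ge0.
rewrite sumEFin -EFinM /= mulr_sumr; apply: eq_bigr => i _.
rewrite !mxE ComplexField.Normc.normcM exprMn -fmorphV; congr (_ * _).
by rewrite normc_real exprVn sqr_sqrtr.
Qed.

Lemma sample_isometry : linear_isometry (sample : hvec U -> hvec E).
Proof.
split.
(* Almost everywhere equality becomes equality of samples through norms: nsq (f - g) = 0. *)
- split=> // f g mf mg fg.
  have mfg := memB pU mf mg; have z := ph0 pU.
  have fg0 : heqv U ((f : hvec U) - g) 0.
    by rewrite -[X in heqv _ _ X](subrr (g : hvec U)); apply: (eqvB pU fg); exact: ph_refl.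
  have := nsq_sample ((uniform_mem _).1 mfg).
  rewrite (nsq_eqv pU mfg z fg0) {2}/nsq (hip0l pU z).
  have -> : (f : hvec U) - g = (fun x => (-1) * g x + f x).
    by apply/funext => x; rewrite mulN1r addrC.
  rewrite sample_linear scaleN1r addrC.
  exact: (nsqB0_eqv pE (f := sample f) (g := sample g)).
- by move=> b f g _ _; exact: sample_linear.
- by move=> f mf; rewrite !hnorm_nsq nsq_sample//; exact: (uniform_mem _).1.
Qed.

Definition unsample (u : 'cV[C]_n) (x : R) : C :=
  \sum_i if x == a i then (Num.sqrt (n%:R : R))%:C%C * u i ord0 else 0.

Lemma cmeasurable_unsample u : cmeasurable (unsample u : mR -> C).
Proof.
apply: cmeasurable_sum => i.
have mb : measurable_fun setT (fun x : mR => (x : R) == a i).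
  apply: measurable_fun_eqr; [exact: measurable_id|exact: measurable_cst].
split.
  under eq_fun do rewrite (fun_if (@complex.Re R)).
  by apply: measurable_fun_ifT => //; exact: measurable_cst.
under eq_fun do rewrite (fun_if (@complex.Im R)).
by apply: measurable_fun_ifT => //; exact: measurable_cst.
Qed.

Lemma sqrtn_neq0 : (Num.sqrt (n%:R : R))%:C%C != 0 :> C.
Proof. by rewrite (inj_eq (@complexI R)) gt_eqF// sqrtr_gt0 ltr0n. Qed.

Lemma unsampleK u : sample (unsample u) = u.
Proof.
apply/matrixP => i j; rewrite (ord1 j) !mxE /unsample (bigD1 i)//= eqxx.
rewrite big1 => [|k ki]; last by rewrite (inj_eq a_inj) eq_sym (negbTE ki).
by rewrite addr0 mulrA mulVf ?mul1r// sqrtn_neq0.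
Qed.

Variable lam : 'I_n -> R.

Definition sample_gram i j : C :=
  hip E (sample (e_ (lam i))) (sample (e_ (lam j))).

Lemma U_e l : hmem U (e_ l : R -> C).
Proof. by apply/uniform_mem; exact: cmeasurable_e. Qed.

Lemma hip_sample i j : hip U (e_ (lam i)) (e_ (lam j)) = sample_gram i j.
Proof. by rewrite -(iso_hip pU pE sample_isometry (U_e _) (U_e _)). Qed.

(** A basis indexed by the set [range lam] leaves lam i = lam j with i != j possible. Then the
    square matrix of samples has two equal columns, hence a left kernel vector, and this gives a
    nonzero function orthogonal to all the exponentials, against totality. *)
Lemma orthogonal_basis_gram : orthogonal_basis U (range lam) (@e_ R) ->
  forall i j, i != j -> sample_gram i j = 0.
Proof.
move=> [me orth tot] i j ij.
have [lij|] := eqVneq (lam i) (lam j); last first.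
  by move=> /eqP lij; rewrite -hip_sample; apply: orth.
exfalso; pose B := \matrix_(k, l) sample (e_ (lam l)) k ord0.
have : \det B == 0.
  rewrite -det_tr (determinant_alternate ij)// => k.
  by rewrite !mxE lij.
move=> /det0P[v v0 vB].
(* [hip] conjugates its second argument, so the product with the l-th exponential is the conjugate
   of the l-th entry of v B. *)
pose f := unsample (\col_k (v ord0 k)^*).
have mf : hmem U f by apply/uniform_mem; exact: cmeasurable_unsample.
have me' l : range lam l -> hmem U (e_ l) by move=> _; exact: U_e.
have f0 : heqv U f 0.
  apply: (total_orth pU me' tot mf) => _ [l _ <-].
  rewrite -(iso_hip pU pE sample_isometry mf (U_e _)) unsampleK /hip /=.
  transitivity (((v *m B) ord0 l)^*); last by rewrite vB mxE conjC0.
  rewrite mxE rmorph_sum; apply: eq_bigr => k _.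
  by rewrite [(\col__ _) _ _]mxE rmorphM [B k l]mxE.
have := iso_eqv sample_isometry mf (ph0 pU) f0.
rewrite unsampleK => /= uE; move/eqP : v0; apply.
have s0 : sample (0 : hvec U) = 0.
  by apply/matrixP => k l; rewrite !mxE mulr0.
apply/matrixP => k l; rewrite (ord1 k) mxE.
have := congr1 (fun z : 'cV[C]_n => (z l ord0)^*) uE.
by rewrite s0 !mxE conjCK conjC0.
Qed.

(** For the square matrix B of samples, B^* B = 1 gives B B^* = 1, an exact expansion of every
    sample: the approximation error is 0 for all eps. *)
Lemma gram_orthogonal_basis : (forall i j, sample_gram i j = (i == j)%:R) ->
  orthogonal_basis U (range lam) (@e_ R).
Proof.
move=> gr; split.
- move=> _ [i _ <-]; split; first exact: U_e.
  by rewrite hip_sample gr eqxx; apply/eqP; exact: oner_neq0.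
- move=> _ _ [i _ <-] [j _ <-] lij; rewrite hip_sample gr.
  by case: eqP => // ij; rewrite ij in lij.
have me l : range lam l -> hmem U (e_ l) by move=> _; exact: U_e.
apply: (nsq_total pU me) => f mf eps e0.
pose c j := hip E (sample f) (sample (e_ (lam j))).
have [s [d [sS sE]]] := comb_reindex (@e_ R : R -> hvec U) (enum 'I_n) lam c.
exists s, d; split.
  by move=> l /sS /mapP[i _ ->]; exists i.
rewrite sE (_ : nsq _ = 0)//.
have mg : hmem U (\sum_(j <- enum 'I_n) c j *: (e_ (lam j) : hvec U)).
  by apply: (mem_sum pU) => j _; apply: (memZ pU); exact: U_e.
rewrite -(iso_nsq pU pE sample_isometry (memB pU mf mg)).
have -> : sample ((f : hvec U) - \sum_(j <- enum 'I_n) c j *: (e_ (lam j) : hvec U)) = 0.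
  have -> := iso_B sample_isometry mf mg.
  have -> := iso_sum pU pE sample_isometry c (fun j _ => U_e (lam j)).
  apply/eqP; rewrite subr_eq0 big_enum /=; apply/eqP/matrixP => k l; rewrite (ord1 l).
  pose B := \matrix_(k, l) sample (e_ (lam l)) k ord0.
  have BB : B *m (B ^t*)%sesqui = 1%:M.
    apply/mulmx1C/matrixP => i j; rewrite [RHS]mxE eq_sym -gr mxE.
    by apply: eq_bigr => m _; rewrite !mxE mulrC.
  rewrite summxE -[sample f]mul1mx -BB -mulmxA mxE; apply: eq_bigr => i _.
  rewrite [RHS]mxE mulrC; congr (_ * _); last by rewrite mxE.
  rewrite mxE; apply: eq_bigr => m _; rewrite mulrC; congr (_ * _).
  by rewrite !mxE.
by rewrite /nsq (hip0l pE).
Qed.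

End FiniteSpectrum.

(** * Local translations *)

Section LocalTranslations.
Variable R : realType.
Local Notation leb := (@lebesgue_measure R).
Local Notation mR := (measurableTypeR R).
Local Notation C := R[i].
Local Notation Re := complex.Re.
Local Notation normc := ComplexField.Normc.normc.
Variables (Omega : set R) (p : nat) (hp : (0 < p)%N).
Hypothesis Obnd : bounded_set (Omega : set R^o).
Hypothesis Omeas : measurable (Omega : set mR).
Hypothesis O1 : leb Omega = 1%E.
Hypothesis Otile : p_tiles Omega p.
Local Notation h := ((p%:R : R)^-1).
Local Notation cell := (cell p : set R).
Local Notation fiber := (fiber Omega p).
Local Notation k_ := (k_ Omega p).
Local Notation good := (good Omega p).
Local Notation W := (W Omega p).
Local Notation H := (L2Omega Omega).
Local Notation K := (L2cell R p).
Local Notation H1 := (L2 leb cell).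
Variable lam : 'I_p -> R.
Local Notation v_ := (v_ Omega lam).
Local Notation M_ := (M_ Omega lam).
Local Notation Lam := (spectrum_form lam).
Local Notation Up := (Up Omega lam).
Local Notation cell_part := (cell_part p).
Let h0 : 0 < h := h_gt0 R hp.
Let mcell : measurable (cell : set mR) := measurable_itv _.
Let pH : prehilbert H := prehilbert_Omega Omeas.
Let pK : prehilbert K := prehilbert_cell R p.
Let pH1 : prehilbert H1 := L2_prehilbert leb mcell.

(** Sampling e_(lam i) on the fiber gives v_i(x), so both sides say that [vgram] is the identity. *)
Lemma finite_spectrum_unitary x : good x ->
  finite_spectrum (scaled_fiber Omega p x) (range lam) <-> M_ x \is unitarymx.
Proof.
move=> gx; pose a (i : 'I_p) : R := (k_ i x)%:~R / p%:R.
have a_inj : injective a.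
  move=> i j /divIf; rewrite pnatr_eq0 -lt0n => /(_ hp)/eqP.
  by rewrite eqr_int => /eqP; exact: k_inj.
have AE : scaled_fiber Omega p x = range a.
  apply/seteqP; split=> y.
    move=> [k /(fiber_kP hp Obnd gx)[i ->] <-]; by exists i.
  move=> [i _ <-]; exists (k_ i x) => //.
  exact: (k_fiber hp Obnd gx (ltn_ord i)).
have gramE i j : sample_gram a lam i j = vgram Omega lam i j x.
  apply: eq_bigr => k _; rewrite !vE.
  by rewrite [sample a (e_ (lam i)) k ord0]mxE [sample a (e_ (lam j)) k ord0]mxE
    [(\col__ _) k _]mxE [(\col__ _) k _ in X in _ * X^*]mxE.
split=> [[_ ob]|/M_unitaryE gr].
  apply/M_unitaryE => // i j; have [->|ij] := eqVneq i j; first exact: vgram_diag.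
  by rewrite -gramE (orthogonal_basis_gram hp a_inj AE ob).
split; first by rewrite AE; apply: finite_image; exact: finite_finset.
apply: (gram_orthogonal_basis a_inj AE) => i j.
by rewrite gramE gr.
Qed.

Lemma adj_entry m n (A : 'M[C]_(m, n)) i j : (A ^t*)%sesqui i j = (A j i)^*.
Proof. by rewrite !mxE. Qed.

Lemma adj_mul_self n (u : 'cV[C]_n) :
  ((u ^t*)%sesqui *m u) ord0 ord0 = \sum_k u k ord0 * (u k ord0)^*.
Proof. by rewrite mxE; apply: eq_bigr => k _; rewrite adj_entry mulrC. Qed.

Lemma adj_mul m n q (A : 'M[C]_(m, n)) (B : 'M[C]_(n, q)) :
  ((A *m B) ^t*)%sesqui = (B ^t*)%sesqui *m (A ^t*)%sesqui.
Proof.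
apply/matrixP => i j; rewrite !mxE rmorph_sum; apply: eq_bigr => k _.
by rewrite !mxE rmorphM mulrC.
Qed.

Lemma adjK m n (A : 'M[C]_(m, n)) : ((A ^t*) ^t*)%sesqui = A.
Proof. by apply/matrixP => i j; rewrite !mxE conjCK. Qed.

Lemma good_ae : {ae leb, forall x, good x}.
Proof. exact: ae_good. Qed.

Lemma ae_finite_spectrum :
  {ae leb, forall x : R, cell x ->
    finite_spectrum (scaled_fiber Omega p x) (range lam)} <->
  {ae leb, forall x, cell x -> M_ x \is unitarymx}.
Proof.
split; move: good_ae; apply: aeS2 => x gx fx cx;
  exact/(finite_spectrum_unitary gx)/fx.
Qed.

(** The points x + k_i(x)/p do not change when x moves by 1/p. *)
Lemma W_periodic f x : good x -> periodize (W f) x = W f x.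
Proof.
move=> gx; rewrite periodizeE; apply/matrixP => k l; rewrite !mxE.
rewrite -[in RHS](cell_partE p x) k_shift ?good_cell_part//.
by rewrite intrB mulrBl addrACA subrr addr0.
Qed.

Lemma v_col i x : v_ i x = M_ x *m delta_mx i ord0.
Proof.
by rewrite -colE; apply/matrixP => k l; rewrite (ord1 l) [RHS]mxE ME.
Qed.

Section Group.
Hypothesis aeU : {ae leb, forall x, cell x -> M_ x \is unitarymx}.

Lemma ae_unitary : {ae leb, forall x, M_ x \is unitarymx}.
Proof.
move: (ae_cell_part hp aeU) good_ae; apply: aeS2 => x Ux gx.
by rewrite -(cell_partE p x); apply: M_unitary_shift => //; rewrite good_cell_part.
Qed.

Lemma ae_frames t : {ae leb, forall x, [/\ good x, good (x + t),
  M_ x *m (M_ x ^t*)%sesqui = 1%:M & (M_ (x + t) ^t*)%sesqui *m M_ (x + t) = 1%:M]}.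
Proof.
have gu : {ae leb, forall x, good x /\ M_ x *m (M_ x ^t*)%sesqui = 1%:M}.
  by move: good_ae ae_unitary; apply: aeS2 => x gx /unitarymxP.
move: gu (ae_translate t gu); apply: aeS2 => x [gx Ux] [gt /mulmx1C Ut].
by split.
Qed.

(** Transition from the fiber over x + t to the fiber over x: for orthonormal frames it sends v_i(x
    + t) to v_i(x). *)
Definition frame t x : 'M[C]_p := M_ x *m (M_ (x + t) ^t*)%sesqui.

Lemma UpE t F x : Up t F x = frame t x *m periodize F (x + t).
Proof. by []. Qed.

(** [M_mul_shift] makes the matrix factor 1/p-periodic. The group law relies on this, since [Up s]
    reads [Up t F] through [periodize]. *)
Lemma Up_periodic t F : {ae leb, forall x, periodize (Up t F) x = Up t F x}.
Proof.
move: good_ae (ae_translate t good_ae); apply: aeS2 => x gx gxt.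
have gy : good (cell_part x) by rewrite good_cell_part.
set n := cell_index p x.
have xE : x = cell_part x + n%:~R / p%:R by rewrite cell_partE.
have xtE : x + t = cell_part x + t + n%:~R / p%:R by rewrite {1}xE addrAC.
have gyt : good (cell_part x + t) by rewrite -(good_shift hp Obnd _ n) -xtE.
rewrite periodizeE !UpE.
have -> : periodize F (x + t) = periodize F (cell_part x + t).
  by rewrite !periodizeE xtE cell_part_periodic.
by rewrite /frame -(M_mul_shift hp Obnd _ n gy gyt) -xE -xtE.
Qed.

Lemma frame_unitary t : {ae leb, forall x, (frame t x ^t*)%sesqui *m frame t x = 1%:M}.
Proof.
apply: aeS (ae_frames t) => x [_ _ Ux /mulmx1C Uxt].
rewrite /frame; move: (M_ x) (M_ (x + t)) Ux Uxt => A B /mulmx1C AA BB.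
by rewrite adj_mul adjK -mulmxA [X in _ *m X]mulmxA AA mul1mx.
Qed.

Lemma frame_entry t x k l : frame t x k l =
  \sum_i v_ i x k ord0 * (v_ i (x + t) l ord0)^*.
Proof. by rewrite mxE; apply: eq_bigr => i _; rewrite (adj_entry (M_ (x + t)) i l) (ME _ _ x) (ME _ _ (x + t)). Qed.

Lemma cmeasurable_frame t k l : cmeasurable (fun x : mR => frame t x k l).
Proof.
under eq_fun do rewrite frame_entry.
apply: cmeasurable_sum => i; apply: cmeasurableM; first exact: cmeasurable_v.
apply: cmeasurable_conj; have [m1 m2] := cmeasurable_v hp Obnd Omeas lam i l.
by split; [exact: (measurable_fun_translate t m1)|exact: (measurable_fun_translate t m2)].
Qed.

Lemma frame_bound t k l x : normc (frame t x k l) <= \sum_(i < p) 1.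
Proof.
rewrite frame_entry; apply: (le_trans (normc_sum_le _ _)).
by apply: ler_sum => i _; apply: normc_mul_le1; rewrite ?normc_conj; exact: normc_v_le1.
Qed.

Lemma cmeasurable_periodize (F : R -> 'cV[C]_p) t k :
  cmeasurable (fun x : mR => F x k ord0) ->
  cmeasurable (fun x : mR => periodize F (x + t) k ord0).
Proof.
move=> [m1 m2].
have c1 := measurableT_comp m1 (measurable_cell_part p).
have c2 := measurableT_comp m2 (measurable_cell_part p).
by split; [exact: (measurable_fun_translate t c1)|
  exact: (measurable_fun_translate t c2)].
Qed.

Lemma integral_periodize (F : R -> 'cV[C]_p) t k :
  cmeasurable (fun x : mR => F x k ord0) ->
  (\int[leb]_(x in cell) (normc (periodize F (x + t)%R k ord0) ^+ 2)%:E =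
   \int[leb]_(x in cell) (normc (F x k ord0) ^+ 2)%:E)%E.
Proof.
move=> mF; pose f (x : R) := (normc (periodize F x k ord0) ^+ 2)%:E.
transitivity (\int[leb]_(x in cell) f x)%E.
  apply: (ge0_integral_periodic h0 (f := f)).
  - apply/measurable_EFinP; apply: measurable_normc2.
    have := cmeasurable_periodize 0 mF.
    by congr cmeasurable; apply/funext => x; rewrite addr0.
  - by move=> x; rewrite lee_fin sqr_ge0.
  - move=> x; rewrite /f !periodizeE.
    by have := cell_part_periodic hp x 1; rewrite mul1r => ->.
apply: eq_integral => x; rewrite inE => cx.
by rewrite /f periodizeE cell_part_id.
Qed.

Lemma translate_mem F t : hmem K F -> hmem K (fun x => periodize F (x + t)).
Proof.
move=> mF k; split; first exact: cmeasurable_periodize (mF k).1.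
by rewrite integral_periodize ?(mF k).2//; exact: (mF k).1.
Qed.

Lemma translate_nsq F t : hmem K F ->
  nsq ((fun x => periodize F (x + t)) : hvec K) = nsq (F : hvec K).
Proof.
move=> mF; rewrite !nsq_L2vec; apply: eq_bigr => k _; congr fine.
by rewrite integral_periodize//; exact: (mF k).1.
Qed.

Lemma Up_mem t F : hmem K F -> hmem K (Up t F).
Proof.
move=> /(translate_mem t) mF k.
have -> : (fun x => Up t F x k ord0) = \sum_l
   ((fun x => frame t x k l * periodize F (x + t) l ord0) : hvec H1).
  apply/funext => x; rewrite UpE mxE.
  by rewrite (big_morph (fun g : hvec H1 => g x) (id1 := 0) (op1 := +%R)).
apply: (mem_sum pH1) => l _.
apply: (@L2_mul_bounded _ mR R leb cell mcell (\sum_(i < p) 1)) => //.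
  exact: cmeasurable_frame.
by move=> x _; exact: frame_bound.
Qed.

(** [Up] mixes components, so norms are compared through pointwise lengths of vectors rather than
    entry by entry. *)
Lemma nsq_ae (F G : R -> 'cV[C]_p) : hmem K F -> hmem K G ->
  {ae leb, forall x, cell x -> ((F x)^t*)%sesqui *m F x = ((G x)^t*)%sesqui *m G x} ->
  nsq (F : hvec K) = nsq (G : hvec K).
Proof.
move=> mF mG FG; rewrite /nsq /hip /= -!(cintegral_sum mcell); last 2 first.
- by move=> k; exact: L2_prod_int (mG k) (mG k).
- by move=> k; exact: L2_prod_int (mF k) (mF k).
congr (Re _); apply: (cintegral_ae mcell).
- apply: cmeasurable_sum => k; apply: cmeasurableM; first exact: (mF k).1.
  by apply: cmeasurable_conj; exact: (mF k).1.
- apply: cmeasurable_sum => k; apply: cmeasurableM; first exact: (mG k).1.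
  by apply: cmeasurable_conj; exact: (mG k).1.
- apply: aeS FG => x FGx cx.
  by have := congr1 (fun A : 'M[C]_1 => A ord0 ord0) (FGx cx);
    rewrite /= !adj_mul_self.
Qed.

Lemma Up_isometry t : linear_isometry (Up t : hvec K -> hvec K).
Proof.
split.
- split=> [F|F G _ _ FG]; first exact: Up_mem.
  apply: aeS (ae_translate t (ae_cell_part hp FG)) => x FGx cx.
  by rewrite !UpE !periodizeE FGx.
- move=> a F G _ _; suff -> : Up t (a *: F + G) = a *: (Up t F : hvec K) + Up t G.
    exact: (ph_refl pK).
  apply/funext => x; rewrite UpE.
  have -> : periodize (a *: F + G) (x + t) =
    a *: periodize F (x + t) + periodize G (x + t) by [].
  by rewrite mulmxDr -scalemxAr.
- move=> F mF; rewrite !hnorm_nsq -(translate_nsq t mF); congr Num.sqrt.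
  apply: nsq_ae; [exact: Up_mem|exact: translate_mem|].
  apply: aeS (frame_unitary t) => x Ux cx; rewrite UpE.
  move: (frame t x) (periodize F (x + t)) Ux => A u AA.
  by rewrite adj_mul -mulmxA [X in _ *m X]mulmxA AA mul1mx.
Qed.

Lemma Up0 F : heqv K (Up 0 F) F.
Proof.
apply: aeS (ae_frames 0) => x [_ _ Ux _] cx.
by rewrite UpE /frame addr0 Ux mul1mx periodizeE cell_part_id.
Qed.

(** The product of the two frames telescopes by M_(x+s)^* M_(x+s) = 1. *)
Lemma UpD s t F : heqv K (Up (s + t) F) (Up s (Up t F)).
Proof.
move: (ae_frames s) (ae_translate s (Up_periodic t F)).
apply: aeS2 => x [_ _ _ Uxs] pU _.
rewrite [RHS]UpE pU !UpE /frame addrA.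
move: (M_ x) (M_ (x + s)) (M_ (x + s + t)) (periodize _ _) Uxs => A B D u BB.
by rewrite -!mulmxA [(B ^t*)%sesqui *m _]mulmxA BB mul1mx.
Qed.

Lemma Up_inverse t : inverse_operators K K (Up t) (Up (- t)).
Proof.
have inv s F : heqv K (Up (- s) (Up s F)) F.
  apply: (ph_trans pK (ph_sym pK (UpD (- s) s F))).
  by rewrite addNr; exact: Up0.
split; [by case: (Up_isometry t)|by case: (Up_isometry (- t))| |] => F _.
  exact: inv.
by have := inv (- t) F; rewrite opprK.
Qed.

Lemma Up_eigen t l : Lam l -> heqv K (Up t (W (e_ l))) (e_ l t *: (W (e_ l) : hvec K)).
Proof.
move=> [i [n ->]]; apply: aeS (ae_frames t) => x [gx gxt _ Uxt] cx.
rewrite UpE W_periodic// /frame W_exp_v// -scalemxAr v_col mulmxA -(mulmxA (M_ x)).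
rewrite Uxt mulmx1 -v_col.
have -> : (e_ (lam i + n%:~R * p%:R) t *: (W (e_ (lam i + n%:~R * p%:R)) : hvec K)) x
  = e_ (lam i + n%:~R * p%:R) t *: W (e_ (lam i + n%:~R * p%:R)) x by [].
rewrite (W_exp_v _ hp) scalerA e_Dr [in RHS]mulrC -[in RHS]mulrA.
by [].
Qed.

Let iW : linear_isometry (W : hvec H -> hvec K) := W_isometry hp Obnd Omeas Otile.
Let WV : inverse_operators H K W (fun F => Winv Omega F) := W_Winv_inverse hp Obnd Omeas Otile.
Let me l : Lam l -> hmem H (e_ l) := fun _ => H_e Omeas O1 l.
Let mWe l : Lam l -> hmem K (W (e_ l)) := fun Ll => iso_mem iW (me Ll).
Let tot : total_family (H := H) Lam (@e_ R) := unitary_total hp Obnd Omeas O1 Otile aeU.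
Let totW : total_family (H := K) Lam (fun l => W (e_ l)) :=
  total_isometry pH pK iW WV me tot.

Lemma Up_group : sc_unitary_group K Up.
Proof.
split.
- by move=> t; split; [exact: Up_isometry|exists (Up (- t)); exact: Up_inverse].
- by move=> F _; exact: Up0.
- by move=> s t F _; exact: UpD.
- apply: (eigenvectors_continuous pK Up_isometry mWe totW (chi := @e_ R)).
    by move=> l t; exact: Up_eigen.
  by move=> l t _; exact: normc_e_dist.
Qed.

(** The group is W^-1 U_p(t) W; the inverse carries the eigenvalue relation from W e_l back to
    e_l. *)
Lemma local_translations_exist : exists U, local_translations Omega Lam U.
Proof.
exists (fun t f => Winv Omega (Up t (W f))); split.
  exact: (sc_unitary_group_conj pH pK iW WV Up_group).
move=> l t Ll; have iV := linear_isometry_inv pH pK iW WV.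
have mUe := iso_mem (Up_isometry t) (mWe Ll).
have mZ : hmem K (e_ l t *: (W (e_ l) : hvec K)) by apply: (memZ pK); exact: mWe.
apply: (ph_trans pH (iso_eqv iV mUe mZ (Up_eigen t Ll))).
apply: (ph_trans pH (iso_Z pK pH iV _ (mWe Ll))).
apply: (eqvZ pH); exact: Winv_W.
Qed.

Lemma W_local_translations U : local_translations Omega Lam U ->
  forall (t : R) f, hmem H f -> heqv K (W (U t f)) (Up t (W f)).
Proof.
move=> [[Uiso _ _ _] Ue] t f mf; have [iU _] := Uiso t.
apply: (isometry_ext pH pK me tot (linear_isometry_comp pH pH pK iU iW)
  (linear_isometry_comp pH pK pK iW (Up_isometry t))) => // l Ll.
have mUe := iso_mem iU (me Ll).
apply: (ph_trans pK _ (ph_sym pK (Up_eigen t Ll))).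
apply: (ph_trans pK _ (iso_Z pH pK iW _ (me Ll))).
by apply: (iso_eqv iW mUe); [apply: (memZ pH); exact: me|exact: Ue].
Qed.

End Group.

End LocalTranslations.

Theorem theorem2p12 (R : realType) (Omega : set R) (p : nat) (hp : (0 < p)%N)
    (Obnd : bounded_set (Omega : set R^o))
    (Omeas : measurable (Omega : set (measurableTypeR R)))
    (O1 : @lebesgue_measure R Omega = 1%E)
    (Otile : p_tiles Omega p) :
  [/\ (* (a) *)
      {ae @lebesgue_measure R, forall x : R,
        [/\ fiber Omega p x #= `I_p,
            fiber Omega p x = range (fun i : 'I_p => k_ Omega p i x) &
            forall i j : 'I_p, (i < j)%N -> k_ Omega p i x < k_ Omega p j x]},
      (* (b) *)
      {ae @lebesgue_measure R, forall x : R, Omega x ->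
        exists! yi : R * 'I_p,
          cell p yi.1 /\ yi.1 + (k_ Omega p yi.2 yi.1)%:~R / p%:R = x},
      (* (c) *)
      {ae @lebesgue_measure R, forall x : R, forall i : 'I_p,
        k_ Omega p i (x + p%:R^-1) = k_ Omega p i x - 1},
      (* (d) *)
      isometric_isomorphism (L2Omega Omega) (L2cell R p) (W Omega p) /\
      (exists V : (R -> 'cV[R[i]]_p) -> (R -> R[i]^o),
        inverse_operators (L2Omega Omega) (L2cell R p) (W Omega p) V /\
        forall F, hmem (L2cell R p) F ->
          {ae @lebesgue_measure R, forall x : R, Omega x ->
            forall (y : R) (i : 'I_p), cell p y ->
              x = y + (k_ Omega p i y)%:~R / p%:R -> V F x = F y i ord0}) &
      forall lam : 'I_p -> R, lam (Ordinal hp) = 0 ->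
      [/\ (* (e) *)
          spectrum Omega (spectrum_form lam) <->
          {ae @lebesgue_measure R, forall x : R, cell p x ->
            finite_spectrum (scaled_fiber Omega p x) (range lam)},
          (* (f) *)
          (forall (i : 'I_p) (n : int) (x : R), cell p x ->
            W Omega p (e_ (lam i + n%:~R * p%:R)) x =
            e_ (lam i + n%:~R * p%:R) x *:
              \col_(j < p) e_ (lam i) ((k_ Omega p j x)%:~R / p%:R)) &
          (* (g) *)
          spectrum Omega (spectrum_form lam) ->
          [/\ {ae @lebesgue_measure R, forall x : R,
                M_ Omega lam x \is unitarymx},
              (* the formula defining Up is compatible with periodization *)
              (forall (t : R) F, hmem (L2cell R p) F ->
                {ae @lebesgue_measure R, forall x : R,
                  periodize (Up Omega lam t F) x = Up Omega lam t F x}),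
              sc_unitary_group (L2cell R p) (Up Omega lam),
              (exists U, local_translations Omega (spectrum_form lam) U) &
              forall U, local_translations Omega (spectrum_form lam) U ->
                forall (t : R) f, hmem (L2Omega Omega) f ->
                  heqv (L2cell R p) (W Omega p (U t f))
                    (Up Omega lam t (W Omega p f))]]].
Proof.
split.
- exact: fiber_structure.
- exact: cell_decomposition_unique.
- exact: k_periodic_ae.
- have iW := W_isometry hp Obnd Omeas Otile.
  have WV := W_Winv_inverse hp Obnd Omeas Otile.
  split; first by split=> //; exists (fun F => Winv Omega F).
  by exists (fun F => Winv Omega F); split=> // F _; exact: Winv_formula.
move=> lam _; have sU := spectrum_unitary hp Obnd Omeas O1 Otile lam.
split.
- exact: iff_trans sU (iff_sym (ae_finite_spectrum hp Obnd Otile lam)).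
- by move=> i n x _; exact: W_exp.
move=> /sU aeU; split.
- exact: ae_unitary.
- by move=> t F _; exact: Up_periodic.
- exact: Up_group.
- exact: local_translations_exist.
- by move=> U; exact: W_local_translations.
Qed.
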